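(* Let $T>0$ and let $f:\mathbb{R}\times[0,\infty)\to\mathbb{R}$ be locally H\''older continuous, of class $C^1$ in $u$, such that $f(t,0)=0$ for all $t$, $f(t+T,u)=f(t,u)$ for all $t\in\mathbb{R}$, $u\ge0$, and $\partial_u f(t,u)$ is locally Lipschitz continuous in $u$ uniformly in $t$. Let $u_0\in L^\infty(\mathbb{R})$ be nonnegative with compact support and suppose the solution $u$ of $u_t=u_{xx}+f(t,u)$ ($x\in\mathbb{R}$, $t>0$), $u(\cdot,0)=u_0$, is bounded. Let $p\in\mathcal{X}_{per}$. Then the spatially constant function $(x,t)\mapsto p(t)$ does not belong to $\widetilde{\omega}(u)$ if one of the following holds for some $\varepsilon>0$: (i) $h(t;a)$ is $T$-monotone decreasing for every $a\in(p(0)-\varepsilon,p(0))$; (ii) $h(t;a)$ is $T$-monotone nonincreasing for every $a\in(p(0)-\varepsilon,p(0)+\varepsilon)$.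
   Context: $h(t;a)$ denotes the solution of $h_t=f(t,h)$, $h(0)=a$. It is $T$-monotone decreasing if $h(t+T;a)<h(t;a)$ for $t\ge0$, $T$-periodic if $h(t+T;a)=h(t;a)$ for $t\ge0$; $T$-monotone nonincreasing means $T$-periodic or $T$-monotone decreasing. $\mathcal{X}_{per}$ is the set of nonnegative $T$-periodic solutions of $p_t=f(t,p)$. An $\omega$-limit solution is an entire solution $v$ of $v_t=v_{xx}+f(t,v)$ on $\mathbb{R}^2$ such that $u(x,t+k_jT)\to v(x,t)$ locally uniformly for some sequence of positive integers $k_j\to\infty$; $\widetilde{\omega}(u)$ is the set of these. *)

(* Defs.v *)
From HB Require Import structures.
From mathcomp Require Import all_boot all_order all_algebra.
From mathcomp Require Import all_classical all_reals all_analysis.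
Set Implicit Arguments. Unset Strict Implicit. Unset Printing Implicit Defensive.
Import Order.TTheory GRing.Theory Num.Theory.
Import numFieldNormedType.Exports.
Local Open Scope classical_set_scope.
Local Open Scope ring_scope.

Section Defs.
Variable R : realType.

(* f is given as a total function R -> R -> R; only its values on u >= 0 matter. *)

Definition loc_holder (f : R -> R -> R) : Prop :=
  forall M : R, 0 < M -> exists alpha C : R, 0 < alpha /\ alpha <= 1 /\
    forall t s u v : R, `|t| <= M -> `|s| <= M -> 0 <= u -> u <= M -> 0 <= v -> v <= M ->
      `|f t u - f s v| <= C * ((`|t - s| + `|u - v|) `^ alpha).

Definition C1_u_loclip (f : R -> R -> R) : Prop :=
  exists fu : R -> R -> R,
    (forall t u : R, 0 < u -> is_derive u 1 (f t) (fu t u)) /\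
    (forall t : R, (fun h : R => (f t h - f t 0) / h) @ 0^'+ --> fu t 0) /\
    (forall t : R, {within [set u : R | 0 <= u], continuous (fu t)}) /\
    (forall M : R, 0 < M -> exists L : R, forall t u v : R,
        0 <= u -> u <= M -> 0 <= v -> v <= M -> `|fu t u - fu t v| <= L * `|u - v|).

Definition f_zero (f : R -> R -> R) : Prop := forall t : R, f t 0 = 0.

Definition f_periodic (T : R) (f : R -> R -> R) : Prop :=
  forall t u : R, 0 <= u -> f (t + T) u = f t u.

(* h is a (nonnegative, i.e. in the domain of f) solution on [0,oo) *)
Definition ode_sol_from (f : R -> R -> R) (a : R) (h : R -> R) : Prop :=
  h 0 = a /\ (forall t : R, 0 <= t -> 0 <= h t) /\
  h x @[x --> 0^'+] --> a /\
  (forall t : R, 0 < t -> is_derive t 1 h (f t (h t))).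

Definition T_mono_decreasing (f : R -> R -> R) (T a : R) : Prop :=
  exists h : R -> R, ode_sol_from f a h /\ forall t : R, 0 <= t -> h (t + T) < h t.

Definition T_periodic_sol (f : R -> R -> R) (T a : R) : Prop :=
  exists h : R -> R, ode_sol_from f a h /\ forall t : R, 0 <= t -> h (t + T) = h t.

Definition T_mono_nonincreasing (f : R -> R -> R) (T a : R) : Prop :=
  T_periodic_sol f T a \/ T_mono_decreasing f T a.

Definition X_per (f : R -> R -> R) (T : R) (p : R -> R) : Prop :=
  (forall t : R, 0 <= p t) /\ (forall t : R, p (t + T) = p t) /\
  (forall t : R, is_derive t 1 p (f t (p t))).

Definition ut (u : R -> R -> R) (x t : R) : R := derive1 (fun s => u x s) t.
Definition ux (u : R -> R -> R) (x t : R) : R := derive1 (fun y => u y t) x.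
Definition uxx (u : R -> R -> R) (x t : R) : R := derive1 (fun y => ux u y t) x.

Definition classical_sol_on (f : R -> R -> R) (D : set R) (u : R -> R -> R) : Prop :=
  forall x t : R, D t ->
    0 <= u x t /\
    derivable (fun s => u x s) t 1 /\
    derivable (fun y => u y t) x 1 /\
    derivable (fun y => ux u y t) x 1 /\
    ut u x t = uxx u x t + f t (u x t) /\
    {for (x, t), continuous (fun q : R * R => u q.1 q.2)} /\
    {for (x, t), continuous (fun q : R * R => ux u q.1 q.2)} /\
    {for (x, t), continuous (fun q : R * R => uxx u q.1 q.2)} /\
    {for (x, t), continuous (fun q : R * R => ut u q.1 q.2)}.

(* initial datum u0 in L^oo, nonnegative, compactly supported (a bounded
   measurable representative) *)
Definition admissible_u0 (u0 : R -> R) : Prop :=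
  measurable_fun [set: R] u0 /\
  (forall x : R, 0 <= u0 x) /\
  (exists M : R, forall x : R, `|u0 x| <= M) /\
  (exists r : R, forall x : R, r < `|x| -> u0 x = 0).

Definition cauchy_sol (f : R -> R -> R) (u0 : R -> R) (u : R -> R -> R) : Prop :=
  classical_sol_on f [set t | 0 < t] u /\
  forall r : R, 0 < r ->
    (fun t : R => (\int[@lebesgue_measure R]_(x in `[(- r)%R, r%R]) (`|u x t - u0 x|)%:E)%E)
      @ 0^'+ --> 0%E.

Definition bounded_sol (u : R -> R -> R) : Prop :=
  exists M : R, forall x t : R, 0 < t -> `|u x t| <= M.

Definition omega_tilde_mem (f : R -> R -> R) (T : R) (u v : R -> R -> R) : Prop :=
  classical_sol_on f setT v /\
  exists k : nat -> nat,
    (forall j, (0 < k j)%N) /\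
    (forall N : nat, exists J : nat, forall j, (J <= j)%N -> (N <= k j)%N) /\
    (forall r eps : R, 0 < r -> 0 < eps -> exists J : nat, forall j, (J <= j)%N ->
       forall x t : R, `|x| <= r -> `|t| <= r ->
         `|u x (t + (k j)%:R * T) - v x t| < eps).

End Defs.

(* Main.v *)
Require Import Defs.
From HB Require Import structures.
From mathcomp Require Import all_boot all_order all_algebra.
From mathcomp Require Import all_classical all_reals all_analysis.
From mathcomp Require Import ring lra.
Set Implicit Arguments. Unset Strict Implicit. Unset Printing Implicit Defensive.
Import Order.TTheory GRing.Theory Num.Theory.
Import numFieldNormedType.Exports.
Local Open Scope classical_set_scope.
Local Open Scope ring_scope.

(* Hypotheses (i), (ii) force p(0) > 0, so p is bounded below; put z = u - p and let
   P = flow g T be the time-T map of the perturbed equation z' = g(t,z).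

   Reflecting in a point x0 outside the support of u0 shows that u(.,t) is monotone on each
   side of the support, and u(x,t) -> 0 as |x| -> oo. Supersolutions are built by letting the
   flow act on a profile: flow g t (psi x t) is a supersolution wherever psi is small and
   psi_t >= psi_xx + C psi_x^2.

   If P a < a for small a < 0, then for small A a cosine profile gives a "bowl": if z lies
   below it on [s-l, s+l] at time 0 and z <= eta at s-l and s+l during one period, then z lies
   below it again at time T. The tail of u starts in such a bowl.
   - If P a <= a for arbitrarily small a > 0, such an a keeps z <= eta for ever, the bowl
     persists, and z cannot tend to 0 at its centre.
   - Otherwise P a > a for small a > 0, and -z has bowls as well. A bowl at s can only be broken
     by z > eta at s-l, which by monotonicity holds on all of [r, s-l] and fills a bowl of -z at
     a point y in between; that one can only be broken by z < -eta' on the right of y + l', and then,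
     by a < 0 => P a < a, the bowl at s is restored within N periods. At every
     period z is therefore away from 0 at y or at s.
   If P q = q for some small q < 0 and P a <= a on [q, eps[, the flow of q plus a decaying Gaussian
   is a supersolution and z <= q + o(1). *)


(** * Maximum principles *)

Lemma is_derive_epsP (R : realType) (f : R -> R) (x l : R) :
  is_derive x 1 f l <->
  forall e : R, 0 < e -> exists2 d : R, 0 < d &
    forall h, `|h| < d -> `|f (x + h) - f x - l * h| <= e * `|h|.
Proof.
split.
- move=> [df dl] e e0.
  have /cvgrPdist_le /(_ e e0) : (fun h => h^-1 *: (f (h *: (1:R) + x) - f x)) @ 0^' --> l.
    by rewrite -dl; exact: df.
  rewrite -nbhs_nearE => /nbhs_ballP [d /= d0 H]; exists d => // h hd.
  have [->|h0] := eqVneq h 0; first by rewrite addr0 subrr mulr0 subrr !normr0 mulr0.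
  have := H h; rewrite /ball /= sub0r normrN => /(_ hd h0).
  rewrite /GRing.scale /= mulr1 (addrC h x) => Hh.
  have -> : f (x + h) - f x - l * h = - ((l - h^-1 * (f (x + h) - f x)) * h).
    by field.
  by rewrite normrN normrM ler_wpM2r.
- move=> H.
  have C : (fun h => h^-1 *: (f (h *: (1:R) + x) - f x)) @ 0^' --> l.
    apply/cvgrPdist_le => e e0; have [d d0 Hd] := H e e0.
    rewrite -nbhs_nearE; apply/nbhs_ballP; exists d => //= h.
    rewrite /ball /= sub0r normrN => hd h0.
    rewrite /GRing.scale /= mulr1 (addrC h x).
    have -> : l - h^-1 * (f (x + h) - f x) = - ((f (x + h) - f x - l * h) / h).
      by field.
    by rewrite normrN normrM normfV ler_pdivrMr ?normr_gt0// Hd.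
  split; last exact/cvg_lim.
  by apply/cvg_ex; exists l.
Qed.

Definition cont2 (R : realType) (w : R -> R -> R) (x t : R) :=
  {for (x, t), continuous (fun q : R * R => w q.1 q.2)}.

Lemma cont2P (R : realType) (w : R -> R -> R) (x t : R) :
  cont2 w x t <-> forall e : R, 0 < e -> exists2 d : R, 0 < d &
    forall x' t', `|x' - x| < d -> `|t' - t| < d -> `|w x' t' - w x t| < e.
Proof.
split.
- move=> /cvgrPdist_lt H e e0; have := H e e0.
  move=> /nbhs_ballP [d /= d0 Hd]; exists d => // x' t' hx ht.
  rewrite distrC; apply: (Hd (x', t')).
  by split; rewrite /ball /= distrC.
- move=> H; apply/cvgrPdist_lt => e e0; have [d d0 Hd] := H e e0.
  apply/(@nbhs_ballP R (R^o * R^o)%type); exists d => //= -[x' t'] [/= h1 h2].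
  by rewrite distrC; apply: Hd; rewrite distrC.
Qed.

Lemma is_derive1_cont (R : realType) (f : R -> R) (x l : R) :
  is_derive x 1 f l -> {for x, continuous f}.
Proof. by move=> [df _]; exact/differentiable_continuous/derivable1_diffP. Qed.

(* Multiplying by [e^(-(K+1)t)] turns a positive maximum into a point where the time derivative is both >= 0 and < 0. *)
Lemma max_contra (R : realType) (m : R -> R) (t l K d : R) :
  is_derive t 1 m l -> l <= K * m t -> 0 < m t -> 0 < d ->
  (forall s, t - d < s -> s <= t ->
     expR (- (K + 1) * s) * m s <= expR (- (K + 1) * t) * m t) -> False.
Proof.
move=> dm lK m0 d0 H.
pose M s := expR (- (K + 1) * s) * m s.
have dM : is_derive t 1 M (expR (- (K + 1) * t) * (l - (K + 1) * m t)).
  rewrite /M; apply: is_derive_eq.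
  by rewrite /GRing.scale /=; ring.
set L := _ * (l - _) in dM.
have L0 : L < 0.
  by rewrite /L pmulr_rlt0 ?expR_gt0//; lra.
have /is_derive_epsP /(_ (- L / 2)) [|e e0 He] := dM; first by lra.
pose h := - (Num.min d e / 2).
have mn : 0 < Num.min d e by rewrite lt_min d0 e0.
have h0 : h < 0 by rewrite /h; lra.
have md : Num.min d e <= d by rewrite ge_min lexx.
have me : Num.min d e <= e by rewrite ge_min lexx orbT.
have hd : - d < h by rewrite /h; lra.
have he : - e < h by rewrite /h; lra.
have := He h; rewrite ltr0_norm// => /(_ ltac:(lra)).
rewrite ler_norml => /andP[H1 _].
have := H (t + h) ltac:(lra) ltac:(lra); rewrite -/(M (t + h)) -/(M t) => H2.
have : 0 < L * h by rewrite nmulr_rgt0.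
nra.
Qed.

Lemma max_principle (R : realType) (w : R -> R -> R) (x1 x2 s0 S K : R) :
  (forall x t, x1 <= x <= x2 -> s0 <= t <= S -> cont2 w x t) ->
  (forall x, x1 <= x <= x2 -> w x s0 <= 0) ->
  (forall t, s0 <= t <= S -> w x1 t <= 0 /\ w x2 t <= 0) ->
  (forall x t, x1 < x < x2 -> s0 < t <= S -> 0 < w x t ->
     (forall y, x1 <= y <= x2 -> w y t <= w x t) ->
     exists l, is_derive t 1 (w x) l /\ l <= K * w x t) ->
  forall x t, x1 <= x <= x2 -> s0 <= t <= S -> w x t <= 0.
Proof.
move=> cw w0 wb wi x t hx ht.
have [//|wxt] := leP (w x t) 0.
pose W (q : R * R) := expR (- (K + 1) * q.2) * w q.1 q.2.
pose A := `[x1, x2] `*` `[s0, S].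
have A0 : A !=set0 by exists (x, t); split => /=; rewrite in_itv.
have cA : compact A by apply: compact_setX; exact: segment_compact.
have cW : {within A, continuous W}.
  apply: continuous_in_subspaceT => -[y s] /set_mem [/=]; rewrite !in_itv/= => hy hs.
  apply: cvgM; last exact: cw.
  apply: (cvg_comp _ expR); last exact: continuous_expR.
  apply: cvgM; first exact: cvg_cst.
  exact: cvg_snd.
have [[y s] /set_mem [/=]] := compact_EVT_max A0 cA cW; rewrite !in_itv/= => hy hs Hmax.
have Wxt : 0 < W (x, t) by rewrite mulr_gt0 ?expR_gt0.
have Wys : 0 < W (y, s).
  apply: (lt_le_trans Wxt); apply: Hmax; apply/mem_set.
  by split => /=; rewrite in_itv.
have wys : 0 < w y s by move: Wys; rewrite /W /= pmulr_rgt0 ?expR_gt0.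
have ys0 : s0 < s.
  rewrite lt_neqAle (andP hs).1 andbT; apply/eqP => E; subst s.
  by have := w0 _ hy; rewrite leNgt wys.
have [b1 b2] := wb s hs.
have yi : x1 < y < x2.
  have [y1 y2] := andP hy.
  rewrite !lt_neqAle y1 y2 !andbT; apply/andP; split; apply/eqP => E.
    by subst y; rewrite leNgt wys in b1.
  by subst y; rewrite leNgt wys in b2.
have [||l [dl lK]] := wi y s yi _ wys.
- by rewrite ys0 (andP hs).2.
- move=> x' hx'.
  have : W (x', s) <= W (y, s).
    by apply: Hmax; apply/mem_set; split => /=; rewrite in_itv.
  by rewrite /W /= ler_pM2l ?expR_gt0.
exfalso; apply: (max_contra dl lK wys (d := s - s0)); first by lra.
move=> r r1 r2; apply: (Hmax (y, r)); apply/mem_set; split => /=; rewrite in_itv //=.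
by have := andP hs; lra.
Qed.

Lemma max_principle1 (R : realType) (w : R -> R) (s0 S K : R) :
  {within `[s0, S], continuous w} ->
  w s0 <= 0 ->
  (forall t, s0 < t <= S -> 0 < w t -> exists l, is_derive t 1 w l /\ l <= K * w t) ->
  forall t, s0 <= t <= S -> w t <= 0.
Proof.
move=> cw w0 wi t ht.
have [//|wt] := leP (w t) 0.
pose W q := expR (- (K + 1) * q) * w q.
have sS : s0 <= S by lra.
have cW : {within `[s0, S], continuous W}.
  move=> q; apply: cvgM; last exact: cw.
  have : {within `[s0, S], continuous (fun q : R => expR (- (K + 1) * q))}.
    apply: derivable_within_continuous => r _.
    by apply: ex_derive.
  exact.
have [s] := EVT_max sS cW; rewrite in_itv/= => hs Hmax.
have ws : 0 < w s.
  have : 0 < W s.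
    by apply: (lt_le_trans _ (Hmax t _)); rewrite ?mulr_gt0 ?expR_gt0// in_itv.
  by rewrite /W /= pmulr_rgt0 ?expR_gt0.
have s0s : s0 < s.
  rewrite lt_neqAle (andP hs).1 andbT; apply/eqP => E; subst s.
  by move: w0; rewrite leNgt ws.
have [|l [dl lK]] := wi s _ ws; first by rewrite s0s (andP hs).2.
exfalso; apply: (max_contra dl lK ws (d := s - s0)); first by lra.
by move=> r r1 r2; apply: Hmax; rewrite in_itv /=; have := andP hs; lra.
Qed.

Lemma second_derivative_at_max (R : realType) (f f1 : R -> R) (x f2 d : R) :
  0 < d -> (forall y, `|y - x| < d -> is_derive y 1 f (f1 y)) ->
  is_derive x 1 f1 f2 -> (forall y, `|y - x| < d -> f y <= f x) -> f2 <= 0.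
Proof.
move=> d0 df df1 fmax.
have dfx : is_derive x 1 f (f1 x) by apply: df; rewrite subrr normr0.
have small (e h : R) : 0 < e -> 0 < h -> exists h', [/\ 0 < h', h' < e & h' < h].
  move=> e0 h0; exists (Num.min e h / 2).
  have m0 : 0 < Num.min e h by rewrite lt_min e0 h0.
  have m1 : Num.min e h <= e by rewrite ge_min lexx.
  have m2 : Num.min e h <= h by rewrite ge_min lexx orbT.
  by split; lra.
have f1x : f1 x = 0.
  apply/eqP; rewrite eq_le !leNgt; apply/andP; split; apply/negP => H.
  - have /is_derive_epsP /(_ (f1 x / 2)) [|e e0 He] := dfx; first by lra.
    have [h [h0 he hd]] := small e d e0 d0.
    have := He h; rewrite gtr0_norm// => /(_ he); rewrite ler_norml => /andP[H1 _].
    have := fmax (x + h); rewrite addrAC subrr add0r gtr0_norm// => /(_ hd) H2.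
    have : 0 < f1 x * h by rewrite mulr_gt0.
    nra.
  - have /is_derive_epsP /(_ (- f1 x / 2)) [|e e0 He] := dfx; first by lra.
    have [h [h0 he hd]] := small e d e0 d0.
    have := He (- h); rewrite normrN gtr0_norm// => /(_ he); rewrite ler_norml => /andP[H1 _].
    have := fmax (x - h); rewrite addrAC subrr add0r normrN gtr0_norm// => /(_ hd) H2.
    have : f1 x * h < 0 by rewrite nmulr_rlt0.
    nra.
rewrite leNgt; apply/negP => f20.
have /is_derive_epsP /(_ (f2 / 2)) [|e e0 He] := df1; first by lra.
have [h [h0 he hd]] := small e d e0 d0.
have xh : x < x + h by lra.
have [||c] := @MVT R f f1 x (x + h) xh.
- move=> y; rewrite in_itv/= => hy; apply: df; rewrite ltr_norml; lra.
- apply: derivable_within_continuous => y; rewrite in_itv/= => hy.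
  suff [] : is_derive y 1 f (f1 y) by [].
  by apply: df; rewrite ltr_norml; lra.
rewrite in_itv/= => /andP[c1 c2] E.
have := He (c - x); rewrite gtr0_norm; last by lra.
move=> /(_ ltac:(lra)); rewrite subrKC f1x subr0 ler_norml => /andP[H1 _].
have := fmax (x + h); rewrite addrAC subrr add0r gtr0_norm// => /(_ hd) H2.
have : 0 < f1 c * (x + h - x).
  by apply: mulr_gt0; [nra|lra].
lra.
Qed.

Lemma is_derive_near (R : realType) (f g : R -> R) (x l d : R) :
  0 < d -> (forall y, `|y - x| < d -> f y = g y) ->
  is_derive x 1 g l -> is_derive x 1 f l.
Proof.
move=> d0 fg /is_derive_epsP dg; apply/is_derive_epsP => e /dg [d' d'0 H].
exists (Num.min d d'); first by rewrite lt_min d0.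
move=> h; rewrite lt_min => /andP[h1 h2].
rewrite !fg ?subrr ?normr0//; first exact: H.
by rewrite addrAC subrr add0r.
Qed.


(** * The flow of a Lipschitz field *)

Lemma geometric_limit (R : realType) (u : nat -> R) (c : R) :
  (forall n, `|u n.+1 - u n| <= c / 2 ^+ n) ->
  exists l, forall n, `|l - u n| <= 2 * c / 2 ^+ n.
Proof.
move=> H.
pose e n : R := c / 2 ^+ n.
have eS n : e n.+1 = e n / 2 by rewrite /e exprS; field.
have c0 : 0 <= c.
  have := le_trans (normr_ge0 _) (H 0%N).
  by rewrite expr0 divr1.
have e0 n : 0 <= e n by rewrite /e divr_ge0// exprn_ge0.
have stepl n : u n - 2 * e n <= u n.+1 - 2 * e n.+1.
  by have := H n; rewrite -/(e n) eS ler_norml => /andP[]; have := e0 n; lra.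
have stepr n : u n.+1 + 2 * e n.+1 <= u n + 2 * e n.
  by have := H n; rewrite -/(e n) eS ler_norml => /andP[]; have := e0 n; lra.
have lo n m : (n <= m)%N -> u n - 2 * e n <= u m - 2 * e m.
  elim: m => [|m IH]; first by rewrite leqn0 => /eqP ->.
  by rewrite leq_eqVlt => /orP[/eqP->//|/IH/le_trans]; apply.
have hi n m : (n <= m)%N -> u m + 2 * e m <= u n + 2 * e n.
  elim: m => [|m IH]; first by rewrite leqn0 => /eqP ->.
  by rewrite leq_eqVlt => /orP[/eqP->//|/IH]; exact: le_trans.
have cross n m : u n - 2 * e n <= u m + 2 * e m.
  have := lo _ _ (leq_maxl n m); have := hi _ _ (leq_maxr n m).
  by have := e0 (maxn n m); lra.
pose A := range (fun n => u n - 2 * e n).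
have sA : has_sup A.
  split; first by exists (u 0%N - 2 * e 0%N); exists 0%N.
  by exists (u 0%N + 2 * e 0%N) => _ [n _ <-].
exists (sup A) => n; rewrite -mulrA -/(e n) ler_norml; apply/andP; split.
  have : u n - 2 * e n <= sup A by apply: sup_upper_bound => //; exists n.
  lra.
have : sup A <= u n + 2 * e n.
  by apply: ge_sup; [exact: sA.1|move=> _ [m _ <-]].
lra.
Qed.

Lemma geometric_cvg (R : realType) (u : nat -> R) (l c : R) :
  (forall n, `|l - u n| <= c / 2 ^+ n) -> u @ \oo --> l.
Proof.
move=> H; apply/cvgrPdist_le => e e0.
have : (geometric c 2^-1) @ \oo --> (0 : R).
  by apply: cvg_geometric; rewrite ger0_norm//; lra.
move=> /cvgrPdist_le /(_ e e0); apply: filterS => n.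
rewrite sub0r normrN /geometric /= exprVn => /(le_trans (ler_norm _)).
exact: le_trans.
Qed.

Lemma pow2_small (R : realType) (c e : R) : 0 < e -> exists n, c / 2 ^+ n < e.
Proof.
move=> e0.
have : (geometric c 2^-1) @ \oo --> (0 : R).
  by apply: cvg_geometric; rewrite ger0_norm//; lra.
move=> /cvgrPdist_lt /(_ e e0) [n _ Hn]; exists n.
have := Hn n (leqnn n); rewrite /= sub0r normrN /geometric /= exprVn.
exact: le_lt_trans (ler_norm _).
Qed.

Lemma antiderivative (R : realType) (h : R -> R) (a : R) :
  continuous h ->
  exists H : R -> R, H a = 0 /\ forall t, a <= t -> is_derive t 1 H (h t).
Proof.
move=> ch.
pose F x := (\int[@lebesgue_measure R]_(t in [set` `[a - 1, x]]) (h t))%R.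
exists (fun x => F x - F a); split; first by rewrite subrr.
move=> t at_.
have ih : (@lebesgue_measure R).-integrable `[a - 1, t + 1] (EFin \o h).
  apply: continuous_compact_integrable; first exact: segment_compact.
  exact: continuous_subspaceT.
have t1 : t < t + 1 by lra.
have ta : a - 1 < t by lra.
have [dF Fh] := @continuous_FTC1_closed R h (a - 1) t (t + 1) t1 ih ta (ch t).
have dFt : is_derive t 1 F (h t).
  by apply: (DeriveDef dF); rewrite -Fh derive1E.
by apply: is_derive_eq; rewrite subr0.
Qed.

Lemma dominated_increment (R : realType) (u u' v v' : R -> R) (S : R) :
  {within `[0, S], continuous u} -> {within `[0, S], continuous v} ->
  (forall t, 0 < t <= S -> is_derive t 1 u (u' t)) ->
  (forall t, 0 < t <= S -> is_derive t 1 v (v' t)) ->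
  (forall t, 0 < t <= S -> `|u' t| <= v' t) ->
  forall t, 0 <= t <= S -> `|u t - u 0| <= v t - v 0.
Proof.
move=> cu cv du dv uv t ht.
have H s : `|s| = 1 -> s * (u t - u 0) - (v t - v 0) <= 0.
  move=> s1.
  pose w := fun t => s * (u t - u 0) - (v t - v 0).
  apply: (@max_principle1 R w 0 S 0 _ _ _ t ht).
  - move=> x; apply: cvgB.
      by apply: cvgM; [exact: cvg_cst|apply: cvgB; [exact: cu|exact: cvg_cst]].
    by apply: cvgB; [exact: cv|exact: cvg_cst].
  - by rewrite /w; lra.
  - move=> r hr _; have dur := du r hr; have dvr := dv r hr.
    exists (s * u' r - v' r); split; last first.
      rewrite mul0r subr_le0 (le_trans (ler_norm _))// normrM s1 mul1r.
      exact: uv.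
    rewrite /w; apply: is_derive_eq.
    by rewrite /GRing.scale /=; ring.
rewrite ler_norml.
have := H 1 (normr1 _); have := H (-1) (normrN1 _).
by lra.
Qed.

Definition lip_field (R : realType) (K : R) (g : R -> R -> R) :=
  (forall z, continuous (g ^~ z)) /\
  (forall t a b, `|g t a - g t b| <= K * `|a - b|).

Lemma lip_field_cont (R : realType) (K : R) (g : R -> R -> R) (y : R -> R) (t : R) :
  0 < K -> lip_field K g -> {for t, continuous y} ->
  {for t, continuous (fun s => g s (y s))}.
Proof.
move=> K0 [gc gl] yc; apply/cvgrPdist_lt => e e0.
have /cvgrPdist_lt /(_ (e / 2)) := gc (y t) t.
move=> /(_ ltac:(lra)) H1.
have /cvgrPdist_lt /(_ (e / 2 / K)) := yc.
move=> /(_ ltac:(by rewrite divr_gt0//; lra)) H2.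
near=> s.
have h1 : `|g t (y t) - g s (y t)| < e / 2 by near: s.
have h2 : `|y t - y s| < e / 2 / K by near: s.
have h3 := gl s (y t) (y s).
have -> : g t (y t) - g s (y s) = (g t (y t) - g s (y t)) + (g s (y t) - g s (y s)) by ring.
rewrite (le_lt_trans (ler_normD _ _))//.
move: h2; rewrite ltr_pdivlMr// mulrC => h2.
lra.
Unshelve. all: by end_near. Qed.

Definition flow_line (R : realType) (g : R -> R -> R) (a : R) (y : R -> R) :=
  [/\ forall t : R, t <= 0 -> y t = a, continuous y &
      forall t : R, 0 < t -> is_derive t 1 y (g t (y t))].

Lemma cont_epsP (R : realType) (y : R -> R) (t : R) :
  {for t, continuous y} <-> forall e : R, 0 < e -> exists2 d : R, 0 < d &
    forall s, `|s - t| < d -> `|y s - y t| < e.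
Proof.
split.
- move=> /cvgrPdist_lt H e e0; have /nbhs_ballP [d /= d0 Hd] := H e e0.
  exists d => // s hs; rewrite distrC; apply: Hd.
  by rewrite /ball /= distrC.
- move=> H; apply/cvgrPdist_lt => e e0; have [d d0 Hd] := H e e0.
  apply/nbhs_ballP; exists d => //= s; rewrite /ball /= distrC => /Hd.
  by rewrite distrC.
Qed.

Lemma max0_dist (R : realType) (s t : R) : `|Num.max 0 s - Num.max 0 t| <= `|s - t|.
Proof.
have /andP[h1 h2] : - `|s - t| <= s - t <= `|s - t| by rewrite -ler_norml.
by rewrite ler_norml; case: (lerP 0 s) => hs; case: (lerP 0 t) => ht; lra.
Qed.

Lemma continuous_max0 (R : realType) (y : R -> R) :
  (forall t : R, 0 <= t -> {for t, continuous y}) ->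
  continuous (fun t : R => y (Num.max 0 t)).
Proof.
move=> H t; have m0 : 0 <= Num.max 0 t by rewrite le_max lexx.
apply/cont_epsP => e e0; have /cont_epsP /(_ e e0) [d d0 Hd] := H _ m0.
exists d => // s hs; apply: Hd.
exact: le_lt_trans (max0_dist _ _) hs.
Qed.


Lemma flow_line_exists (R : realType) (K : R) (g : R -> R -> R) (a : R) :
  0 < K -> lip_field K g -> exists y, flow_line g a y.
Proof.
move=> K0 gl.
pose good (y : R -> R) := continuous y /\ forall t : R, t <= 0 -> y t = a.
pose next (y y' : R -> R) := forall t : R, 0 < t -> is_derive t 1 y' (g t (y t)).
have nextP y : exists y', good y -> good y' /\ next y y'.
  have [[cy ya]|ny] := pselect (good y); last by exists y => /ny.
  have cg : continuous (fun s => g s (y s)) by move=> s; exact: lip_field_cont K0 gl (cy s).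
  have [H [H0 dH]] := antiderivative 0 cg.
  exists (fun t => a + H (Num.max 0 t)) => _; split; first split.
  - apply: (@continuous_max0 R (fun t => a + H t)) => t t0; apply: cvgD; first exact: cvg_cst.
    exact: is_derive1_cont (dH t t0).
  - by move=> t t0; rewrite max_l// H0 addr0.
  - move=> t t0; apply: (@is_derive_near _ _ (fun t => a + H t) _ _ t) => //.
    + by move=> s; rewrite ltr_norml => hs; rewrite max_r//; lra.
    + have dHt : is_derive t 1 H (g t (y t)) := dH t (ltW t0).
      have := is_deriveD (is_derive_cst a t 1) dHt. by rewrite add0r.
pose nx y := projT1 (cid (nextP y)).
have nxP y : good y -> good (nx y) /\ next y (nx y) by exact: (projT2 (cid (nextP y))).
pose Y n := iter n nx (fun=> a).
have gY n : good (Y n).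
  elim: n => [|n IH]; last exact: (nxP _ IH).1.
  by split => // t; exact: cvg_cst.
have dY n (t : R) : 0 < t -> is_derive t 1 (Y n.+1) (g t (Y n t)) by exact: (nxP _ (gY n)).2.
have Y0 n : Y n 0 = a by exact: (gY n).2.
have Yc t : Y 0%N t = a by [].
clearbody Y.
pose E (t : R) := expR (2 * K * t).
have dE (t : R) : is_derive t 1 E (2 * K * E t).
  by rewrite /E; apply: is_derive_eq; rewrite /GRing.scale /=; ring.
have E1 (t : R) : 0 <= t -> 1 <= E t.
  by move=> t0; rewrite /E -expR0 ler_expR !mulr_ge0// ltW.
have cE : continuous E by move=> t; exact: is_derive1_cont (dE t).
have key (S : R) : 0 <= S -> exists D, 0 <= D /\ forall n t, 0 <= t <= S ->
    `|Y n.+1 t - Y n t| <= D / 2 ^+ n * E t.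
  move=> S0.
  have cga : {within `[0, S], continuous (fun t => g t a)}.
    by apply: continuous_subspaceT; exact: gl.1.
  have [M [M0 HM]] : exists M, 0 <= M /\ forall t, 0 <= t <= S -> `|g t a| <= M.
    have cga' : {within `[0, S], continuous (fun t => `|g t a|)}.
      by move=> t; apply: cvg_norm; exact: cga.
    have [c hc Hc] := EVT_max S0 cga'.
    exists `|g c a|; split => // t ht; apply: Hc; by rewrite in_itv.
  have sub (u v : R -> R) (c : R) : 0 <= c ->
      (forall t : R, 0 < t -> is_derive t 1 u (v t)) -> continuous u -> u 0 = 0 ->
      (forall t, 0 < t <= S -> `|v t| <= c * (2 * K * E t)) ->
      forall t, 0 <= t <= S -> `|u t| <= c * E t.
    move=> c0 du cu u0 hv t ht.
    have cu' : {within `[0, S], continuous u} by exact: continuous_subspaceT.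
    have cv' : {within `[0, S], continuous (fun t => c * E t)}.
      by apply: continuous_subspaceT => s; apply: cvgM; [exact: cvg_cst|exact: cE].
    have dv' s : 0 < s <= S -> is_derive s 1 (fun t => c * E t) (c * (2 * K * E s)).
      move=> _; have dEs := dE s; apply: is_derive_eq.
      by rewrite /GRing.scale /=; ring.
    have := @dominated_increment R u v _ _ S cu' cv' _ dv' hv t ht.
    rewrite u0 subr0 => H.
    apply: le_trans (H _) _; first by move=> s /andP[s0 _]; exact: du.
    have : 0 <= c * E 0 by rewrite mulr_ge0// (le_trans ler01)// E1.
    lra.
  have dYd n (t : R) : 0 < t ->
      is_derive t 1 (fun t => Y n.+2 t - Y n.+1 t) (g t (Y n.+1 t) - g t (Y n t)).
    by move=> t0; have d1 := dY n.+1 t t0; have d2 := dY n t t0; apply: is_derive_eq.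
  exists (M / (2 * K)); split; first by rewrite divr_ge0// mulr_ge0// ltW.
  elim=> [|n IH] t ht.
    rewrite Yc; have -> : M / (2 * K) / 2 ^+ 0 = M / (2 * K) by rewrite expr0 divr1.
    apply: (@sub (fun t => Y 1%N t - a) (fun t => g t a) (M / (2 * K)) _ _ _ _ _ t ht).
    - by rewrite divr_ge0// mulr_ge0// ltW.
    - by move=> s s0; have := dY 0%N s s0; rewrite Yc => d1; apply: is_derive_eq; rewrite subr0.
    - by move=> s; apply: cvgB; [exact: (gY 1%N).1|exact: cvg_cst].
    - by rewrite Y0 subrr.
    - move=> s /andP[s0 sS].
      rewrite mulrA divfK; last by rewrite mulf_neq0// gt_eqF.
      rewrite (le_trans (HM s _))//; first by rewrite (ltW s0).
      by rewrite ler_peMr// E1// ltW.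
  apply: (@sub (fun t => Y n.+2 t - Y n.+1 t) (fun t => g t (Y n.+1 t) - g t (Y n t))
     (M / (2 * K) / 2 ^+ n.+1) _ _ _ _ _ t ht).
  - by rewrite !divr_ge0 ?exprn_ge0 ?mulr_ge0// ltW.
  - by move=> s; apply: cvgB; [exact: (gY n.+2).1|exact: (gY n.+1).1].
  - by rewrite !Y0 subrr.
  - move=> s /andP[s0 sS]; rewrite (le_trans (gl.2 _ _ _))//.
    have := IH s; rewrite (ltW s0) sS => /(_ isT) IHs.
    have -> : M / (2 * K) / 2 ^+ n.+1 * (2 * K * E s) = K * (M / (2 * K) / 2 ^+ n * E s).
      by rewrite exprS; field; rewrite expf_neq0//= gt_eqF.
    by rewrite ler_wpM2l// ltW.
pose y (t : R) : R := limn (fun n => Y n t).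
have yP (S D t : R) : 0 <= t <= S -> (forall n s, 0 <= s <= S ->
      `|Y n.+1 s - Y n s| <= D / 2 ^+ n * E s) -> forall n, `|y t - Y n t| <= 2 * (D * E t) / 2 ^+ n.
  move=> tS H.
  have [l Hl] := @geometric_limit R (fun n => Y n t) (D * E t) (fun n => le_trans (H n t tS) ltac:(by rewrite mulrAC)).
  suff -> : y t = l by [].
  rewrite /y; apply/cvg_lim; first exact: Rhausdorff.
  exact: geometric_cvg Hl.
have yle (t : R) : t <= 0 -> y t = a.
  move=> t0; rewrite /y; have -> : (fun n => Y n t) = fun=> a.
    by apply/funext => n; exact: (gY n).2.
  by apply: lim_cst; exact: Rhausdorff.
have gy : good y.
  split => //.
  have cy : forall t : R, 0 <= t -> {for t, continuous (fun t : R => y (Num.max 0 t))}.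
    move=> t t0; apply/cont_epsP => e e0.
    have [D [D0 HD]] := key (t + 1) ltac:(lra).
    have [n Hn] : exists n, 2 * (D * E (t + 1)) / 2 ^+ n < e / 3.
      by apply: pow2_small; lra.
    have /cont_epsP /(_ (e / 3)) [|d d0 Hd] := (gY n).1 t; first by lra.
    exists (Num.min d 1); first by rewrite lt_min d0 ltr01.
    move=> s; rewrite lt_min => /andP[sd s1].
    set s' := Num.max 0 s.
    have ts' : 0 <= s' <= t + 1.
      rewrite /s' le_max lexx/= ge_max; apply/andP; split; first lra.
      by move: s1; rewrite ltr_norml; lra.
    have tt' : 0 <= t <= t + 1 by lra.
    have Emono (r : R) : r <= t + 1 -> E r <= E (t + 1) by move=> rt; rewrite ler_expR ler_wpM2l// mulr_ge0// ltW.
    have bnd (r : R) : 0 <= r <= t + 1 -> `|y r - Y n r| < e / 3.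
      move=> hr; apply: le_lt_trans Hn; apply: (le_trans (yP _ _ _ hr HD n)).
      rewrite ler_wpM2r ?invr_ge0 ?exprn_ge0// ler_wpM2l// ler_wpM2l// Emono//.
      by case/andP: hr.
    have Ys : Y n s' = Y n s.
      rewrite /s'; case: (lerP 0 s) => // /ltW hs.
      by rewrite (gY n).2// (gY n).2.
    rewrite (max_r t0).
    have := bnd _ ts'; have := bnd _ tt'; have := Hd s sd; rewrite -Ys !ltr_norml.
    by lra.
  have -> : y = fun t : R => y (Num.max 0 t).
    by apply/funext => t; case: (lerP 0 t) => // /ltW t0; rewrite !yle.
  have yy : (fun t : R => y (Num.max 0 t)) = fun t : R => (fun t : R => y (Num.max 0 t)) (Num.max 0 t).
    by apply/funext => t; rewrite (@max_r _ _ 0 (Num.max 0 t))// le_max lexx.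
  rewrite yy; exact: (@continuous_max0 R (fun t : R => y (Num.max 0 t))).
have [gz dz] := nxP _ gy.
exists y; suff yz : y = nx y by split; [exact: gy.2|exact: gy.1|move=> t t0; have := dz t t0; rewrite -yz].
apply/funext => t.
have [t0|t0] := leP t 0; first by rewrite gy.2// gz.2.
have [D [D0 HD]] := key t (ltW t0).
have bnd n : `|nx y t - Y n.+1 t| <= D / 2 ^+ n * E t.
  have tt : 0 <= t <= t by rewrite lexx ltW.
  have c1 : {within `[0, t], continuous (fun s => nx y s - Y n.+1 s)}.
    by apply: continuous_subspaceT => s; apply: cvgB; [exact: gz.1|exact: (gY n.+1).1].
  have c2 : {within `[0, t], continuous (fun s => D / 2 ^+ n * E s)}.
    by apply: continuous_subspaceT => s; apply: cvgM; [exact: cvg_cst|exact: cE].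
  have du s : 0 < s <= t -> is_derive s 1 (fun s => nx y s - Y n.+1 s) (g s (y s) - g s (Y n s)).
    move=> /andP[s0 _]; have d1 := dz s s0; have d2 := dY n s s0.
    exact: is_derive_eq.
  have dv s : 0 < s <= t -> is_derive s 1 (fun s => D / 2 ^+ n * E s) (D / 2 ^+ n * (2 * K * E s)).
    move=> _; have dEs := dE s; apply: is_derive_eq.
    by rewrite /GRing.scale /=; ring.
  have uv s : 0 < s <= t -> `|g s (y s) - g s (Y n s)| <= D / 2 ^+ n * (2 * K * E s).
    move=> /andP[s0 st]; rewrite (le_trans (gl.2 _ _ _))//.
    have hs : 0 <= s <= t by rewrite (ltW s0).
    have := yP t D s hs HD n => H1.
    have -> : D / 2 ^+ n * (2 * K * E s) = K * (2 * (D * E s) / 2 ^+ n).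
      by field; rewrite expf_neq0.
    by rewrite ler_wpM2l// ltW.
  have := dominated_increment c1 c2 du dv uv tt.
  have E0 : nx y 0 - Y n.+1 0 = 0 by rewrite gz.2// Y0 subrr.
  rewrite /= E0 => H.
  
  have : 0 <= D / 2 ^+ n * E 0.
    by rewrite mulr_ge0 ?divr_ge0 ?exprn_ge0// (le_trans ler01)// E1.
  by move: H; rewrite subr0; lra.
apply/eqP; rewrite -subr_eq0 -normr_le0; apply/ler_addgt0Pl => e e0; rewrite addr0.
have [n Hn] := @pow2_small R (D * E t) (e / 2) ltac:(lra).
have tt : 0 <= t <= t by rewrite lexx ltW.
have := yP t D t tt HD n.+1; have := bnd n.
have -> : 2 * (D * E t) / 2 ^+ n.+1 = D * E t / 2 ^+ n by rewrite exprS; field; rewrite expf_neq0.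
have -> : D / 2 ^+ n * E t = D * E t / 2 ^+ n by rewrite mulrAC.
rewrite !ler_norml; lra.
Qed.


Lemma ode_unique (R : realType) (w : R -> R) (S K : R) :
  {within `[0, S], continuous w} -> w 0 = 0 ->
  (forall t : R, 0 < t <= S -> exists l, is_derive t 1 w l /\ `|l| <= K * `|w t|) ->
  forall t : R, 0 <= t <= S -> w t = 0.
Proof.
move=> cw w0 dw t ht.
have H s : `|s| = 1 -> s * w t <= 0.
  move=> s1; apply: (@max_principle1 R (fun t => s * w t) 0 S K _ _ _ t ht).
  - by move=> x; apply: cvgM; [exact: cvg_cst|exact: cw].
  - by rewrite w0 mulr0.
  - move=> r hr sw; have [l [dl lK]] := dw r hr.
    exists (s * l); split.
      by apply: is_derive_eq; rewrite /GRing.scale /=; ring.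
    have -> : s * w r = `|w r| by rewrite -[LHS]gtr0_norm// normrM s1 mul1r.
    by rewrite (le_trans (ler_norm _))// normrM s1 mul1r.
by have := H 1 (normr1 _); have := H (-1) (normrN1 _); lra.
Qed.

Definition flow (R : realType) (g : R -> R -> R) (t a : R) : R :=
  xget (fun=> 0) [set y | flow_line g a y] t.

Lemma flowP (R : realType) (K : R) (g : R -> R -> R) (a : R) :
  0 < K -> lip_field K g -> flow_line g a (fun t => flow g t a).
Proof.
move=> K0 gl; rewrite /flow.
exact: (@xgetPex _ (fun=> 0) [set y | flow_line g a y] (flow_line_exists a K0 gl)).
Qed.

Lemma flow_line_diff (R : realType) (K : R) (g : R -> R -> R) (a b : R) (y z : R -> R) :
  lip_field K g -> flow_line g a y -> flow_line g b z ->
  forall t : R, 0 < t -> is_derive t 1 (fun t => z t - y t) (g t (z t) - g t (y t)) /\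
     `|g t (z t) - g t (y t)| <= K * `|z t - y t|.
Proof.
move=> gl [_ _ dy] [_ _ dz] t t0; split; last exact: gl.2.
by have d1 := dy t t0; have d2 := dz t t0; exact: is_derive_eq.
Qed.

Lemma flow_line_dist (R : realType) (K : R) (g : R -> R -> R) (a b : R) (y z : R -> R) :
  lip_field K g -> flow_line g a y -> flow_line g b z ->
  forall t : R, 0 <= t -> `|z t - y t| <= expR (K * t) * `|b - a|.
Proof.
move=> gl fy fz t t0.
have H s : `|s| = 1 -> s * (z t - y t) - expR (K * t) * `|b - a| <= 0.
  move=> s1.
  have tt : 0 <= t <= t by rewrite lexx t0.
  apply: (@max_principle1 R (fun t => s * (z t - y t) - expR (K * t) * `|b - a|) 0 t K _ _ _ t tt).
  - apply: continuous_subspaceT => x.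
    have [_ cy _] := fy; have [_ cz _] := fz.
    apply: cvgB; first by apply: cvgM; [exact: cvg_cst|apply: cvgB; [exact: cz|exact: cy]].
    apply: cvgM; last exact: cvg_cst.
    apply: (cvg_comp _ expR); last exact: continuous_expR.
    by apply: cvgM; [exact: cvg_cst|exact: cvg_id].
  - have [-> // _ _] := fy; have [-> // _ _] := fz.
    rewrite mulr0 expR0 mul1r subr_le0 (le_trans (ler_norm _))//.
    by rewrite normrM s1 mul1r.
  - move=> r /andP[r0 _] Wr; have [dD DK] := flow_line_diff gl fy fz r0.
    have dE : is_derive r 1 (fun t => expR (K * t)) (K * expR (K * r)).
      by apply: is_derive_eq; rewrite /GRing.scale /=; ring.
    exists (s * (g r (z r) - g r (y r)) - K * expR (K * r) * `|b - a|); split.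
      apply: is_derive_eq; rewrite /GRing.scale /=; ring.
    have e0 : 0 <= expR (K * r) * `|b - a| by rewrite mulr_ge0// expR_ge0.
    have sD : 0 < s * (z r - y r) by lra.
    have : s * (g r (z r) - g r (y r)) <= K * (s * (z r - y r)).
      rewrite -(gtr0_norm sD) normrM s1 mul1r (le_trans _ DK)//.
      by rewrite (le_trans (ler_norm _))// normrM s1 mul1r.
    lra.
rewrite ler_norml.
by have := H 1 (normr1 _); have := H (-1) (normrN1 _); lra.
Qed.

Lemma flow_line_gap (R : realType) (K : R) (g : R -> R -> R) (a b : R) (y z : R -> R) :
  0 < K -> lip_field K g -> flow_line g a y -> flow_line g b z -> a <= b ->
  forall t : R, 0 <= t -> expR (- K * t) * (b - a) <= z t - y t.
Proof.
move=> K0 gl fy fz ab t t0; rewrite -subr_le0.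
have tt : 0 <= t <= t by rewrite lexx t0.
apply: (@max_principle1 R (fun t => expR (- K * t) * (b - a) - (z t - y t)) 0 t K _ _ _ t tt).
- apply: continuous_subspaceT => x.
  have [_ cy _] := fy; have [_ cz _] := fz.
  apply: cvgB; last by apply: cvgB; [exact: cz|exact: cy].
  apply: cvgM; last exact: cvg_cst.
  apply: (cvg_comp _ expR); last exact: continuous_expR.
  by apply: cvgM; [exact: cvg_cst|exact: cvg_id].
- have [-> // _ _] := fy; have [-> // _ _] := fz.
  by rewrite mulr0 expR0 mul1r; lra.
- move=> r /andP[r0 _] Wr; have [dD DK] := flow_line_diff gl fy fz r0.
  have dE : is_derive r 1 (fun t => expR (- K * t)) (- K * expR (- K * r)).
    by apply: is_derive_eq; rewrite /GRing.scale /=; ring.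
  exists (- K * expR (- K * r) * (b - a) - (g r (z r) - g r (y r))); split.
    by apply: is_derive_eq; rewrite /GRing.scale /=; ring.
  have e0 : 0 <= expR (- K * r) * (b - a) by rewrite mulr_ge0 ?expR_ge0// subr_ge0.
  move: DK; rewrite ler_norml => /andP[D1 _].
  case: (lerP 0 (z r - y r)) => hD; rewrite ?(ger0_norm hD) ?(ltr0_norm hD) in D1.
    have : 0 <= K * (expR (- K * r) * (b - a) - (z r - y r)) by rewrite mulr_ge0// ltW.
    have : K * (z r - y r) <= K * (expR (- K * r) * (b - a)) by rewrite ler_wpM2l//; lra.
    lra.
  have : 0 <= K * (expR (- K * r) * (b - a)) by rewrite mulr_ge0// ltW.
  lra.
Qed.

Lemma flow0 (R : realType) (K : R) (g : R -> R -> R) (a : R) :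
  0 < K -> lip_field K g -> flow g 0 a = a.
Proof. by move=> K0 gl; have [->] := flowP a K0 gl. Qed.

Lemma flow_dist (R : realType) (K : R) (g : R -> R -> R) (a b t : R) :
  0 < K -> lip_field K g -> 0 <= t ->
  `|flow g t b - flow g t a| <= expR (K * t) * `|b - a|.
Proof. by move=> K0 gl; exact: (flow_line_dist gl (flowP a K0 gl) (flowP b K0 gl)). Qed.

Lemma flow_gap (R : realType) (K : R) (g : R -> R -> R) (a b t : R) :
  0 < K -> lip_field K g -> a <= b -> 0 <= t ->
  expR (- K * t) * (b - a) <= flow g t b - flow g t a.
Proof. by move=> K0 gl ab; exact: (flow_line_gap K0 gl (flowP a K0 gl) (flowP b K0 gl) ab). Qed.

Lemma flow_mono (R : realType) (K : R) (g : R -> R -> R) (a b t : R) :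
  0 < K -> lip_field K g -> 0 <= t -> a <= b -> flow g t a <= flow g t b.
Proof.
move=> K0 gl t0 ab; rewrite -subr_ge0 (le_trans _ (flow_gap K0 gl ab t0))//.
by rewrite mulr_ge0 ?expR_ge0// subr_ge0.
Qed.

Lemma flow_unique (R : realType) (K : R) (g : R -> R -> R) (a S : R) (y : R -> R) :
  0 < K -> lip_field K g -> {within `[0, S], continuous y} -> y 0 = a ->
  (forall t : R, 0 < t <= S -> is_derive t 1 y (g t (y t))) ->
  forall t : R, 0 <= t <= S -> y t = flow g t a.
Proof.
move=> K0 gl cy ya dy t ht; apply/eqP; rewrite -subr_eq0; apply/eqP.
have [f0 cf df] := flowP a K0 gl.
apply: (@ode_unique R (fun t => y t - flow g t a) S K _ _ _ t ht).
- move=> x; apply: cvgB; first exact: cy.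
  exact: (continuous_subspaceT cf).
- by rewrite f0// ya subrr.
- move=> r hr; have d1 := dy r hr; have /andP[r0 _] := hr; have d2 := df r r0.
  exists (g r (y r) - g r (flow g r a)); split; first exact: is_derive_eq.
  exact: gl.2.
Qed.

Record smooth_field (R : realType) (K L rho : R) (g gz : R -> R -> R) : Prop := SmoothField {
  sf_K : 0 < K ; sf_L : 0 <= L ; sf_rho : 0 < rho ;
  sf_lip : lip_field K g ;
  sf_0 : forall t, g t 0 = 0 ;
  sf_bd : forall t a : R, `|a| <= rho -> `|gz t a| <= K ;
  sf_cont : forall a : R, `|a| <= rho -> continuous (gz ^~ a) ;
  sf_gz : forall t a b : R, `|a| <= rho -> `|b| <= rho -> `|gz t a - gz t b| <= L * `|a - b| ;
  sf_exp : forall t a b : R, `|a| <= rho -> `|b| <= rho ->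
    `|g t b - g t a - gz t a * (b - a)| <= L * (b - a) ^+ 2 }.

Lemma flow_zero (R : realType) (K L rho : R) (g gz : R -> R -> R) (t : R) :
  smooth_field K L rho g gz -> 0 <= t -> flow g t 0 = 0.
Proof.
move=> sf t0; apply/esym.
have := @flow_unique R K g 0 t (fun=> 0) (sf_K sf) (sf_lip sf).
apply => //; last by rewrite lexx t0.
- by move=> x; exact: cvg_cst.
- by move=> s _; rewrite (sf_0 sf); exact: is_derive_cst.
Qed.

Lemma flow_norm (R : realType) (K L rho : R) (g gz : R -> R -> R) (t a : R) :
  smooth_field K L rho g gz -> 0 <= t -> `|flow g t a| <= expR (K * t) * `|a|.
Proof.
move=> sf t0; have := flow_dist 0 a (sf_K sf) (sf_lip sf) t0.
by rewrite (flow_zero sf)// !subr0.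
Qed.

Lemma flow_expand (R : realType) (K L rho S : R) (g gz : R -> R -> R) :
  smooth_field K L rho g gz -> 0 <= S ->
  forall a : R, `|a| <= rho * expR (- (K * S)) ->
  exists J : R -> R, [/\ forall t : R, 0 < t -> derivable J t 1,
    continuous J,
    forall t : R, 0 <= t <= S -> expR (- (K * S)) <= J t &
    forall t b : R, 0 <= t <= S -> `|b| <= rho * expR (- (K * S)) ->
      `|flow g t b - flow g t a - J t * (b - a)| <= L * S * expR (3 * K * S) * (b - a) ^+ 2].
Proof.
move=> sf S0 a ha.
have K0 := sf_K sf; have gl := sf_lip sf; have L0 := sf_L sf; have r0 := sf_rho sf.
have small (b t : R) : `|b| <= rho * expR (- (K * S)) -> 0 <= t <= S -> `|flow g t b| <= rho.
  move=> hb /andP[t0 tS]; apply: le_trans (flow_norm b sf t0) _.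
  apply: (@le_trans _ _ (expR (K * t) * (rho * expR (- (K * S))))).
    by rewrite ler_wpM2l// expR_ge0.
  rewrite mulrCA -expRD; apply: ler_piMr; first exact: ltW.
  rewrite -expR0 ler_expR.
  have : K * t <= K * S by rewrite ler_wpM2l// ltW.
  by lra.
pose cl (t : R) : R := S - Num.max 0 (S - Num.max 0 t).
have clr (t : R) : 0 <= cl t <= S.
  rewrite /cl; case: (lerP 0 t) => ht; first by case: (lerP 0 (S - t)); lra.
  by case: (lerP 0 (S - 0)); lra.
have clid (t : R) : 0 <= t <= S -> cl t = t.
  move=> /andP[t0 tS]; rewrite /cl (max_r t0) max_r; lra.
pose y (t : R) := flow g (cl t) a.
have [fa0 cfa dfa] := flowP a K0 gl.
have [gc gL] := gl.
have cy : continuous y.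
  have -> : y = fun t : R => (fun s : R => flow g (S - s) a) (Num.max 0 (S - Num.max 0 t)) by [].
  have c1 : continuous (fun s : R => flow g (S - s) a).
    move=> s; apply: (cvg_comp (fun s => S - s) (fun t => flow g t a)); last exact: cfa.
    by apply: cvgB; [exact: cvg_cst|exact: cvg_id].
  apply: (@continuous_max0 R (fun t : R => flow g (S - Num.max 0 (S - t)) a)) => t _.
  apply: (cvg_comp (fun t => S - t) (fun t : R => flow g (S - Num.max 0 t) a)).
    by apply: cvgB; [exact: cvg_cst|exact: cvg_id].
  by apply: (@continuous_max0 R (fun s : R => flow g (S - s) a)) => s _; exact: c1.
have ysm (t : R) : `|y t| <= rho by apply: small => //; exact: clr.
pose c (t : R) := gz t (y t).
have cc : continuous c.
  move=> t; apply/cvgrPdist_lt => e e0.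
  have /cvgrPdist_lt /(_ (e / 2)) := @sf_cont _ _ _ _ _ _ sf (y t) (ysm t) t.
  move=> /(_ ltac:(lra)) H1.
  have /cvgrPdist_lt /(_ (e / 2 / (L + 1))) := cy t.
  move=> /(_ ltac:(by rewrite divr_gt0//; lra)) H2.
  near=> s.
  have h1 : `|gz t (y t) - gz s (y t)| < e / 2 by near: s.
  have h2 : `|y t - y s| < e / 2 / (L + 1) by near: s.
  have h3 := sf_gz sf s (ysm t) (ysm s).
  rewrite /c; have -> : gz t (y t) - gz s (y s) = (gz t (y t) - gz s (y t)) + (gz s (y t) - gz s (y s)) by ring.
  rewrite (le_lt_trans (ler_normD _ _))//.
  move: h2; rewrite ltr_pdivlMr; last by lra.
  move=> h2.
  have := normr_ge0 (y t - y s).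
  lra.
pose gJ (t z : R) := c t * z.
have lJ : lip_field K gJ.
  split; first by move=> z t; apply: cvgM; [exact: cc|exact: cvg_cst].
  move=> t b b'; rewrite /gJ -mulrBr normrM ler_wpM2r//.
  by apply: (sf_bd sf).
have [J0 cJ dJ] := flowP 1 K0 lJ.
pose J t := flow gJ t 1.
exists J; split => //.
- by move=> t t0; have [] := dJ t t0.
- move=> t /andP[t0 tS].
  have := flow_gap K0 lJ (@ler01 R) t0.
  have -> : flow gJ t 0 = 0.
    apply/esym; have := @flow_unique R K gJ 0 t (fun=> 0) K0 lJ.
    apply => //; last by rewrite lexx t0.
    + by move=> x; exact: cvg_cst.
    + by move=> s _; rewrite /gJ mulr0; exact: is_derive_cst.
  rewrite !subr0 mulr1; apply: le_trans; rewrite ler_expR.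
  have : K * t <= K * S by rewrite ler_wpM2l// ltW.
  by lra.
move=> t b ht hb.
have [fb0 cfb dfb] := flowP b K0 gl.
pose C0 := L * expR (2 * K * S) * (b - a) ^+ 2.
have C00 : 0 <= C0 by rewrite /C0 mulr_ge0 ?sqr_ge0// mulr_ge0 ?expR_ge0.
pose E t := flow g t b - flow g t a - J t * (b - a).
have H s : `|s| = 1 -> s * E t - C0 * t * expR (K * t) <= 0.
  move=> s1.
  apply: (@max_principle1 R (fun t => s * E t - C0 * t * expR (K * t)) 0 S K _ _ _ t ht).
  - apply: continuous_subspaceT => x.
    apply: cvgB.
      apply: cvgM; first exact: cvg_cst.
      apply: cvgB; first by apply: cvgB; [exact: cfb|exact: cfa].
      by apply: cvgM; [exact: cJ|exact: cvg_cst].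
    apply: cvgM; first by apply: cvgM; [exact: cvg_cst|exact: cvg_id].
    apply: (cvg_comp _ expR); last exact: continuous_expR.
    by apply: cvgM; [exact: cvg_cst|exact: cvg_id].
  - by rewrite /E fa0// fb0// /J J0//; lra.
  - move=> r /andP[rp rS] Wr.
    have hr : 0 <= r <= S by rewrite (ltW rp).
    have d1 := dfa r rp; have d2 := dfb r rp; have d3 := dJ r rp.
    have dE : is_derive r 1 (fun t => expR (K * t)) (K * expR (K * r)).
      by apply: is_derive_eq; rewrite /GRing.scale /=; ring.
    have dEE : is_derive r 1 E (g r (flow g r b) - g r (flow g r a) - gJ r (J r) * (b - a)).
      by rewrite /E; apply: is_derive_eq; rewrite /GRing.scale /=; ring.
    exists (s * (g r (flow g r b) - g r (flow g r a) - gJ r (J r) * (b - a))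
        - (C0 * expR (K * r) + C0 * r * (K * expR (K * r)))); split.
      by apply: is_derive_eq; rewrite /GRing.scale /=; ring.
    have yr : y r = flow g r a by rewrite /y clid.
    have q1 : 0 <= C0 * r * expR (K * r) := mulr_ge0 (mulr_ge0 C00 (ltW rp)) (expR_ge0 _).
    have sE : 0 < s * E r by lra.
    have nE : s * E r = `|E r| by rewrite -[LHS]gtr0_norm// normrM s1 mul1r.
    have -> : g r (flow g r b) - g r (flow g r a) - gJ r (J r) * (b - a) =
      (g r (flow g r b) - g r (flow g r a) - gz r (flow g r a) * (flow g r b - flow g r a))
      + c r * E r by rewrite /gJ /E /c yr; ring.
    rewrite mulrDr.
    have b1 : s * (c r * E r) <= K * `|E r|.
      rewrite (le_trans (ler_norm _))// !normrM s1 mul1r ler_wpM2r//.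
      exact: (sf_bd sf).
    set q := _ - _ - gz r _ * _.
    have b2 : s * q <= C0.
      rewrite (le_trans (ler_norm _))// normrM s1 mul1r /q.
      apply: le_trans (sf_exp sf r (small _ _ ha hr) (small _ _ hb hr)) _.
      rewrite /C0 -mulrA ler_wpM2l//.
      have := flow_dist a b K0 gl (ltW rp) => HD.
      rewrite -real_normK ?num_real// -[(b - a) ^+ 2]real_normK ?num_real//.
      have -> : expR (2 * K * S) = expR (K * S) ^+ 2.
        by rewrite -expRM_natl; congr expR; ring.
      rewrite -exprMn lerXn2r ?nnegrE ?mulr_ge0 ?expR_ge0//.
      apply: (le_trans HD); rewrite ler_wpM2r// ler_expR ler_wpM2l//; exact: ltW.
    have e1 : 1 <= expR (K * r) by rewrite -expR0 ler_expR mulr_ge0// ltW.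
    have b3 : C0 <= C0 * expR (K * r) by rewrite ler_peMr.
    apply: (@le_trans _ _ (K * `|E r| - K * (C0 * r * expR (K * r)))); first by lra.
    by rewrite -nE -mulrBr.
have bnd : C0 * t * expR (K * t) <= L * S * expR (3 * K * S) * (b - a) ^+ 2.
  have /andP[t0 tS] := ht.
  have -> : L * S * expR (3 * K * S) * (b - a) ^+ 2 = C0 * S * expR (K * S).
    have -> : 3 * K * S = 2 * K * S + K * S by ring.
    by rewrite expRD /C0; ring.
  apply: ler_pM; first exact: mulr_ge0.
  - exact: expR_ge0.
  - by rewrite ler_wpM2l.
  - by rewrite ler_expR ler_wpM2l//; exact: ltW.
rewrite -/(E t) ler_norml.
by have := H 1 (normr1 _); have := H (-1) (normrN1 _); lra.
Unshelve. all: by end_near. Qed.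

Lemma is_derive_quadratic0 (R : realType) (r q : R -> R) (t l C d : R) :
  0 < d -> is_derive t 1 q l -> 
  (forall s, `|s - t| < d -> `|r s| <= C * (q s - q t) ^+ 2) -> is_derive t 1 r 0.
Proof.
move=> d0 /is_derive_epsP dq H; apply/is_derive_epsP => e e0.
have [d1 d10 H1] := dq 1 ltr01.
pose A := `|l| + 1.
have A0 : 0 < A by rewrite /A; have := normr_ge0 l; lra.
have C1 : 0 < `|C| + 1 by have := normr_ge0 C; lra.
have rt : r t = 0.
  apply/eqP; rewrite -normr_le0 (le_trans (H t _))//; first by rewrite subrr normr0.
  by rewrite subrr expr0n mulr0.
exists (Num.min d (Num.min d1 (e / ((`|C| + 1) * A ^+ 2)))).
  by rewrite !lt_min d0 d10 divr_gt0// mulr_gt0// exprn_gt0.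
move=> h; rewrite !lt_min => /and3P[h1 h2 h3].
rewrite rt mul0r !subr0.
have qh : `|q (t + h) - q t| <= A * `|h|.
  have -> : q (t + h) - q t = (q (t + h) - q t - l * h) + l * h by ring.
  rewrite (le_trans (ler_normD _ _))// normrM /A mulrDl mul1r addrC lerD2l.
  by have := H1 h h2; rewrite mul1r.
have := H (t + h); rewrite addrAC subrr add0r => /(_ h1) H2; apply: (le_trans H2).
apply: (@le_trans _ _ ((`|C| + 1) * (A * `|h|) ^+ 2)).
  apply: (@le_trans _ _ ((`|C| + 1) * (q (t + h) - q t) ^+ 2)).
    by rewrite ler_wpM2r ?sqr_ge0//; have := ler_norm C; lra.
  apply: ler_wpM2l; first exact: ltW.
  rewrite -[leLHS]real_normK ?num_real//.
  by rewrite lerXn2r ?nnegrE// mulr_ge0// ltW.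
move: h3; rewrite ltr_pdivlMr; last by rewrite mulr_gt0// exprn_gt0.
move=> h3; rewrite exprMn mulrA expr2 mulrA.
by rewrite ler_wpM2r// mulrC ltW// expr2.
Qed.

Lemma flow_comp_derive (R : realType) (K L rho S : R) (g gz : R -> R -> R) :
  smooth_field K L rho g gz -> 0 <= S ->
  forall (psi : R -> R) (t psit : R), 0 < t < S -> is_derive t 1 psi psit ->
  `|psi t| < rho * expR (- (K * S)) ->
  forall J : R -> R, derivable J t 1 ->
  (forall s b : R, 0 <= s <= S -> `|b| <= rho * expR (- (K * S)) ->
      `|flow g s b - flow g s (psi t) - J s * (b - psi t)| <= L * S * expR (3 * K * S) * (b - psi t) ^+ 2) ->
  is_derive t 1 (fun s => flow g s (psi s)) (g t (flow g t (psi t)) + J t * psit).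
Proof.
move=> sf S0 psi t psit /andP[t0 tS] dpsi psis J dJ HJ.
have K0 := sf_K sf; have gl := sf_lip sf.
have [_ _ dfa] := flowP (psi t) K0 gl.
have /cont_epsP /(_ (rho * expR (- (K * S)) - `|psi t|)) [|d d0 Hd] := is_derive1_cont dpsi.
  by rewrite subr_gt0.
pose r s := flow g s (psi s) - flow g s (psi t) - J s * (psi s - psi t).
have dr : is_derive t 1 r 0.
  pose d' := Num.min d (Num.min t (S - t)).
  apply: (@is_derive_quadratic0 R r psi t psit (L * S * expR (3 * K * S)) d') => //.
    by rewrite !lt_min d0 t0 subr_gt0.
  move=> s; rewrite !lt_min => /and3P[s1 s2 s3]; apply: HJ.
    by move: s2 s3; rewrite !ltr_norml; lra.
  have := Hd s s1 => h.
  have -> : psi s = (psi s - psi t) + psi t by ring.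
  rewrite (le_trans (ler_normD _ _))//; lra.
have -> : (fun s => flow g s (psi s)) = (fun s => r s + flow g s (psi t) + J s * (psi s - psi t)).
  by apply/funext => s; rewrite /r; ring.
have d1 := dfa t t0; have d2 := derivableP dJ.
by apply: is_derive_eq; rewrite /GRing.scale /= subrr; ring.
Qed.

Lemma flow_comp_cont (R : realType) (K : R) (g : R -> R -> R) (psi : R -> R -> R) (x t : R) :
  0 < K -> lip_field K g -> cont2 psi x t ->
  cont2 (fun x t => flow g t (psi x t)) x t.
Proof.
move=> K0 gl /cont2P cp; apply/cont2P => e e0.
have [f0 /(_ t) /cont_epsP cf _] := flowP (psi x t) K0 gl.
have [d1 d10 H1] := cf (e / 2) ltac:(lra).
pose M := expR (K * (`|t| + 1)).
have M0 : 0 < M by exact: expR_gt0.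
have [d2 d20 H2] := cp (e / 2 / M) ltac:(by rewrite divr_gt0//; lra).
exists (Num.min 1 (Num.min d1 d2)); first by rewrite !lt_min ltr01 d10.
move=> x' t'; rewrite !lt_min => /and3P[_ _ hx] /and3P[ht1 ht2 ht3].
have := H2 x' t' hx ht3; rewrite ltr_pdivlMr// => h2.
have := H1 t' ht2 => h1.
have -> : flow g t' (psi x' t') - flow g t (psi x t) =
  (flow g t' (psi x' t') - flow g t' (psi x t)) + (flow g t' (psi x t) - flow g t (psi x t)) by ring.
rewrite (le_lt_trans (ler_normD _ _))//.
suff : `|flow g t' (psi x' t') - flow g t' (psi x t)| <= `|psi x' t' - psi x t| * M by lra.
have [t'0|t'0] := lerP t' 0.
  have [-> // _ _] := flowP (psi x' t') K0 gl; rewrite f0//.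
  apply: ler_peMr; first exact: normr_ge0.
  rewrite /M -expR0 ler_expR; apply: mulr_ge0; first exact: ltW.
  by rewrite addr_ge0.
rewrite mulrC (le_trans (flow_dist _ _ K0 gl (ltW t'0)))// ler_wpM2r// ler_expR.
apply: ler_wpM2l; first exact: ltW.
have h4 : t' - t <= 1 by rewrite (le_trans (ler_norm _))// ltW.
have h5 := ler_norm t.
by rewrite -lerBlDl (le_trans _ h4)// lerB.
Qed.


(** * Comparison with the flow of a profile *)

Definition psol (R : realType) (g z : R -> R -> R) := exists zx zxx : R -> R -> R,
  forall x t : R, 0 <= t ->
  [/\ is_derive x 1 (z^~ t) (zx x t), is_derive x 1 (zx^~ t) (zxx x t),
      is_derive t 1 (z x) (zxx x t + g t (z x t)) & cont2 z x t].

Lemma cont2D (R : realType) (v w : R -> R -> R) (x t : R) :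
  cont2 v x t -> cont2 w x t -> cont2 (fun x t => v x t + w x t) x t.
Proof. by move=> cv cw; apply: cvgD; [exact: cv|exact: cw]. Qed.

Lemma cont2B (R : realType) (v w : R -> R -> R) (x t : R) :
  cont2 v x t -> cont2 w x t -> cont2 (fun x t => v x t - w x t) x t.
Proof. by move=> cv cw; apply: cvgB; [exact: cv|exact: cw]. Qed.

Lemma cont2M (R : realType) (v w : R -> R -> R) (x t : R) :
  cont2 v x t -> cont2 w x t -> cont2 (fun x t => v x t * w x t) x t.
Proof. by move=> cv cw; apply: cvgM; [exact: cv|exact: cw]. Qed.

Lemma cont2_cst (R : realType) (c x t : R) : cont2 (fun _ _ => c) x t.
Proof. exact: cvg_cst. Qed.

Lemma cont2_fst (R : realType) (x t : R) : cont2 (fun x _ => x) x t.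
Proof. exact: cvg_fst. Qed.

Lemma cont2_snd (R : realType) (x t : R) : cont2 (fun _ t => t) x t.
Proof. exact: cvg_snd. Qed.

Lemma cont2_comp (R : realType) (h : R -> R) (v : R -> R -> R) (x t : R) :
  cont2 v x t -> {for v x t, continuous h} -> cont2 (fun x t => h (v x t)) x t.
Proof. by move=> cv ch; apply: (@cvg_comp _ _ _ (fun q : R * R => v q.1 q.2) h _ _ _ cv); exact: ch. Qed.

Lemma supersol_cmp (R : realType) (K : R) (g z V : R -> R -> R) (x1 x2 s0 S : R) :
  0 <= s0 -> psol g z -> lip_field K g ->
  (forall x t, x1 <= x <= x2 -> s0 <= t <= S -> cont2 V x t) ->
  (forall x, x1 <= x <= x2 -> z x s0 <= V x s0) ->
  (forall t, s0 <= t <= S -> z x1 t <= V x1 t /\ z x2 t <= V x2 t) ->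
  (forall x t, x1 < x < x2 -> s0 < t <= S -> exists vt (Q Q1 : R -> R) q2,
     [/\ is_derive t 1 (V x) vt,
         Q x = V x t /\ forall y, x1 <= y <= x2 -> V y t <= Q y,
         forall y : R, is_derive y 1 Q (Q1 y), is_derive x 1 Q1 q2 &
         q2 + g t (V x t) <= vt]) ->
  forall x t, x1 <= x <= x2 -> s0 <= t <= S -> z x t <= V x t.
Proof.
move=> s00 [zx [zxx zP]] gl cV Vi Vb VP x t hx ht; rewrite -subr_le0.
apply: (@max_principle R (fun x t => z x t - V x t) x1 x2 s0 S K _ _ _ _ x t hx ht).
- move=> y s hy hs; apply: cont2B; last exact: cV.
  by have [] := zP y s (le_trans s00 (proj1 (andP hs))).
- by move=> y hy; rewrite subr_le0; exact: Vi.
- by move=> s hs; rewrite !subr_le0; exact: Vb.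
move=> y s /andP[y1 y2] hs wp wm.
have [vt [Q [Q1 [q2 [dV [Qy QV] dQ dQ1 H]]]]] := VP y s ltac:(by rewrite y1) hs.
have s0' : 0 <= s by lra.
have [d1 d2 d3 _] := zP y s s0'.
exists (zxx y s + g s (z y s) - vt); split; first exact: is_derive_eq.
suff h : zxx y s - q2 <= 0.
  have := ler_norm (g s (z y s) - g s (V y s)); have := gl.2 s (z y s) (V y s).
  rewrite (gtr0_norm wp); lra.
pose d := Num.min (y - x1) (x2 - y).
have dd : is_derive y 1 (fun y => zx y s - Q1 y) (zxx y s - q2) by exact: is_derive_eq.
apply: (@second_derivative_at_max R (fun y => z y s - Q y) _ y _ d _ _ dd).
- by rewrite lt_min !subr_gt0 y1.
- move=> y' _; have [d1' _ _ _] := zP y' s s0'; have dQ' := dQ y'.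
  exact: is_derive_eq.
- move=> y'; rewrite lt_min => /andP[]; rewrite !ltr_norml => h1 h2.
  have hy' : x1 <= y' <= x2 by lra.
  have := wm y' hy'; have := QV y' hy'; rewrite Qy; lra.
Qed.

Definition tail (R : realType) (K B x1 x2 x t : R) : R :=
  B * (expR (x1 - x) + expR (x - x2)) * expR ((1 + K) * t).

Lemma tail_ge0 (R : realType) (K B x1 x2 x t : R) : 0 <= B -> 0 <= tail K B x1 x2 x t.
Proof. by move=> B0; rewrite /tail mulr_ge0 ?expR_ge0// mulr_ge0// addr_ge0 ?expR_ge0. Qed.

Lemma cont2_tail (R : realType) (K B x1 x2 x t : R) : cont2 (tail K B x1 x2) x t.
Proof.
have cE (v : R -> R -> R) : cont2 v x t -> cont2 (fun x t => expR (v x t)) x t.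
  by move=> cv; apply: cont2_comp => //; exact: continuous_expR.
apply: cont2M; last first.
  by apply: cE; apply: cont2M; [exact: cont2_cst|exact: cont2_snd].
apply: cont2M; first exact: cont2_cst.
apply: cont2D; apply: cE; apply: cont2B;
  by [exact: cont2_cst|exact: cont2_fst].
Qed.

Lemma tail_dt (R : realType) (K B x1 x2 x t : R) :
  is_derive t 1 (tail K B x1 x2 x) ((1 + K) * tail K B x1 x2 x t).
Proof. by rewrite /tail; apply: is_derive_eq; rewrite /GRing.scale /=; ring. Qed.

Definition tailx (R : realType) (K B x1 x2 t x : R) : R :=
  B * (expR (x - x2) - expR (x1 - x)) * expR ((1 + K) * t).

Lemma tail_dx (R : realType) (K B x1 x2 x t : R) :
  is_derive x 1 (fun x => tail K B x1 x2 x t) (tailx K B x1 x2 t x).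
Proof. by rewrite /tail /tailx; apply: is_derive_eq; rewrite /GRing.scale /=; ring. Qed.

Lemma tailx_dx (R : realType) (K B x1 x2 x t : R) :
  is_derive x 1 (tailx K B x1 x2 t) (tail K B x1 x2 x t).
Proof. by rewrite /tail /tailx; apply: is_derive_eq; rewrite /GRing.scale /=; ring. Qed.

Lemma tail_bound (R : realType) (K B x1 x2 t : R) : 0 < K -> 0 <= B -> 0 <= t ->
  B <= tail K B x1 x2 x1 t /\ B <= tail K B x1 x2 x2 t.
Proof.
move=> K0 B0 t0; rewrite /tail !subrr expR0.
have e1 : 1 <= expR ((1 + K) * t) by rewrite -expR0 ler_expR mulr_ge0// addr_ge0// ltW.
have H c : 0 <= c -> B <= B * (1 + c) * expR ((1 + K) * t).
  move=> c0; rewrite -mulrA ler_peMr//.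
  by rewrite -[leLHS]mulr1 ler_pM//; lra.
by split; [|rewrite addrC]; apply: H; rewrite expR_ge0.
Qed.

Lemma flat_cmp (R : realType) (K B M a : R) (g z : R -> R -> R) (x1 x2 s0 S : R) :
  0 < K -> lip_field K g -> psol g z -> 0 <= s0 ->
  (forall x, x1 <= x <= x2 -> z x s0 <= flow g s0 a) ->
  (forall x t, 0 <= t -> z x t <= M) -> 0 <= B ->
  (forall t, 0 <= t <= S -> M - B <= flow g t a) ->
  forall x t, x1 <= x <= x2 -> s0 <= t <= S ->
    z x t <= flow g t a + tail K B x1 x2 x t.
Proof.
move=> K0 gl zs s00 zi zM B0 GB.
have [_ cf df] := flowP a K0 gl.
apply: (@supersol_cmp R K g z (fun x t => flow g t a + tail K B x1 x2 x t)) => //.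
- move=> x t _ _; apply: cont2D; last exact: cont2_tail.
  by apply: (flow_comp_cont K0 gl (psi := fun _ _ => a)); exact: cont2_cst.
- by move=> x hx; rewrite (le_trans (zi x hx))// lerDl tail_ge0.
- move=> t /andP[ht tS]; have t0 : 0 <= t by lra.
  have [b1 b2] := tail_bound x1 x2 K0 B0 t0.
  have := GB t ltac:(by rewrite t0); have := zM x1 t t0; have := zM x2 t t0.
  by split; lra.
- move=> x t _ /andP[t0 _]; have tp : 0 < t by lra.
  have d1 := df t tp; have d2 := tail_dt K B x1 x2 x t.
  exists (g t (flow g t a) + (1 + K) * tail K B x1 x2 x t).
  exists (fun x => flow g t a + tail K B x1 x2 x t), (tailx K B x1 x2 t), (tail K B x1 x2 x t).
  split.
  + exact: is_derive_eq.
  + by [].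
  + move=> y; have d3 := tail_dx K B x1 x2 y t.
    by have := is_deriveD (is_derive_cst (flow g t a) y 1) d3; rewrite add0r.
  + exact: tailx_dx.
  + have := ler_norm (g t (flow g t a + tail K B x1 x2 x t) - g t (flow g t a)).
    have := gl.2 t (flow g t a + tail K B x1 x2 x t) (flow g t a).
    rewrite [X in K * `|X|]addrAC subrr add0r (ger0_norm (tail_ge0 _ _ _ _ _ B0)); lra.
Qed.

(* While [`|psi| < flow_rad K rho S], [flow g t psi] stays in the ball of radius [rho] up to
   time [S + 1], and [flow_curv] bounds the ratio of its second to its first derivative in [psi]. *)
Definition flow_rad (R : realType) (K rho S : R) : R := rho * expR (- (K * (S + 1))).

Definition flow_curv (R : realType) (K L S : R) : R :=
  2 * (L * (S + 1) * expR (3 * K * (S + 1))) * expR (K * (S + 1)).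

Lemma flow_cmp (R : realType) (K L rho B : R) (g gz z : R -> R -> R)
    (psi psit psix psixx : R -> R -> R) (x1 x2 s0 S : R) :
  smooth_field K L rho g gz -> psol g z -> 0 <= s0 -> 0 <= B ->
  (forall x t, x1 <= x <= x2 -> s0 <= t <= S -> cont2 psi x t) ->
  (forall x t, x1 <= x <= x2 -> s0 <= t <= S -> `|psi x t| < flow_rad K rho S) ->
  (forall x t : R, 0 < t -> is_derive t 1 (psi x) (psit x t)) ->
  (forall x t : R, 0 < t -> is_derive x 1 (psi^~ t) (psix x t)) ->
  (forall x t : R, 0 < t -> is_derive x 1 (psix^~ t) (psixx x t)) ->
  (forall x t, x1 < x < x2 -> s0 < t <= S ->
     psixx x t + flow_curv K L S * psix x t ^+ 2 <= psit x t) ->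
  (forall x, x1 <= x <= x2 -> z x s0 <= flow g s0 (psi x s0) + tail K B x1 x2 x s0) ->
  (forall t, s0 <= t <= S -> z x1 t <= flow g t (psi x1 t) + tail K B x1 x2 x1 t
      /\ z x2 t <= flow g t (psi x2 t) + tail K B x1 x2 x2 t) ->
  forall x t, x1 <= x <= x2 -> s0 <= t <= S ->
    z x t <= flow g t (psi x t) + tail K B x1 x2 x t.
Proof.
move=> sf zs s00 B0 cpsi psib dt dx dxx Hpsi zi zb.
have K0 := sf_K sf; have gl := sf_lip sf; have L0 := sf_L sf.
apply: (@supersol_cmp R K g z (fun x t => flow g t (psi x t) + tail K B x1 x2 x t)) => //.
- move=> x t hx ht; apply: cont2D; last exact: cont2_tail.
  by apply: (flow_comp_cont K0 gl); exact: cpsi.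
move=> x t hx ht; have tp : 0 < t by lra.
have hx' : x1 <= x <= x2 by lra.
have ht' : s0 <= t <= S by lra.
have S1 : 0 <= S + 1 by lra.
have tS1 : 0 <= t <= S + 1 by lra.
set C := L * (S + 1) * expR (3 * K * (S + 1)).
have C0 : 0 <= C by rewrite mulr_ge0 ?expR_ge0// mulr_ge0.
have [J [dJ cJ Jlow Jexp]] := flow_expand sf S1 (ltW (psib x t hx' ht')).
have d1 := tail_dt K B x1 x2 x t.
have d2 : is_derive t 1 (fun s => flow g s (psi x s)) (g t (flow g t (psi x t)) + J t * psit x t).
  apply: (flow_comp_derive sf S1 _ (dt x t tp) (psib x t hx' ht') (dJ t tp)); first by lra.
  by move=> s b hs hb; exact: Jexp.
pose D y := psi y t - psi x t.
have dD (y : R) : is_derive y 1 D (psix y t).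
  by have d3 := dx y t tp; rewrite /D; apply: is_derive_eq; rewrite subr0.
exists (g t (flow g t (psi x t)) + J t * psit x t + (1 + K) * tail K B x1 x2 x t).
exists (fun y => flow g t (psi x t) + J t * D y + C * D y ^+ 2 + tail K B x1 x2 y t).
exists (fun y => J t * psix y t + C * (2 * D y * psix y t) + tailx K B x1 x2 t y).
exists (J t * psixx x t + C * (2 * psix x t ^+ 2) + tail K B x1 x2 x t).
split.
- exact: is_derive_eq.
- split; first by rewrite /D subrr; ring.
  move=> y hy; rewrite lerD2r.
  have := ler_norm (flow g t (psi y t) - flow g t (psi x t) - J t * (psi y t - psi x t)).
  by have := Jexp t (psi y t) tS1 (ltW (psib y t hy ht')); rewrite -/C -/(D y); lra.
- move=> y; have d3 := dD y; have d4 := tail_dx K B x1 x2 y t.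
  by apply: is_derive_eq; rewrite /GRing.scale /=; ring.
- have d3 := dD x; have d4 := tailx_dx K B x1 x2 x t; have d5 := dxx x t tp.
  have D0 : D x = 0 by rewrite /D subrr.
  by apply: is_derive_eq; rewrite /GRing.scale /= D0; ring.
- have h1 := Hpsi x t hx ht.
  have := ler_norm (g t (flow g t (psi x t) + tail K B x1 x2 x t) - g t (flow g t (psi x t))).
  have := gl.2 t (flow g t (psi x t) + tail K B x1 x2 x t) (flow g t (psi x t)).
  rewrite [X in K * `|X|]addrAC subrr add0r (ger0_norm (tail_ge0 _ _ _ _ _ B0)).
  suff : J t * psixx x t + C * (2 * psix x t ^+ 2) <= J t * psit x t by lra.
  have Jt := Jlow t tS1.
  have J0 : 0 <= J t by rewrite (le_trans _ Jt)// expR_ge0.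
  apply: le_trans (ler_wpM2l J0 h1); rewrite mulrDr lerD2l.
  have := sqr_ge0 (psix x t); move: (psix x t ^+ 2) => q q0; rewrite [leRHS]mulrA [leLHS](_ : _ = C * 2 * q); last by ring.
  apply: ler_wpM2r => //.
  have e0 := expR_gt0 (K * (S + 1)).
  apply: (@le_trans _ _ (expR (- (K * (S + 1))) * flow_curv K L S)); last first.
    apply: ler_wpM2r; last exact: Jt.
    by apply: mulr_ge0; [exact: mulr_ge0|exact: ltW].
  by rewrite /flow_curv -/C expRN le_eqVlt; apply/orP; left; apply/eqP; field; rewrite gt_eqF.
Qed.


(** * Bowls *)

Lemma bowl_closing (R : realType) (P : R -> R) (A E tau m c d : R) :
  1 <= E -> 0 < A -> 0 < tau -> 2 * E * A * tau <= m -> d = 3 / 8 * tau * (1 + E^-1) ->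
  (forall a b, a <= b -> P a <= P b) -> (forall a b, a <= b -> P b - P a <= E * (b - a)) ->
  P 0 = 0 -> (forall a, - (3 / 2 * A) <= a <= 0 -> P a <= a) ->
  (forall a, - (3 / 2 * A) <= a <= - (3 / 8 * A) -> P a <= a - m) ->
  - 2^-1 - d <= c <= 1 ->
  P (- A * (c + 2^-1) + tau * A * (c + 8^-1)) <= - A * (c + 2^-1).
Proof.
move=> E1 A0 t0 tm dE Pm Pl P0 Pneg Pmm /andP[c1 c2].
have E0 : 0 < E by lra.
have tA : 0 < tau * A by rewrite mulr_gt0.
have leA u v : u <= v -> A * u <= A * v by apply: ler_wpM2l; exact: ltW.
have letA u v : u <= v -> tau * A * u <= tau * A * v by apply: ler_wpM2l; exact: ltW.
have leE u v : u <= v -> E * u <= E * v by apply: ler_wpM2l; exact: ltW.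
set phi := - A * (c + 2^-1).
have phi_lo : - (3 / 2 * A) <= phi.
  have := leA _ _ c2.
  by rewrite /phi; lra.
have [h8|h8] := lerP (- 8^-1) c.
  have phi8 : phi <= - (3 / 8 * A).
    have := leA _ _ h8.
    by rewrite /phi; lra.
  have := letA _ _ h8 => q0.
  have q1 : tau * A * (c + 8^-1) <= tau * A * 2 by apply: letA; lra.
  have := Pl phi (phi + tau * A * (c + 8^-1)) ltac:(lra).
  have := Pmm phi ltac:(lra).
  have := leE _ _ q1.
  rewrite addrAC subrr add0r; lra.
have tneg := letA _ _ (ltW h8).
have [h2|h2] := lerP (- 2^-1) c.
  have phi0 : phi <= 0.
    have := leA _ _ h2.
    by rewrite /phi; lra.
  by apply: le_trans (Pneg phi _); [apply: Pm; lra|lra].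
have phi0 : 0 <= phi.
  have := leA _ _ (ltW h2).
  by rewrite /phi; lra.
have [hn|hp] := lerP (phi + tau * A * (c + 8^-1)) 0.
  by apply: le_trans phi0; rewrite -P0; exact: Pm.
have := Pl 0 _ (ltW hp); rewrite P0 !subr0 => /le_trans; apply.
pose x := - (c + 2^-1).
have xd : x <= d by rewrite /x; lra.
have x0 : 0 <= x by rewrite /x; lra.
have -> : phi + tau * A * (c + 8^-1) = A * (x - tau * (x + 3 / 8)).
  by rewrite /phi /x; field.
have -> : phi = A * x by rewrite /phi /x; ring.
rewrite mulrCA; apply: leA.
have k1 : (E - 1) * d <= 3 / 8 * E * tau.
  have -> : (E - 1) * d = 3 / 8 * E * tau - 3 / 8 * tau / E.
    by rewrite dE; field; rewrite gt_eqF.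
  by rewrite gerBl mulr_ge0 ?invr_ge0 ?(ltW E0)// mulr_ge0// ltW.
have k2 : (E - 1) * x <= (E - 1) * d by rewrite ler_wpM2l//; lra.
have k3 : 0 <= E * (tau * x) := mulr_ge0 (ltW E0) (mulr_ge0 (ltW t0) x0).
lra.
Qed.

Lemma cos_itv_ge (R : realType) (x l : R) : 0 <= l <= pi -> `|x| <= l -> cos l <= cos x.
Proof.
move=> /andP[l0 lpi] xl.
have -> : cos x = cos `|x| by case: (lerP 0 x) => hx; rewrite ?(ger0_norm hx)// ltr0_norm// cosN.
have [->//|xl'] := eqVneq `|x| l.
rewrite ltW// ltr_cos ?in_itv/= ?l0// ?normr_ge0 ?(le_trans xl)//.
by rewrite lt_neqAle xl'.
Qed.

Lemma bowl_exists (R : realType) (K L rho T eps : R) (g gz : R -> R -> R) :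
  smooth_field K L rho g gz -> 0 < T -> 0 < eps ->
  (forall a, - eps < a -> a < 0 -> flow g T a < a) ->
  exists2 A0, 0 < A0 & forall A, 0 < A -> A <= A0 ->
  exists l eta (phi : R -> R), [/\ 0 < l, 0 < eta, phi 0 = - (3 / 2 * A),
    forall x, - (3 / 2 * A) <= phi x &
    forall z s, psol g z -> (forall x, `|x| <= l -> z (s + x) 0 <= phi x) ->
      (forall t, 0 <= t <= T -> z (s - l) t <= eta /\ z (s + l) t <= eta) ->
      forall x, `|x| <= l -> z (s + x) T <= phi x].
Proof.
move=> sf T0 eps0 Peps.
have K0 := sf_K sf; have gl := sf_lip sf; have L0 := sf_L sf; have r0 := sf_rho sf.
pose C1 := flow_curv K L T; pose rad := flow_rad K rho T.
have C10 : 0 <= C1.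
  rewrite /C1 /flow_curv mulr_ge0 ?expR_ge0// mulr_ge0// mulr_ge0 ?expR_ge0//.
  by rewrite mulr_ge0//; lra.
have rad0 : 0 < rad by rewrite mulr_gt0 ?expR_gt0.
exists (Num.min (eps / 2) (Num.min (rad / 2) (16 * (C1 + 1))^-1)).
  by rewrite !lt_min !divr_gt0//= invr_gt0 mulr_gt0//; lra.
move=> A A0; rewrite !le_min => /and3P[Aeps Arad].
have C11 : 0 < 16 * (C1 + 1) by lra.
rewrite -[_^-1]div1r ler_pdivlMr// => AC1.
have CA : C1 * A <= 16^-1 by lra.
pose E := expR (K * T).
have E1 : 1 <= E by rewrite /E -expR0 ler_expR mulr_ge0// ltW.
have E0 : 0 < E by lra.
pose P a := flow g T a.
have Pm a b : a <= b -> P a <= P b by move=> ab; apply: (flow_mono K0 gl) => //; exact: ltW.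
have Pl a b : a <= b -> P b - P a <= E * (b - a).
  move=> ab; rewrite (le_trans (ler_norm _))//.
  have := flow_dist a b K0 gl (ltW T0).
  by rewrite (ger0_norm (_ : 0 <= b - a))// subr_ge0.
have P0 : P 0 = 0 by exact: (flow_zero sf (ltW T0)).
have Pneg a : - (3 / 2 * A) <= a <= 0 -> P a <= a.
  move=> ha; have [->|na] := eqVneq a 0; first by rewrite P0.
  apply/ltW/Peps; first by lra.
  by rewrite lt_neqAle na; lra.
have [m m0 Pmm] : exists2 m, 0 < m &
    forall a, - (3 / 2 * A) <= a <= - (3 / 8 * A) -> P a <= a - m.
  have cP : {within `[- (3 / 2 * A), - (3 / 8 * A)], continuous (fun a => a - P a)}.
    apply: continuous_subspaceT => a; apply: cvgB; first exact: cvg_id.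
    apply/cont_epsP => e e0; exists (e / E); first by rewrite divr_gt0.
    move=> b; rewrite ltr_pdivlMr// mulrC => h.
    exact: le_lt_trans (flow_dist a b K0 gl (ltW T0)) h.
  have [|c] := EVT_min _ cP; first by lra.
  rewrite in_itv/= => hc Hc; exists (c - P c); first by rewrite subr_gt0; apply: Peps; lra.
  by move=> a ha; have := Hc a; rewrite in_itv/= => /(_ ha); lra.
pose tau := Num.min 16^-1 (Num.min (m / (2 * E * A)) (2 * (E + 1))^-1).
have EA0 : 0 < 2 * E * A by rewrite !mulr_gt0.
have E2 : 0 < 2 * (E + 1) by lra.
have t0 : 0 < tau by rewrite !lt_min invr_gt0 divr_gt0//= invr_gt0 E2 andbT.
have : tau <= tau by [].
rewrite {2}/tau !le_min -[(2 * (E + 1))^-1]div1r !ler_pdivlMr// => /and3P[t16 tm tE].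
rewrite mulrC in tm.
pose k := Num.sqrt (tau / T).
have k0 : 0 < k by rewrite sqrtr_gt0 divr_gt0.
have k2 : k ^+ 2 = tau / T by rewrite sqr_sqrtr// ltW// divr_gt0.
have Tk2 : T * k ^+ 2 = tau by rewrite k2; field; rewrite gt_eqF.
have k20 : 0 <= k ^+ 2 by rewrite sqr_ge0.
pose d := 3 / 8 * tau * (1 + E^-1).
have Ei : 0 < E^-1 <= 1 by rewrite invr_gt0 E0 invf_le1.
have d0 : 0 < d by rewrite !mulr_gt0//; lra.
have d1 : d <= 3 / 4 * tau.
  have : tau * (1 + E^-1) <= tau * 2 by apply: ler_wpM2l; [exact: ltW|lra].
  by rewrite /d; lra.
have e0 : 0 < d - tau * (d + 3 / 8).
  have -> : d - tau * (d + 3 / 8) = (3 / 8) * tau * (E^-1 - tau * (1 + E^-1)) by rewrite /d; ring.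
  rewrite !mulr_gt0// subr_gt0 -(ltr_pM2r E0) mulVf ?gt_eqF// -mulrA mulrDl mulVf ?gt_eqF//.
  lra.
pose y := - 2^-1 - d.
have y1 : -1 <= y <= 1 by rewrite /y; lra.
have [ac0 cac] := acos_def y1.
pose l := acos y / k.
have kl : k * l = acos y by rewrite /l mulrC divfK// gt_eqF.
have l0 : 0 < l by rewrite divr_gt0// acos_gt0// /y; lra.
pose eta := expR (- K * T) * (A * (d - tau * (d + 3 / 8))).
exists l, eta, (fun x => - A * (cos (k * x) + 2^-1)); split => //.
- by rewrite !mulr_gt0 ?expR_gt0.
- by rewrite mulr0 cos0; field.
- move=> x; have := cos_le1 (k * x) => hc.
  have : A * cos (k * x) <= A * 1 by rewrite ler_wpM2l// ltW.
  by lra.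
move=> z s zs zi zb x xl.
(* The slack of about [A k^2 / 8] in [psit - psixx] absorbs the gradient term. Over one period the
   profile rises by [A tau (c + 1/8)], which [P] undoes by [bowl_closing]. *)
pose cs (x : R) : R := cos (k * (x - s)); pose sn (x : R) : R := sin (k * (x - s)).
pose psi (x t : R) : R := - A * (cs x + 2^-1) + t * (A * k ^+ 2 * (cs x + 8^-1)).
pose psit (x t : R) : R := A * k ^+ 2 * (cs x + 8^-1).
pose psix (x t : R) : R := A * k * sn x * (1 - t * k ^+ 2).
pose psixx (x t : R) : R := A * k ^+ 2 * cs x * (1 - t * k ^+ 2).
have dcs (u : R) : is_derive u 1 cs (- k * sn u).
  by rewrite /cs /sn; apply: is_derive_eq; rewrite /GRing.scale /=; ring.
have dsn (u : R) : is_derive u 1 sn (k * cs u).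
  by rewrite /cs /sn; apply: is_derive_eq; rewrite /GRing.scale /=; ring.
have cs1 u : -1 <= cs u <= 1 by rewrite cos_le1 cos_geN1.
have tk (t : R) : 0 <= t <= T -> 0 <= t * k ^+ 2 <= tau.
  by move=> /andP[h1 h2]; rewrite mulr_ge0//= -Tk2 ler_wpM2r.
have csy (u : R) : `|u| <= l -> y <= cs (s + u).
  move=> ul; rewrite -cac /cs addrAC subrr add0r; apply: cos_itv_ge => //.
  by rewrite normrM gtr0_norm// -kl ler_wpM2l// ltW.
have csl : cs (s - l) = y /\ cs (s + l) = y.
  rewrite /cs; have -> : s - l - s = - l by ring.
  have -> : s + l - s = l by ring.
  by rewrite mulrN cosN kl.
have xx : s - l <= s + x <= s + l by move: xl; rewrite ler_norml; clear; lra.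
have TT : 0 <= T <= T by rewrite lexx ltW.
have tl0 (u v : R) : tail K 0 (s - l) (s + l) u v = 0 by rewrite /tail !mul0r.
have leA (u v : R) : u <= v -> A * u <= A * v by apply: ler_wpM2l; exact: ltW.
have cpsi (u t : R) : s - l <= u <= s + l -> 0 <= t <= T -> cont2 psi u t.
  move=> _ _.
  have ccs : cont2 (fun u _ : R => cs u) u t.
    by apply: cont2_comp; [exact: cont2_fst|exact: is_derive1_cont (dcs u)].
  apply: cont2D.
    by apply: cont2M; [exact: cont2_cst|apply: cont2D; [exact: ccs|exact: cont2_cst]].
  apply: cont2M; first exact: cont2_snd.
  by apply: cont2M; [exact: cont2_cst|apply: cont2D; [exact: ccs|exact: cont2_cst]].
have tAb (u t : R) : 0 <= t <= T -> `|t * (A * k ^+ 2 * (cs u + 8^-1))| <= A / 8.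
  move=> ht; have /andP[h1 h2] := tk t ht.
  have -> : t * (A * k ^+ 2 * (cs u + 8^-1)) = A * (t * k ^+ 2 * (cs u + 8^-1)) by ring.
  rewrite normrM (gtr0_norm A0); apply: leA.
  rewrite normrM (ger0_norm h1).
  have h3 : `|cs u + 8^-1| <= 2 by rewrite ler_norml; have := cs1 u; clear; lra.
  by have := ler_pM h1 (normr_ge0 _) h2 h3; clear -t16; lra.
have psib (u t : R) : s - l <= u <= s + l -> 0 <= t <= T -> `|psi u t| < flow_rad K rho T.
  move=> _ ht; rewrite /psi (le_lt_trans (ler_normD _ _))//.
  have h1 := tAb u t ht.
  have h2 : `|- A * (cs u + 2^-1)| <= A * (3 / 2).
    rewrite normrM normrN (gtr0_norm A0); apply: leA.
    by rewrite ler_norml; have := cs1 u; clear; lra.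
  by rewrite -/rad; clear -h1 h2 Arad A0; lra.
have dt (u t : R) : 0 < t -> is_derive t 1 (psi u) (psit u t).
  by move=> _; rewrite /psi /psit; apply: is_derive_eq; rewrite /GRing.scale /=; ring.
have dx (u t : R) : 0 < t -> is_derive u 1 (psi^~ t) (psix u t).
  move=> _; have d2 := dcs u; rewrite /psi /psix.
  by apply: is_derive_eq; rewrite /GRing.scale /=; ring.
have dxx (u t : R) : 0 < t -> is_derive u 1 (psix^~ t) (psixx u t).
  move=> _; have d2 := dsn u; rewrite /psix /psixx.
  by apply: is_derive_eq; rewrite /GRing.scale /=; ring.
have Hpsi (u t : R) : s - l < u < s + l -> 0 < t <= T ->
    psixx u t + flow_curv K L T * psix u t ^+ 2 <= psit u t.
  move=> _ ht; have ht' : 0 <= t <= T by case/andP: ht => q1 q2; rewrite ltW.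
  have /andP[h1 h2] := tk t ht'.
  rewrite -/C1 /psixx /psix /psit.
  have -> : A * k ^+ 2 * cs u * (1 - t * k ^+ 2) + C1 * (A * k * sn u * (1 - t * k ^+ 2)) ^+ 2 =
    A * k ^+ 2 * (cs u - cs u * (t * k ^+ 2) + C1 * A * (sn u ^+ 2 * (1 - t * k ^+ 2) ^+ 2)) by ring.
  apply: ler_wpM2l; first by rewrite mulr_ge0// ltW.
  have s1 : 0 <= sn u ^+ 2 <= 1.
    by rewrite sqr_ge0 /=; have := cos2Dsin2 (k * (u - s)); have := sqr_ge0 (cs u); rewrite /sn /cs; clear; lra.
  have s2 : 0 <= (1 - t * k ^+ 2) ^+ 2 <= 1.
    by rewrite sqr_ge0 /= expr_le1//; clear -h1 h2 t16; lra.
  have s3 : sn u ^+ 2 * (1 - t * k ^+ 2) ^+ 2 <= 1.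
    by rewrite mulr_ile1//; [case/andP: s1|case/andP: s2|case/andP: s1|case/andP: s2].
  have s4 : C1 * A * (sn u ^+ 2 * (1 - t * k ^+ 2) ^+ 2) <= C1 * A.
    by apply: ler_piMr s3; apply: mulr_ge0 => //; exact: ltW.
  have s5 : - (cs u * (t * k ^+ 2)) <= t * k ^+ 2.
    have : -1 * (t * k ^+ 2) <= cs u * (t * k ^+ 2) by apply: ler_wpM2r => //; case/andP: (cs1 u).
    by clear; lra.
  by clear -s4 s5 CA h2 t16; lra.
have rim (t : R) : 0 <= t <= T -> forall u, cs u = y -> eta <= flow g t (psi u t).
  move=> ht u cu; have /andP[h1 h2] := tk t ht; have /andP[h3 h4] := ht.
  have -> : psi u t = A * (d - t * k ^+ 2 * (d + 3 / 8)).
    by rewrite /psi cu /y; field.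
  have q : A * (d - tau * (d + 3 / 8)) <= A * (d - t * k ^+ 2 * (d + 3 / 8)).
    apply: leA; rewrite lerB//; apply: ler_wpM2r => //; clear -d0; lra.
  have q0 : 0 < A * (d - tau * (d + 3 / 8)) by rewrite mulr_gt0.
  have q1 : 0 <= A * (d - t * k ^+ 2 * (d + 3 / 8)) := le_trans (ltW q0) q.
  have := flow_gap K0 gl q1 h3; rewrite (flow_zero sf h3) !subr0; apply: le_trans.
  rewrite /eta ler_pM ?expR_ge0 ?(ltW q0)// ler_expR !mulNr lerN2.
  by apply: ler_wpM2l => //; exact: ltW.
have [csm csp] := csl.
have Hi (u : R) : s - l <= u <= s + l -> z u 0 <= flow g 0 (psi u 0) + tail K 0 (s - l) (s + l) u 0.
  move=> hu; rewrite tl0 addr0 (flow0 _ K0 gl) /psi mul0r addr0.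
  have := zi (u - s); rewrite subrKC; apply.
  by rewrite ler_norml; clear -hu; lra.
have Hb (t : R) : 0 <= t <= T -> z (s - l) t <= flow g t (psi (s - l) t) + tail K 0 (s - l) (s + l) (s - l) t
   /\ z (s + l) t <= flow g t (psi (s + l) t) + tail K 0 (s - l) (s + l) (s + l) t.
  move=> ht; rewrite !tl0 !addr0; have [b1 b2] := zb t ht.
  by split; [apply: (le_trans b1)|apply: (le_trans b2)]; exact: rim.
have H := flow_cmp sf zs (lexx 0) (lexx 0) cpsi psib dt dx dxx Hpsi Hi Hb xx TT.
apply: (le_trans H); rewrite tl0 addr0.
have -> : psi (s + x) T = - A * (cs (s + x) + 2^-1) + tau * A * (cs (s + x) + 8^-1).
  by rewrite /psi -Tk2; ring.
have -> : cos (k * x) = cs (s + x) by rewrite /cs addrAC subrr add0r.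
apply: (@bowl_closing R P A E tau m _ d) => //.
by rewrite (csy x xl) /=; case/andP: (cs1 (s + x)).
Qed.


(** * Comparison on the whole line *)

Lemma psol_shift (R : realType) (g z : R -> R -> R) (T : R) : 0 <= T ->
  (forall t a : R, 0 <= t -> g (t + T) a = g t a) -> psol g z ->
  psol g (fun x t => z x (t + T)).
Proof.
move=> T0 gT [zx [zxx H]]; exists (fun x t => zx x (t + T)), (fun x t => zxx x (t + T)).
move=> x t t0; have [h1 h2 h3 h4] := H x (t + T) (addr_ge0 t0 T0); split => //.
- rewrite -gT//; apply/is_derive_epsP => e /(proj1 (is_derive_epsP _ _ _) h3) [d d0 Hd].
  by exists d => // h /Hd; rewrite (addrAC t h).
- apply/cont2P => e e0; have [d d0 Hd] := proj1 (cont2P _ _ _) h4 e e0.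
  exists d => // x' t' hx ht; apply: Hd => //.
  by have -> : t' + T - (t + T) = t' - t by ring.
Qed.

Lemma psol_shiftn (R : realType) (g z : R -> R -> R) (T : R) n : 0 <= T ->
  (forall t a : R, 0 <= t -> g (t + T) a = g t a) -> psol g z ->
  psol g (fun x t => z x (t + n%:R * T)).
Proof.
move=> T0 gT; elim: n z => [|n IH] z zs.
  have -> // : (fun x t => z x (t + 0%:R * T)) = z.
  by apply/funext => x; apply/funext => t; rewrite mul0r addr0.
have := IH _ (psol_shift T0 gT zs).
have -> // : (fun x t => z x (t + n%:R * T + T)) = (fun x t => z x (t + n.+1%:R * T)).
by apply/funext => x; apply/funext => t; rewrite -natr1 mulrDl mul1r addrA.
Qed.

Lemma expR_small (R : realType) (c e : R) : 0 < e -> exists2 Y, 0 < Y &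
  forall y, Y <= y -> c * expR (- y) < e.
Proof.
move=> e0; exists (`|c| / e + 1); first by rewrite ltr_wpDl// divr_ge0// ltW.
move=> y hy.
have y1 : `|c| / e < 1 + y by have := normr_ge0 c; lra.
have : `|c| < e * expR y.
  rewrite mulrC -ltr_pdivrMr//; apply: (lt_le_trans y1); exact: expR_ge1Dx.
rewrite expRN ltr_pdivrMr ?expR_gt0//; apply: le_lt_trans; exact: ler_norm.
Qed.

Lemma tail_small (R : realType) (K B t e : R) : 0 < e -> 0 <= B -> exists2 Y, 0 < Y &
  forall x1 x2 x s, x1 + Y <= x -> x <= x2 - Y -> s <= t -> 0 <= K -> tail K B x1 x2 x s < e.
Proof.
move=> e0 B0; have [Y Y0 HY] := @expR_small R (2 * B * expR ((1 + K) * t)) e e0.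
exists Y => // x1 x2 x s h1 h2 st K0; apply: le_lt_trans (HY Y (lexx Y)); rewrite /tail.
have a1 : expR (x1 - x) <= expR (- Y) by rewrite ler_expR; lra.
have a2 : expR (x - x2) <= expR (- Y) by rewrite ler_expR; lra.
have a3 : expR ((1 + K) * s) <= expR ((1 + K) * t) by rewrite ler_expR ler_wpM2l// addr_ge0.
have -> : 2 * B * expR ((1 + K) * t) * expR (- Y) = B * (expR (- Y) + expR (- Y)) * expR ((1 + K) * t) by ring.
apply: ler_pM => //; rewrite ?expR_ge0//.
  by rewrite mulr_ge0// addr_ge0 ?expR_ge0.
by apply: ler_wpM2l => //; exact: lerD.
Qed.

Lemma flat_cmp_line (R : realType) (K M a S : R) (g z : R -> R -> R) :
  0 < K -> lip_field K g -> psol g z ->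
  (forall x, z x 0 <= a) -> (forall x t, 0 <= t -> z x t <= M) ->
  (exists m, forall t, 0 <= t <= S -> m <= flow g t a) ->
  forall x t, 0 <= t <= S -> z x t <= flow g t a.
Proof.
move=> K0 gl zs zi zM [m Hm] x t ht; apply/ler_addgt0Pl => e e0.
pose B := `|M - m|.
have [Y Y0 HY] := @tail_small R K B t e e0 (normr_ge0 _).
pose X := `|x| + Y.
have xX : - X <= x <= X by rewrite -ler_norml /X lerDl ltW.
have zi' y : - X <= y <= X -> z y 0 <= flow g 0 a by rewrite (flow0 _ K0 gl).
have hB s : 0 <= s <= S -> M - B <= flow g s a.
  by move=> hs; have := Hm s hs; have := ler_norm (M - m); rewrite /B; lra.
have := flat_cmp K0 gl zs (lexx 0) zi' zM (normr_ge0 _) hB xX ht.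
have := HY (- X) X x t; have := ler_norm x; have := ler_norm (- x); rewrite normrN.
move=> h1 h2 /(_ ltac:(rewrite /X; lra) ltac:(rewrite /X; lra) (lexx _) (ltW K0)).
by rewrite -/B; lra.
Qed.

Lemma flow_cmp_line (R : realType) (K L rho M : R) (g gz z : R -> R -> R)
    (psi psit psix psixx : R -> R -> R) (S : R) :
  smooth_field K L rho g gz -> psol g z ->
  (forall x t, 0 <= t -> z x t <= M) ->
  (forall x t, 0 <= t <= S -> cont2 psi x t) ->
  (forall x t, 0 <= t <= S -> `|psi x t| < flow_rad K rho S) ->
  (forall x t : R, 0 < t -> is_derive t 1 (psi x) (psit x t)) ->
  (forall x t : R, 0 < t -> is_derive x 1 (psi^~ t) (psix x t)) ->
  (forall x t : R, 0 < t -> is_derive x 1 (psix^~ t) (psixx x t)) ->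
  (forall x t, 0 < t <= S ->
     psixx x t + flow_curv K L S * psix x t ^+ 2 <= psit x t) ->
  (forall x, z x 0 <= psi x 0) ->
  forall x t, 0 <= t <= S -> z x t <= flow g t (psi x t).
Proof.
move=> sf zs zM cpsi psib dt dx dxx Hpsi zi x t ht; apply/ler_addgt0Pl => e e0.
have K0 := sf_K sf; have gl := sf_lip sf.
pose B := `|M| + expR (K * S) * flow_rad K rho S.
have rad0 : 0 <= flow_rad K rho S by rewrite /flow_rad mulr_ge0 ?expR_ge0// ltW// (sf_rho sf).
have B0 : 0 <= B by rewrite addr_ge0// mulr_ge0// expR_ge0.
have [Y Y0 HY] := @tail_small R K B t e e0 B0.
pose X := `|x| + Y.
have xX : - X <= x <= X by rewrite -ler_norml /X lerDl ltW.
have Gb y s : 0 <= s <= S -> M - B <= flow g s (psi y s).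
  move=> hs; have /andP[s0 sS] := hs.
  have : `|flow g s (psi y s)| <= expR (K * S) * flow_rad K rho S.
    apply: le_trans (flow_norm _ sf s0) _; apply: ler_pM => //; rewrite ?expR_ge0//.
      by rewrite ler_expR ler_wpM2l// ltW.
    by apply: ltW; exact: psib.
  by rewrite ler_norml /B; have := ler_norm M; lra.
have H : z x t <= flow g t (psi x t) + tail K B (- X) X x t.
  apply: (flow_cmp (s0 := 0) (S := S) sf zs (lexx 0) B0 (psit := psit) (psix := psix) (psixx := psixx)) => //.
  - by move=> y s _; exact: cpsi.
  - by move=> y s _; exact: psib.
  - by move=> y s _; exact: Hpsi.
  - move=> y _; rewrite (flow0 _ K0 gl) (le_trans (zi y))// lerDl.
    exact: tail_ge0.
  - move=> s hs; have /andP[s0 _] := hs; have [b1 b2] := tail_bound (- X) X K0 B0 s0.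
    have := Gb (- X) s hs; have := Gb X s hs; have := zM X s s0; have := zM (- X) s s0.
    by split; lra.
have := HY (- X) X x t; have := ler_norm x; have := ler_norm (- x); rewrite normrN.
move=> h1 h2 /(_ ltac:(rewrite /X; lra) ltac:(rewrite /X; lra) (lexx _) (ltW K0)).
by lra.
Qed.

(* [q + B ((s0 + t) / W)^(- gamma) exp (- x^2 / (4 kappa (s0 + t)))] with [gamma = 1 / (2 kappa)]; [kappa > 1] absorbs the gradient term. *)
Definition gauss (R : realType) (kappa W B s0 x t : R) : R :=
  B * expR (- (2 * kappa)^-1 * (ln (s0 + t) - ln W) - x ^+ 2 / (4 * kappa) * (s0 + t)^-1).

Lemma gauss_step (R : realType) (K L rho M T W s0 kappa B q eps : R) (g gz z : R -> R -> R) :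
  smooth_field K L rho g gz -> 0 < T -> psol g z ->
  (forall x t, 0 <= t -> z x t <= M) ->
  0 < W -> W <= s0 -> 0 <= B -> kappa = 1 + flow_curv K L T * B ->
  - flow_rad K rho T < q -> q + B < flow_rad K rho T -> q + B < eps ->
  (forall a, q <= a < eps -> flow g T a <= a) ->
  (forall x, z x 0 <= q + gauss kappa W B s0 x 0) ->
  forall x, z x T <= q + gauss kappa W B s0 x T.
Proof.
move=> sf T0 zs zM W0 Ws B0 kE q1 q2 q3 PT zi x.
have K0 := sf_K sf; have L0 := sf_L sf.
set C1 := flow_curv K L T in kE.
have C10 : 0 <= C1.
  rewrite /C1 /flow_curv mulr_ge0 ?expR_ge0// mulr_ge0// mulr_ge0 ?expR_ge0//.
  by rewrite mulr_ge0//; lra.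
have k1 : 1 <= kappa by rewrite kE lerDl mulr_ge0.
have k0 : 0 < kappa by lra.
pose G (x t : R) := gauss kappa W B s0 x t.
have sp (t : R) : 0 <= t -> 0 < s0 + t by lra.
have Gb (y t : R) : 0 <= t -> 0 <= G y t <= B.
  move=> t0; rewrite /G /gauss mulr_ge0 ?expR_ge0//= ler_piMr// -[leRHS]expR0 ler_expR.
  have st := sp t t0.
  have h1 : 0 <= (2 * kappa)^-1 * (ln (s0 + t) - ln W).
    apply: mulr_ge0; first by rewrite invr_ge0; lra.
    by rewrite subr_ge0 ler_ln ?posrE//; lra.
  have h2 : 0 <= y ^+ 2 / (4 * kappa) * (s0 + t)^-1.
    apply: mulr_ge0; last by rewrite invr_ge0 ltW.
    by apply: divr_ge0; [exact: sqr_ge0|lra].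
  lra.
pose psi (x t : R) := q + G x t.
pose lx (x t : R) := - x / (2 * kappa) * (s0 + t)^-1.
pose lt (x t : R) := - (2 * kappa)^-1 * (s0 + t)^-1 + x ^+ 2 / (4 * kappa) * (s0 + t)^-1 ^+ 2.
pose psit (x t : R) := G x t * lt x t.
pose psix (x t : R) := G x t * lx x t.
pose psixx (x t : R) := G x t * (lx x t ^+ 2 - (2 * kappa)^-1 * (s0 + t)^-1).
have dGt (y t : R) : 0 < t -> is_derive t 1 (G y) (psit y t).
  move=> t0; have st := sp t (ltW t0).
  have dln : is_derive t 1 (fun t => ln (s0 + t)) ((s0 + t)^-1).
    have d1 : is_derive t 1 (fun t : R => s0 + t) 1.
      by have := is_deriveD (is_derive_cst s0 t 1) (is_derive_id t 1); rewrite add0r.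
    have := @is_derive1_comp R (@ln R) (fun t => s0 + t) t (s0 + t)^-1 1 (is_derive1_ln st) d1.
    by rewrite mulr1.
  have dinv : is_derive t 1 (fun t => (s0 + t)^-1) (- (s0 + t)^-1 ^+ 2).
    have d1 : is_derive t 1 (fun t : R => s0 + t) 1.
      by have := is_deriveD (is_derive_cst s0 t 1) (is_derive_id t 1); rewrite add0r.
    have := @is_deriveV R (fun t => s0 + t) t 1 1 (lt0r_neq0 st) d1.
    by rewrite /GRing.scale /= mulr1 exprVn.
  rewrite /psit /G /gauss /lt; apply: is_derive_eq; rewrite /GRing.scale /=; ring.
have dquad (c1 c3 y : R) : is_derive y 1 (fun y => B * expR (c1 - y ^+ 2 * c3))
    (B * expR (c1 - y ^+ 2 * c3) * (- (2 * y * c3))).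
  have d1 : is_derive y 1 (fun y : R => y ^+ 2) (2 * y).
    by apply: is_derive_eq; rewrite /GRing.scale /=; ring.
  have d2 : is_derive y 1 (fun y : R => c1 - y ^+ 2 * c3) (- (2 * y * c3)).
    have := is_deriveB (is_derive_cst c1 y 1) (is_deriveM d1 (is_derive_cst c3 y 1)).
    by move/is_derive_eq; apply; rewrite /GRing.scale /=; ring.
  have d3 := @is_derive1_comp R expR (fun y : R => c1 - y ^+ 2 * c3) y _ _ (is_derive_expR _) d2.
  have := is_deriveM (is_derive_cst B y 1) d3.
  by move/is_derive_eq; apply; rewrite /GRing.scale /=; ring.
have dlin (c y : R) : is_derive y 1 (fun y => y * c) c.
  by apply: is_derive_eq; rewrite /GRing.scale /=; ring.
have dGx (y t : R) : 0 < t -> is_derive y 1 (G^~ t) (psix y t).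
  move=> t0; have st := sp t (ltW t0).
  have := dquad (- (2 * kappa)^-1 * (ln (s0 + t) - ln W)) ((4 * kappa)^-1 * (s0 + t)^-1) y.
  have -> : (fun y => B * expR (- (2 * kappa)^-1 * (ln (s0 + t) - ln W) - y ^+ 2 * ((4 * kappa)^-1 * (s0 + t)^-1))) = G^~ t.
    by apply/funext => v; rewrite /G /gauss mulrA.
  rewrite mulrA -/(gauss kappa W B s0 y t) -/(G y t) /psix.
  have -> // : - (2 * y * ((4 * kappa)^-1 / (s0 + t))) = lx y t.
  by rewrite /lx; field; rewrite !gt_eqF.
have dlx (y t : R) : 0 < t -> is_derive y 1 (lx^~ t) (- (2 * kappa)^-1 * (s0 + t)^-1).
  move=> t0; have -> : lx^~ t = fun y => y * (- (2 * kappa)^-1 * (s0 + t)^-1).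
    by apply/funext => v; rewrite /lx; ring.
  exact: dlin.
have TT : 0 <= T <= T by rewrite lexx ltW.
have H : z x T <= flow g T (psi x T).
  have cpsi (y t : R) : 0 <= t <= T -> cont2 psi y t.
    move=> /andP[t0 _]; have st := sp t t0.
    have cs : cont2 (fun _ t : R => s0 + t) y t by apply: cont2D; [exact: cont2_cst|exact: cont2_snd].
    apply: cont2D; first exact: cont2_cst.
    apply: cont2M; first exact: cont2_cst.
    apply: cont2_comp; last exact: continuous_expR.
    apply: cont2B.
      apply: cont2M; first exact: cont2_cst.
      apply: cont2B; last exact: cont2_cst.
      by apply: cont2_comp cs _; exact: continuous_ln.
    apply: cont2M.
      apply: cont2M; last exact: cont2_cst.
      by apply: cont2M; exact: cont2_fst.
    by apply: (@cont2_comp R (fun u => u^-1) _ y t cs); apply: inv_continuous; rewrite gt_eqF.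
  have psib (y t : R) : 0 <= t <= T -> `|psi y t| < flow_rad K rho T.
    by move=> /andP[t0 _]; have := Gb y t t0; rewrite ltr_norml /psi; lra.
  have dt (y t : R) : 0 < t -> is_derive t 1 (psi y) (psit y t).
    move=> t0; have d1 := dGt y t t0.
    by have := is_deriveD (is_derive_cst q t 1) d1; rewrite add0r.
  have dx (y t : R) : 0 < t -> is_derive y 1 (psi^~ t) (psix y t).
    move=> t0; have d1 := dGx y t t0.
    by have := is_deriveD (is_derive_cst q y 1) d1; rewrite add0r.
  have dxx (y t : R) : 0 < t -> is_derive y 1 (psix^~ t) (psixx y t).
    move=> t0; have := is_deriveM (dGx y t t0) (dlx y t t0).
    by move/is_derive_eq; apply; rewrite /psixx /psix /GRing.scale /=; ring.
  have Hpsi (y t : R) : 0 < t <= T -> psixx y t + flow_curv K L T * psix y t ^+ 2 <= psit y t.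
    move=> /andP[t0 tT]; have /andP[G0 GB] := Gb y t (ltW t0).
    rewrite -/C1 /psixx /psix /psit.
    have -> : G y t * (lx y t ^+ 2 - (2 * kappa)^-1 * (s0 + t)^-1) + C1 * (G y t * lx y t) ^+ 2 =
      G y t * ((1 + C1 * G y t) * lx y t ^+ 2 - (2 * kappa)^-1 * (s0 + t)^-1) by ring.
    apply: ler_wpM2l => //.
    have -> : lt y t = kappa * lx y t ^+ 2 - (2 * kappa)^-1 * (s0 + t)^-1.
      by have st := sp t (ltW t0); rewrite /lt /lx; field; rewrite !gt_eqF.
    rewrite lerB//; apply: ler_wpM2r; first exact: sqr_ge0.
    by rewrite kE lerD2l; exact: ler_wpM2l.
  exact: (flow_cmp_line sf zs zM cpsi psib dt dx dxx Hpsi zi x TT).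
apply: (le_trans H); apply: PT.
by have := Gb x T (ltW T0); rewrite /psi; lra.
Qed.

Lemma gauss_decay (R : realType) (K L rho M T q eps eta X : R) (g gz z : R -> R -> R) :
  smooth_field K L rho g gz -> 0 < T -> (forall t a : R, 0 <= t -> g (t + T) a = g t a) ->
  psol g z -> (forall x t, 0 <= t -> z x t <= M) ->
  q < 0 -> 0 < eta -> - flow_rad K rho T < q -> 2 * eta < flow_rad K rho T -> 2 * eta < eps ->
  (forall a, q <= a < eps -> flow g T a <= a) ->
  (forall x, z x 0 <= eta) -> (forall x, X <= `|x| -> z x 0 <= q) ->
  forall e, 0 < e -> exists N : nat, forall n : nat, (N <= n)%N -> forall x, z x (n%:R * T) <= q + e.
Proof.
move=> sf T0 gT zs zM q0 eta0 qr er ee PT zeta zq e e0.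
have K0 := sf_K sf; have L0 := sf_L sf.
pose B := 2 * eta - q.
have B0 : 0 < B by rewrite /B; lra.
set C1 := flow_curv K L T.
have C10 : 0 <= C1.
  rewrite /C1 /flow_curv mulr_ge0 ?expR_ge0// mulr_ge0// mulr_ge0 ?expR_ge0//.
  by rewrite mulr_ge0//; lra.
pose kappa := 1 + C1 * B.
have k1 : 1 <= kappa by rewrite /kappa lerDl mulr_ge0// ltW.
have k0 : 0 < kappa by lra.
pose W := X ^+ 2 * B / (4 * kappa * eta) + 1.
have ke0 : 0 < 4 * kappa * eta by rewrite !mulr_gt0.
have W0 : 0 < W by rewrite ltr_wpDl// divr_ge0 ?(ltW ke0)// mulr_ge0 ?sqr_ge0// ltW.
have G0 s x t : 0 <= gauss kappa W B s x t by rewrite /gauss mulr_ge0 ?expR_ge0// ltW.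
have step n : forall x, z x (n%:R * T) <= q + gauss kappa W B (W + n%:R * T) x 0.
  elim: n => [|n IH] x.
    rewrite mul0r addr0; have [xX|Xx] := lerP X `|x|.
      by rewrite (le_trans (zq x xX))// lerDl.
    apply: (le_trans (zeta x)); rewrite /gauss addr0 subrr mulr0 sub0r.
    have := expR_ge1Dx (- (x ^+ 2 / (4 * kappa) / W)).
    have : B * (1 - eta / B) <= B * expR (- (x ^+ 2 / (4 * kappa) / W)); last first.
      have -> : B * (1 - eta / B) = B - eta by field; rewrite gt_eqF.
      by rewrite /B; lra.
    apply: ler_wpM2l; first exact: ltW.
    apply: le_trans (expR_ge1Dx _).
    rewrite lerD2l lerN2 ler_pdivlMr// mulrAC ler_pdivrMr// mulrAC ler_pdivrMr; last by rewrite mulr_gt0.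
    have xX2 : x ^+ 2 <= X ^+ 2.
      rewrite -real_normK ?num_real// -[leRHS]real_normK ?num_real//.
      by rewrite lerXn2r ?nnegrE// (le_trans (ltW Xx))// ler_norm.
    have -> : eta * W * (4 * kappa) = X ^+ 2 * B + 4 * kappa * eta.
      by rewrite /W; field; rewrite !gt_eqF.
    by have := ler_wpM2r (ltW B0) xX2; lra.
  have nT : 0 <= n%:R * T by rewrite mulr_ge0// ltW.
  have := @gauss_step R K L rho M T W (W + n%:R * T) kappa B q eps g gz
    (fun x t => z x (t + n%:R * T)) sf T0 (psol_shiftn n (ltW T0) gT zs).
  move=> /(_ _ W0 _ (ltW B0) erefl qr _ _ PT _ x).
  have -> : T + n%:R * T = n.+1%:R * T by rewrite -natr1; ring.
  have -> : gauss kappa W B (W + n%:R * T) x T = gauss kappa W B (W + n.+1%:R * T) x 0.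
    by rewrite /gauss addr0 (_ : W + n%:R * T + T = W + n.+1%:R * T)// -natr1; ring.
  apply.
  - by move=> y t t0; apply: zM; rewrite addr_ge0.
  - by rewrite lerDl.
  - by rewrite /B; lra.
  - by rewrite /B; lra.
  - by move=> y; rewrite add0r; exact: IH.
have [Y Y0 HY] := @expR_small R B e e0.
pose Z := expR (Y * (2 * kappa) + ln W).
have [N HN] : exists N : nat, Z / T < N%:R by exists (Num.bound (Z / T)); rewrite archi_boundP// divr_ge0 ?expR_ge0// ltW.
exists N => n Nn x; apply: (le_trans (step n x)); rewrite lerD2l ltW//.
have st : 0 < W + n%:R * T by rewrite ltr_pwDl// mulr_ge0// ltW.
apply: le_lt_trans (HY (- (- (2 * kappa)^-1 * (ln (W + n%:R * T) - ln W))) _).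
  rewrite /gauss addr0 opprK; apply: ler_wpM2l; first exact: ltW.
  by rewrite ler_expR gerBl mulr_ge0 ?invr_ge0 ?(ltW st)// divr_ge0 ?sqr_ge0// mulr_ge0// ltW.
rewrite mulNr opprK mulrC ler_pdivlMr; last by rewrite mulr_gt0.
rewrite lerBrDr -ler_expR lnK ?posrE// -/Z.
have : Z <= n%:R * T.
  rewrite -ler_pdivrMr//; apply: (le_trans (ltW HN)).
  by rewrite ler_nat.
by lra.
Qed.


(** * Monotonicity and decay outside the support *)

Definition Int (R : realType) (a b : R) (h : R -> R) : R :=
  (\int[@lebesgue_measure R]_(x in `[a, b]) h x)%R.

Lemma Int_FTC (R : realType) (a b : R) (h H : R -> R) :
  a < b -> continuous h -> (forall x, a <= x <= b -> is_derive x 1 H (h x)) ->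
  (\int[@lebesgue_measure R]_(x in `[a, b]) (h x)%:E = (H b - H a)%:E)%E.
Proof.
move=> ab ch dH.
have cH x : a <= x <= b -> {for x, continuous H} by move=> /dH /is_derive1_cont.
rewrite (@continuous_FTC2 R h H a b ab).
- by rewrite EFinB.
- exact: continuous_subspaceT.
- split.
  + by move=> x; rewrite in_itv/= => /andP[h1 h2]; have [] := dH x ltac:(by rewrite !ltW).
  + by apply: cvg_at_right_filter; apply: cH; rewrite lexx ltW.
  + by apply: cvg_at_left_filter; apply: cH; rewrite lexx ltW.
- move=> x; rewrite in_itv/= => /andP[h1 h2]; rewrite derive1E.
  by have [_] := dH x ltac:(by rewrite !ltW).
Qed.

Lemma IntE (R : realType) (a b : R) (h H : R -> R) :
  a < b -> continuous h -> (forall x, a <= x <= b -> is_derive x 1 H (h x)) ->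
  Int a b h = H b - H a.
Proof. by move=> ab ch dH; rewrite /Int /Rintegral (Int_FTC ab ch dH). Qed.

Lemma is_derive_ndecr (R : realType) (D d : R -> R) (a b : R) :
  (forall x, a <= x <= b -> is_derive x 1 D (d x)) ->
  (forall x, a <= x <= b -> 0 <= d x) ->
  a <= b -> D a <= D b.
Proof.
move=> dD d0 ab.
have cD : {within `[a, b], continuous D}.
  apply: derivable_within_continuous => x; rewrite in_itv/= => hx.
  by have [] := dD x hx.
have [|c hc E] := @MVT_segment R D d a b ab _ cD.
  by move=> x; rewrite in_itv/= => /andP[h1 h2]; apply: dD; rewrite !ltW.
rewrite -subr_ge0 E mulr_ge0 ?subr_ge0// d0//.
Qed.

Lemma Int_le_anti (R : realType) (a b : R) (h g G : R -> R) :
  a < b -> continuous h -> (forall x, a <= x <= b -> is_derive x 1 G (g x)) ->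
  (forall x, a <= x <= b -> h x <= g x) -> Int a b h <= G b - G a.
Proof.
move=> ab ch dG hg; have [H [H0 dH]] := antiderivative a ch.
have dH' x : a <= x <= b -> is_derive x 1 H (h x) by move=> /andP[h1 _]; exact: dH.
rewrite (IntE ab ch dH').
have : G a - H a <= G b - H b.
  apply: (@is_derive_ndecr R (fun x => G x - H x) (fun x => g x - h x)); last exact: ltW.
    by move=> x hx; have d1 := dH' x hx; have d2 := dG x hx; exact: is_derive_eq.
  by move=> x hx; rewrite subr_ge0; exact: hg.
by lra.
Qed.

Lemma Int_ge_sub (R : realType) (a b x1 x2 c : R) (h : R -> R) :
  a < b -> continuous h -> a <= x1 -> x1 <= x2 -> x2 <= b ->
  (forall x, a <= x <= b -> 0 <= h x) -> (forall x, x1 <= x <= x2 -> c <= h x) ->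
  c * (x2 - x1) <= Int a b h.
Proof.
move=> ab ch h1 h12 h2 h0 hc; have [H [H0 dH]] := antiderivative a ch.
have dH' x : a <= x <= b -> is_derive x 1 H (h x) by move=> /andP[? _]; exact: dH.
rewrite (IntE ab ch dH').
have m1 : H a <= H x1.
  apply: (@is_derive_ndecr R H h) => // x hx; [apply: dH'|apply: h0]; lra.
have m2 : H x2 <= H b.
  apply: (@is_derive_ndecr R H h) => // x hx; [apply: dH'|apply: h0]; lra.
have : H x1 - c * x1 <= H x2 - c * x2.
  apply: (@is_derive_ndecr R (fun x => H x - c * x) (fun x => h x - c)) => //.
    move=> x hx; have d1 := dH' x ltac:(lra).
    by apply: is_derive_eq; rewrite /GRing.scale /= mulr1.
  by move=> x hx; rewrite subr_ge0; exact: hc.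
lra.
Qed.

Lemma cont2_slice (R : realType) (w : R -> R -> R) (t : R) :
  (forall x, cont2 w x t) -> continuous (w^~ t).
Proof.
move=> cw x; apply/cont_epsP => e e0; have [d d0 Hd] := proj1 (cont2P _ _ _) (cw x) e e0.
by exists d => // s hs; apply: Hd => //; rewrite subrr normr0.
Qed.

Lemma Int_deriv (R : realType) (a b t : R) (w wt : R -> R -> R) :
  0 < t -> (forall x s : R, 0 < s -> is_derive s 1 (w x) (wt x s)) ->
  (forall x s : R, 0 < s -> cont2 w x s) -> (forall x s : R, 0 < s -> cont2 wt x s) ->
  is_derive t 1 (fun s => Int a b (w^~ s)) (Int a b (wt^~ t)).
Proof.
move=> t0 dw cw cwt.
pose f (s x : R) := w x s.
have [ab|ba] := lerP a b; last first.
  have e0 h : Int a b h = 0.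
    by rewrite /Int set_itv_ge ?Rintegral_set0// bnd_simp -ltNge.
  have -> : (fun s => Int a b (w^~ s)) = fun=> 0 by apply/funext => s; rewrite e0.
  by rewrite e0; exact: is_derive_cst.
have h1 : t / 2 <= t * 2 by lra.
pose A := `[a, b] `*` `[t / 2, t * 2].
have A0 : A !=set0 by exists (a, t); split => /=; rewrite in_itv/= ?lexx//; lra.
have cA : compact A by apply: compact_setX; exact: segment_compact.
have cW : {within A, continuous (fun q : R * R => `|wt q.1 q.2|)}.
  apply: continuous_in_subspaceT => -[y s] /set_mem [/=]; rewrite !in_itv/= => hy hs.
  by apply: cvg_norm; apply: cwt; lra.
have [[y0 s0] _ Hmax] := compact_EVT_max A0 cA cW.
pose G := `|wt y0 s0|.
have mB : measurable (`[a, b] : set (measurableTypeR R)) by exact: measurable_itv.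
have It : `]t / 2, t * 2[%classic t by rewrite /= in_itv/=; lra.
have intf s : `]t / 2, t * 2[%classic s -> (@lebesgue_measure R).-integrable `[a, b] (EFin \o f s).
  rewrite /= in_itv/= => hs; apply: continuous_compact_integrable; first exact: segment_compact.
  by apply: continuous_subspaceT; apply: cont2_slice => x; apply: cw; lra.
have derf (s x : R) : `]t / 2, t * 2[%classic s -> `[a, b]%classic x -> derivable (f^~ x) s 1.
  by rewrite /= !in_itv/= => hs _; have [] := dw x s ltac:(lra).
have intG : (@lebesgue_measure R).-integrable `[a, b] (EFin \o (fun=> G)).
  apply: continuous_compact_integrable; first exact: segment_compact.
  by apply: continuous_subspaceT => x; exact: cvg_cst.
have G_ub (s x : R) : `]t / 2, t * 2[%classic s -> `[a, b]%classic x -> `|partial1of2 f s x| <= G.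
  rewrite /= !in_itv/= => hs hx; rewrite partial1of2E.
  have [_ ->] := dw x s ltac:(lra).
  by apply: (Hmax (x, s)); apply/mem_set; split => /=; rewrite in_itv//=; lra.
have df := @derivable_under_integral R _ _ (@lebesgue_measure R) f _ mB t _ _ It intf derf (fun=> G) (fun=> normr_ge0 _) intG G_ub.
have dE := @differentiation_under_integral R _ _ (@lebesgue_measure R) f _ mB t _ _ It intf derf (fun=> G) (fun=> normr_ge0 _) intG G_ub.
apply: DeriveDef; first exact: df.
rewrite -derive1E dE /Int; apply: eq_Rintegral => x _.
by rewrite partial1of2E; have [_] := dw x t t0.
Qed.

(* Testing [Ut <= Uxx + K U] against a weight vanishing at both ends, then Gronwall. *)
Lemma weighted_mass (R : realType) (U Ut Ux Uxx : R -> R -> R) (rho rho1 rho2 : R -> R)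
    (a b K C0 M k1 k2 : R) :
  a < b -> 0 <= K -> 0 <= C0 -> 0 <= k1 -> 0 <= k2 ->
  (forall x t : R, 0 < t -> [/\ is_derive t 1 (U x) (Ut x t),
     is_derive x 1 (U^~ t) (Ux x t) & is_derive x 1 (Ux^~ t) (Uxx x t)]) ->
  (forall x t : R, 0 < t -> [/\ cont2 U x t, cont2 Ux x t, cont2 Uxx x t & cont2 Ut x t]) ->
  (forall x : R, is_derive x 1 rho (rho1 x) /\ is_derive x 1 rho1 (rho2 x)) ->
  (forall x, a <= x <= b -> 0 <= rho x /\ rho2 x <= C0 * rho x + k1) ->
  rho a = 0 -> rho b = 0 ->
  (forall x t : R, a <= x <= b -> 0 < t -> Ut x t <= Uxx x t + K * U x t) ->
  (forall x t : R, a <= x <= b -> 0 < t -> 0 <= U x t <= M) ->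
  (forall t : R, 0 < t -> U a t * rho1 a - U b t * rho1 b <= k2) ->
  (forall e : R, 0 < e -> exists2 d, 0 < d &
      forall t, 0 < t < d -> Int a b (fun x => U x t * rho x) <= e) ->
  forall t, 0 < t ->
    Int a b (fun x => U x t * rho x) <= expR ((K + C0) * t) * ((k1 * M * (b - a) + k2) * t).
Proof.
move=> ab K0 C00 k10 k20 dU cU drho hrho ra rb HU HM Hflux Hini t t0.
pose w x t := U x t * rho x.
pose wt x t := Ut x t * rho x.
pose y t := Int a b (w^~ t).
set l := K + C0; set k := k1 * M * (b - a) + k2.
have crho : continuous rho by move=> x; apply: is_derive1_cont (drho x).1.
have M0 : 0 <= M.
  by have /andP[h1 h2] := HM a t ltac:(by rewrite lexx ltW) t0; exact: le_trans h2.
have k0 : 0 <= k by rewrite addr_ge0// mulr_ge0 ?mulr_ge0// subr_ge0 ltW.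
have l0 : 0 <= l by rewrite addr_ge0.
have crho2 x s : cont2 (fun x _ : R => rho x) x s.
  by apply: cont2_comp; [exact: cont2_fst|exact: crho].
have cw x s : 0 < s -> cont2 w x s.
  by move=> s0; have [h _ _ _] := cU x s s0; exact: cont2M.
have cwt x s : 0 < s -> cont2 wt x s.
  by move=> s0; have [_ _ _ h] := cU x s s0; exact: cont2M.
have dw (x s : R) : 0 < s -> is_derive s 1 (w x) (wt x s).
  move=> s0; have [d1 _ _] := dU x s s0.
  by rewrite /w /wt; apply: is_derive_eq; rewrite /GRing.scale /=; ring.
have dy (s : R) : 0 < s -> is_derive s 1 y (Int a b (wt^~ s)).
  by move=> s0; exact: Int_deriv.
have y0 (s : R) : 0 < s -> 0 <= y s.
  move=> s0; have := @Int_ge_sub R a b a a 0 (w^~ s) ab (cont2_slice (fun x => cw x s s0)).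
  rewrite subrr mulr0; apply => //; first exact: ltW.
    by move=> x hx; apply: mulr_ge0; [case/andP: (HM x s hx s0)|case: (hrho x hx)].
  move=> x hx; have hx' : a <= x <= b by lra.
  by apply: mulr_ge0; [case/andP: (HM x s hx' s0)|case: (hrho x hx')].
have yt (s : R) : 0 < s -> Int a b (wt^~ s) <= l * y s + k.
  move=> s0; have cws := cont2_slice (fun x => cw x s s0).
  have [Y [Y0 dY]] := antiderivative a cws.
  have dY' x : a <= x <= b -> is_derive x 1 Y (w x s) by move=> /andP[? _]; exact: dY.
  have yE : y s = Y b - Y a by exact: IntE.
  pose G x := Ux x s * rho x - U x s * rho1 x + l * Y x + k1 * M * x.
  pose g x := Uxx x s * rho x - U x s * rho2 x + l * w x s + k1 * M.
  have := @Int_le_anti R a b (wt^~ s) g G ab (cont2_slice (fun x => cwt x s s0)).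
  have -> : G b - G a = (U a s * rho1 a - U b s * rho1 b) + l * y s + k1 * M * (b - a).
    by rewrite /G ra rb yE; ring.
  move=> H; apply: (@le_trans _ _ (U a s * rho1 a - U b s * rho1 b + l * y s + k1 * M * (b - a))); last first.
    by have := Hflux s s0; rewrite /k; lra.
  apply: H => x hx.
    have [_ d1 d2] := dU x s s0; have [d3 d4] := drho x; have d5 := dY' x hx.
    by rewrite /G /g; apply: is_derive_eq; rewrite /GRing.scale /=; ring.
  have [r0 r2] := hrho x hx; have /andP[u0 uM] := HM x s hx s0.
  have p1 := ler_wpM2r r0 (HU x s hx s0).
  have p2 := ler_wpM2l u0 r2.
  have p3 := ler_wpM2r k10 uM.
  by rewrite /wt /g /w /l; lra.
apply/ler_addgt0Pl => e e0.
pose el := expR (l * t).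
have el0 : 0 < el by exact: expR_gt0.
have [d d0 Hd] := Hini (e / el) ltac:(by rewrite divr_gt0).
pose s := Num.min d t / 2.
have m0 : 0 < Num.min d t by rewrite lt_min d0.
have m1 : Num.min d t <= d by rewrite ge_min lexx.
have m2 : Num.min d t <= t by rewrite ge_min lexx orbT.
have s0 : 0 < s by rewrite /s; lra.
have sd : s < d by rewrite /s; lra.
have st : s < t by rewrite /s; lra.
have ys : y s <= e / el by apply: Hd; rewrite s0.
have tt : s <= t <= t by rewrite lexx ltW.
have := @max_principle1 R (fun r => y r - expR (l * (r - s)) * (y s + k * (r - s))) s t l _ _ _ t tt.
move=> H; have {H} : y t - expR (l * (t - s)) * (y s + k * (t - s)) <= 0.
  have dEr (r : R) : is_derive r 1 (fun r => expR (l * (r - s)) * (y s + k * (r - s)))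
      (l * expR (l * (r - s)) * (y s + k * (r - s)) + expR (l * (r - s)) * k).
    by apply: is_derive_eq; rewrite /GRing.scale /=; ring.
  apply: H.
  - apply: derivable_within_continuous => r; rewrite in_itv/= => hr.
    have d1 := dy r ltac:(lra); have d2 := dEr r.
    by have [] : is_derive r 1 (fun r => y r - expR (l * (r - s)) * (y s + k * (r - s))) (Int a b (wt^~ r) - (l * expR (l * (r - s)) * (y s + k * (r - s)) + expR (l * (r - s)) * k)) by exact: is_derive_eq.
  - by rewrite subrr !mulr0 expR0; lra.
  - move=> r hr _; have r0 : 0 < r by lra.
    have d1 := dy r r0; have d2 := dEr r.
    exists (Int a b (wt^~ r) - (l * expR (l * (r - s)) * (y s + k * (r - s)) + expR (l * (r - s)) * k)).
    split; first exact: is_derive_eq.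
    have e1 : 1 <= expR (l * (r - s)) by rewrite -[leLHS]expR0 ler_expR mulr_ge0//; lra.
    have := ler_wpM2r k0 e1; have := yt r r0; lra.
have e1 : expR (l * (t - s)) <= el by rewrite ler_expR ler_wpM2l//; lra.
have e2 : y s + k * (t - s) <= e / el + k * t.
  by apply: lerD => //; apply: ler_wpM2l => //; lra.
have e3 : 0 <= y s + k * (t - s) by rewrite addr_ge0 ?y0// mulr_ge0//; lra.
have := ler_pM (expR_ge0 _) e3 e1 e2.
have -> : el * (e / el + k * t) = e + el * (k * t) by field; rewrite gt_eqF.
by rewrite -/(y t) -/el; lra.
Qed.


Lemma is_derive_pospow (R : realType) (n : nat) (x : R) :
  is_derive x 1 (fun x : R => Num.max 0 x ^+ n.+2) (n.+2%:R * Num.max 0 x ^+ n.+1).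
Proof.
have [x0|x0|->] := ltgtP x 0.
- rewrite expr0n mulr0.
  apply: (is_derive_near _ _ (is_derive_cst (0 : R) x 1) (d := - x)); first by lra.
  by move=> y; rewrite ltr_norml => hy; rewrite max_l ?expr0n//; lra.
- have dd : is_derive x 1 (fun x : R => x ^+ n.+2) (n.+2%:R * x ^+ n.+1).
    by apply: DeriveDef; [exact: exprn_derivable|rewrite exp_derive /GRing.scale /= mulr1].
  apply: (is_derive_near _ _ dd (d := x)) => //.
  by move=> y; rewrite ltr_norml => hy; rewrite max_r//; lra.
rewrite ?maxxx expr0n mulr0; apply/is_derive_epsP => e e0.
exists (Num.min 1 e); first by rewrite lt_min ltr01.
move=> h; rewrite lt_min => /andP[h1 h2]; rewrite add0r mul0r subr0 maxxx expr0n subr0.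
have hm : `|Num.max 0 h| <= `|h|.
  by have := max0_dist h 0; rewrite maxxx !subr0.
rewrite normrX exprS exprS.
have m0 := normr_ge0 (Num.max 0 h).
have p1 : `|Num.max 0 h| ^+ n <= 1 by rewrite exprn_ile1// (le_trans hm)// ltW.
have p2 : `|Num.max 0 h| * `|Num.max 0 h| ^+ n <= e * 1.
  apply: ler_pM; [exact: m0|exact: exprn_ge0| |exact: p1].
  by rewrite (le_trans hm)// ltW.
rewrite mulrC; apply: ler_pM; [|exact: m0| |exact: hm].
  by apply: mulr_ge0; [exact: m0|exact: exprn_ge0].
by rewrite mulr1 in p2.
Qed.

Record pos_sol (R : realType) (K M r : R) (F v vx vxx vt : R -> R -> R) : Prop := PosSol {
  ps_K : 0 < K ;
  ps_F : forall t a b : R, 0 < t -> 0 <= a <= M -> 0 <= b <= M -> `|F t a - F t b| <= K * `|a - b| ;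
  ps_F0 : forall t : R, 0 < t -> F t 0 = 0 ;
  ps_dx : forall x t : R, 0 < t -> is_derive x 1 (v^~ t) (vx x t) ;
  ps_dxx : forall x t : R, 0 < t -> is_derive x 1 (vx^~ t) (vxx x t) ;
  ps_dt : forall x t : R, 0 < t -> is_derive t 1 (v x) (vt x t) ;
  ps_eq : forall x t : R, 0 < t -> vt x t = vxx x t + F t (v x t) ;
  ps_cont : forall x t : R, 0 < t -> [/\ cont2 v x t, cont2 vx x t, cont2 vxx x t & cont2 vt x t] ;
  ps_bd : forall x t : R, 0 < t -> 0 <= v x t <= M ;
  ps_ini : forall a b : R, r < a -> a < b -> forall e : R, 0 < e ->
     exists2 d, 0 < d & forall t, 0 < t < d -> Int a b (v^~ t) <= e }.

Lemma cont2_refl (R : realType) (w : R -> R -> R) (c x t : R) :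
  cont2 w (c - x) t -> cont2 (fun x t => w (c - x) t) x t.
Proof.
move=> /cont2P cw; apply/cont2P => e e0; have [d d0 Hd] := cw e e0.
exists d => // x' t' hx ht; apply: Hd => //.
by rewrite (_ : c - x' - (c - x) = - (x' - x)) ?normrN//; ring.
Qed.

Lemma is_derive_refl (R : realType) (h : R -> R) (c x l : R) :
  is_derive (c - x) 1 h l -> is_derive x 1 (fun x => h (c - x)) (- l).
Proof.
move=> dh; have d1 : is_derive x 1 (fun x : R => c - x) (- 1).
  by have := is_deriveB (is_derive_cst c x 1) (is_derive_id x 1); rewrite sub0r.
by have := @is_derive1_comp R h (fun x => c - x) x l (- 1) dh d1; rewrite mulrN1.
Qed.

Lemma poly_exp_small (R : realType) (c e : R) : 0 < e -> 0 <= c -> exists2 Y, 0 < Y &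
  forall y, Y <= y -> c * (y ^+ 2 * expR (- (y / 2))) < e.
Proof.
move=> e0 c0; have [Y Y0 HY] := @expR_small R (c * 64) e e0.
exists (Y * 4); first by rewrite mulr_gt0.
move=> y hy; apply: le_lt_trans (HY (y / 4) _); last by lra.
rewrite -mulrA; apply: ler_wpM2l => //.
have -> : expR (- (y / 2)) = expR (- (y / 8)) ^+ 2 * expR (- (y / 4)).
  by rewrite -expRM_natl -expRD; congr expR; field.
rewrite mulrA -exprMn; apply: ler_wpM2r; first exact: expR_ge0.
have h8 : y * expR (- (y / 8)) <= 8.
  rewrite expRN ler_pdivrMr ?expR_gt0//.
  by have := expR_ge1Dx (y / 8); lra.
have -> : 64 = 8 ^+ 2 :> R by ring.
rewrite lerXn2r ?nnegrE ?mulr_ge0 ?expR_ge0//; lra.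
Qed.

Lemma reflection_le (R : realType) (K M r : R) (F v vx vxx vt : R -> R -> R) :
  pos_sol K M r F v vx vxx vt ->
  forall x0 x t : R, r < x0 -> x < x0 -> 0 < t -> v (2 * x0 - x) t <= v x t.
Proof.
move=> ps x0 x t rx0 xx0 t0.
have K0 := ps_K ps.
have M0 : 0 <= M by have /andP[h1 h2] := ps_bd ps x t0; exact: le_trans h2.
pose w (x t : R) : R := v (2 * x0 - x) t - v x t.
pose m (x t : R) : R := Num.max 0 (w x t).
rewrite leNgt; apply/negP => wpos.
have wxt : 0 < w x t by rewrite /w subr_gt0.
pose wx (x t : R) : R := - vx (2 * x0 - x) t - vx x t.
pose wxx (x t : R) : R := vxx (2 * x0 - x) t - vxx x t.
pose wt (x t : R) : R := vt (2 * x0 - x) t - vt x t.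
have dw (y s : R) : 0 < s -> [/\ is_derive s 1 (w y) (wt y s),
   is_derive y 1 (w^~ s) (wx y s) & is_derive y 1 (wx^~ s) (wxx y s)].
  move=> s0; split.
  - by have d1 := ps_dt ps (2 * x0 - y) s0; have d2 := ps_dt ps y s0; exact: is_derive_eq.
  - have d1 := is_derive_refl (ps_dx ps (2 * x0 - y) s0); have d2 := ps_dx ps y s0.
    exact: is_derive_eq.
  - have d1 := is_derive_refl (ps_dxx ps (2 * x0 - y) s0); have d2 := ps_dxx ps y s0.
    by rewrite /wxx -[X in X - _]opprK; exact: is_derive_eq.
have cm0 : continuous (fun x : R => Num.max 0 x).
  by apply: (@continuous_max0 R id) => s _; exact: cvg_id.
have cws (y s : R) : 0 < s -> [/\ cont2 w y s, cont2 wx y s, cont2 wxx y s & cont2 wt y s].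
  move=> s0; have [a1 a2 a3 a4] := ps_cont ps (2 * x0 - y) s0.
  have [b1 b2 b3 b4] := ps_cont ps y s0.
  split; apply: cont2B => //; try by exact: cont2_refl.
  apply: (@cont2_comp R (fun u => - u) (fun x t => vx (2 * x0 - x) t)); first exact: cont2_refl.
  by apply: cvgN; exact: cvg_id.
pose U (x t : R) := m x t ^+ 3.
pose Ut (x t : R) := 3 * m x t ^+ 2 * wt x t.
pose Ux (x t : R) := 3 * m x t ^+ 2 * wx x t.
pose Uxx (x t : R) := 6 * m x t * wx x t ^+ 2 + 3 * m x t ^+ 2 * wxx x t.
have dU (y s : R) : 0 < s -> [/\ is_derive s 1 (U y) (Ut y s),
     is_derive y 1 (U^~ s) (Ux y s) & is_derive y 1 (Ux^~ s) (Uxx y s)].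
  move=> s0; have [d1 d2 d3] := dw y s s0; split.
  - have := @is_derive1_comp R (fun u : R => Num.max 0 u ^+ 3) (w y) s _ _ (is_derive_pospow 1 _) d1.
    exact.
  - have := @is_derive1_comp R (fun u : R => Num.max 0 u ^+ 3) (w^~ s) y _ _ (is_derive_pospow 1 _) d2.
    exact.
  - have d4 := @is_derive1_comp R (fun u : R => Num.max 0 u ^+ 2) (w^~ s) y _ _ (is_derive_pospow 0 _) d2.
    have := is_deriveM (is_deriveM (is_derive_cst (3:R) y 1) d4) d3.
    move/is_derive_eq; apply; rewrite /Uxx /m !fctE /GRing.scale /= expr1; ring.
have cU (y s : R) : 0 < s -> [/\ cont2 U y s, cont2 Ux y s, cont2 Uxx y s & cont2 Ut y s].
  move=> s0; have [c1 c2 c3 c4] := cws y s s0.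
  have cm : cont2 m y s by apply: (@cont2_comp R (fun x : R => Num.max 0 x)) => //; exact: cm0.
  have cm2 : cont2 (fun x t => 3 * m x t ^+ 2) y s.
    by apply: cont2M; [exact: cont2_cst|apply: (cont2M cm cm)].
  split.
  - by apply: (cont2M cm (cont2M cm cm)).
  - exact: cont2M.
  - apply: cont2D; last exact: cont2M.
    by apply: cont2M; [apply: cont2M cm; exact: cont2_cst|exact: cont2M].
  - exact: cont2M.
have mM (y s : R) : 0 < s -> 0 <= m y s <= M.
  move=> s0; rewrite /m le_max lexx /= ge_max M0 /= /w.
  by have := ps_bd ps (2 * x0 - y) s0; have := ps_bd ps y s0; lra.
have mv (y s : R) : 0 < s -> m y s <= v (2 * x0 - y) s.
  move=> s0; rewrite /m ge_max /w.
  by have := ps_bd ps (2 * x0 - y) s0; have := ps_bd ps y s0; lra.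
have HU (y s : R) : 0 < s -> Ut y s <= Uxx y s + 3 * K * U y s.
  move=> s0; rewrite /Ut /Uxx /U.
  have m0 : 0 <= m y s by case/andP: (mM y s s0).
  have q1 : 0 <= 6 * m y s * wx y s ^+ 2 by rewrite mulr_ge0 ?sqr_ge0// mulr_ge0.
  have q2 : 3 * m y s ^+ 2 * (wt y s - wxx y s) <= 3 * K * m y s ^+ 3.
    have [w0|w0] := lerP (w y s) 0.
      by rewrite /m max_l// !expr0n /= !mulr0 mul0r.
    have mw : m y s = w y s by rewrite /m max_r// ltW.
    have -> : 3 * K * m y s ^+ 3 = 3 * m y s ^+ 2 * (K * w y s) by rewrite mw; ring.
    apply: ler_wpM2l; first by rewrite mulr_ge0// sqr_ge0.
    have -> : wt y s - wxx y s = F s (v (2 * x0 - y) s) - F s (v y s).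
      by rewrite /wt /wxx !(ps_eq ps)//; ring.
    rewrite (le_trans (ler_norm _))// (le_trans (ps_F ps s0 (ps_bd ps _ s0) (ps_bd ps _ s0)))//.
    by rewrite -/(w y s) gtr0_norm.
  by rewrite mulrBr in q2; lra.
have [d d0 Hd] : exists2 d, 0 < d & forall y, `|y - x| <= d -> w x t / 2 <= w y t.
  have [c1 _ _ _] := cws x t t0.
  have [d d0 Hd] := proj1 (cont2P _ _ _) c1 (w x t / 2) ltac:(lra).
  exists (d / 2); first by lra.
  move=> y hy; have := Hd y t; rewrite subrr normr0 => /(_ _ d0).
  by move=> /(_ ltac:(lra)); rewrite ltr_norml; lra.
pose h := Num.min d ((x0 - x) / 2).
have h0 : 0 < h by rewrite /h lt_min d0; lra.
have hd : h <= d by rewrite /h ge_min lexx.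
have hx : h <= (x0 - x) / 2 by rewrite /h ge_min lexx orbT.
pose c := (w x t / 2) ^+ 3 * ((x0 - x) / 2 * expR (x - x0 - h)).
have c0 : 0 < c.
  apply: mulr_gt0; first by apply: exprn_gt0; lra.
  by apply: mulr_gt0; [lra|exact: expR_gt0].
pose E := expR ((3 * K + 1) * t).
have E0 : 0 < E by exact: expR_gt0.
have C0 : 0 <= E * (3 * M ^+ 3 * t).
  by apply: mulr_ge0; [exact: ltW|rewrite mulr_ge0 ?(ltW t0)// mulr_ge0// exprn_ge0].
have [Y Y0 HY] := @poly_exp_small R (E * (3 * M ^+ 3 * t)) (c * h) (mulr_gt0 c0 h0) C0.
pose l := Y + (x0 - x) * 2 + 1.
have l1 : 1 <= l by rewrite /l; lra.
pose a := x0 - l.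
have ab : a < x0 by rewrite /a; lra.
pose rho (y : R) : R := - (y - x0) * (y - x0 + l) * expR (y - x0).
pose rho1 (y : R) : R := (- (y - x0) * (y - x0 + l) - 2 * (y - x0) - l) * expR (y - x0).
pose rho2 (y : R) : R := (- (y - x0) * (y - x0 + l) + 2 * (- 2 * (y - x0) - l) - 2) * expR (y - x0).
have drho (y : R) : is_derive y 1 rho (rho1 y) /\ is_derive y 1 rho1 (rho2 y).
  split; rewrite /rho /rho1 /rho2; apply: is_derive_eq; rewrite /GRing.scale /=; ring.
have rho0 y : a <= y <= x0 -> 0 <= rho y.
  move=> hy; apply: mulr_ge0; last exact: expR_ge0.
  by apply: mulr_ge0; rewrite /a in hy; clear -hy; lra.
pose k1 := 2 * l * expR (- (l / 2)).
have k10 : 0 <= k1 by rewrite /k1 mulr_ge0 ?expR_ge0//; lra.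
have hrho y : a <= y <= x0 -> 0 <= rho y /\ rho2 y <= 1 * rho y + k1.
  move=> hy; split; first exact: rho0.
  have -> : rho2 y = 1 * rho y + (2 * (- 2 * (y - x0) - l) - 2) * expR (y - x0).
    by rewrite /rho /rho2; ring.
  rewrite lerD2l; have ey := expR_ge0 (y - x0).
  have [hl|hl] := lerP (- 2 * (y - x0) - l) 0.
    by apply: le_trans k10; rewrite nmulr_rle0//; lra.
  have e1 : expR (y - x0) <= expR (- (l / 2)) by rewrite ler_expR; lra.
  apply: (@le_trans _ _ (2 * l * expR (y - x0))).
    by apply: ler_wpM2r => //; rewrite /a in hy; lra.
  by apply: ler_wpM2l => //; lra.
have ra : rho a = 0 by rewrite /rho /a (_ : x0 - l - x0 + l = 0) ?mulr0 ?mul0r//; ring.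
have rb : rho x0 = 0 by rewrite /rho subrr oppr0 !mul0r.
pose k2 := M ^+ 3 * l * expR (- l).
have k20 : 0 <= k2 by rewrite /k2 mulr_ge0 ?expR_ge0// mulr_ge0 ?exprn_ge0//; lra.
have UM (y s : R) : a <= y <= x0 -> 0 < s -> 0 <= U y s <= M ^+ 3.
  move=> _ s0; have /andP[m0 m1] := mM y s s0.
  by rewrite /U exprn_ge0//= lerXn2r.
have Hflux (s : R) : 0 < s -> U a s * rho1 a - U x0 s * rho1 x0 <= k2.
  move=> s0; have -> : U x0 s = 0.
    have w0 : w x0 s = 0 by rewrite /w (_ : 2 * x0 - x0 = x0) ?subrr//; ring.
    by rewrite /U /m w0 maxxx expr0n.
  have -> : rho1 a = l * expR (- l) by rewrite /rho1 /a (_ : x0 - l - x0 = - l); ring.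
  rewrite mul0r subr0 /k2 -mulrA; apply: ler_wpM2r; first by rewrite mulr_ge0 ?expR_ge0//; lra.
  by have /andP[] := UM a s ltac:(by rewrite lexx ltW) s0.
have rhol y : a <= y <= x0 -> rho y <= l ^+ 2.
  move=> hy; have e1 : expR (y - x0) <= 1 by rewrite -[leRHS]expR0 ler_expR; lra.
  have q0 : 0 <= - (y - x0) * (y - x0 + l) by apply: mulr_ge0; rewrite /a in hy; clear -hy; lra.
  have q1 : - (y - x0) * (y - x0 + l) <= l * l by apply: ler_pM; rewrite /a in hy; clear -hy; lra.
  by rewrite /rho; have := ler_pM q0 (expR_ge0 _) q1 e1; rewrite mulr1 expr2.
have Hini (e : R) : 0 < e -> exists2 d, 0 < d &
      forall s, 0 < s < d -> Int a x0 (fun y => U y s * rho y) <= e.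
  move=> e0; pose CC := M ^+ 2 * l ^+ 2 + 1.
  have CC0 : 0 < CC by rewrite /CC; have := mulr_ge0 (sqr_ge0 M) (sqr_ge0 l); lra.
  have [d' d'0 Hd'] := @ps_ini _ _ _ _ _ _ _ _ _ ps x0 (2 * x0 - a) rx0 ltac:(lra) (e / CC) ltac:(by rewrite divr_gt0).
  exists d' => // s hs; have /andP[s0 _] := hs.
  have cvs : continuous (v^~ s) by apply: cont2_slice => y; have [] := ps_cont ps y s0.
  have [N [N0 dN]] := antiderivative x0 cvs.
  have dN' y : x0 <= y <= 2 * x0 - a -> is_derive y 1 N (v y s) by move=> /andP[? _]; exact: dN.
  have NE : Int x0 (2 * x0 - a) (v^~ s) = N (2 * x0 - a) - N x0 by apply: IntE => //; clear -ab; lra.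
  have cUr : continuous (fun y => U y s * rho y).
    move=> y; apply: cvgM; last exact: is_derive1_cont (drho y).1.
    by apply: (@cont2_slice R U s) => y'; have [] := cU y' s s0.
  have := @Int_le_anti R a x0 (fun y => U y s * rho y) (fun y => CC * v (2 * x0 - y) s) (fun y => - CC * N (2 * x0 - y)) ab cUr.
  move=> H; apply: (@le_trans _ _ (- CC * N (2 * x0 - x0) - - CC * N (2 * x0 - a))).
    apply: H => y hy.
      have d1 := is_derive_refl (dN (2 * x0 - y) ltac:(clear -hy; lra)).
      have := is_deriveM (is_derive_cst (- CC) y 1) d1.
      by move/is_derive_eq; apply; rewrite /GRing.scale /=; ring.
    have /andP[m0 m1] := mM y s s0; have v0 := mv y s s0.
    have -> : U y s * rho y = m y s ^+ 2 * rho y * m y s by rewrite /U; ring.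
    have r0 := rho0 y hy; have r1 := rhol y hy.
    apply: ler_pM => //; first by rewrite mulr_ge0 ?sqr_ge0.
    have p1 : m y s ^+ 2 <= M ^+ 2 by rewrite lerXn2r.
    by have := ler_pM (sqr_ge0 _) r0 p1 r1; rewrite /CC; clear; lra.
  have -> : 2 * x0 - x0 = x0 by ring.
  by have := Hd' s hs; rewrite NE ler_pdivlMr//; clear; lra.
have K30 : 0 <= 3 * K by lra.
have := weighted_mass ab K30 ler01 k10 k20 dU cU drho hrho ra rb (fun y s _ s0 => HU y s s0) UM Hflux Hini t0.
rewrite -/E; apply/negP; rewrite -ltNge.
have low : c * (h + h) <= Int a x0 (fun y => U y t * rho y).
  have -> : h + h = (x + h) - (x - h) by ring.
  apply: Int_ge_sub => //.
  - move=> y; apply: cvgM; last exact: is_derive1_cont (drho y).1.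
    by apply: (@cont2_slice R U t) => y'; have [] := cU y' t t0.
  - by rewrite /a /l; lra.
  - by lra.
  - by lra.
  - by move=> y hy; apply: mulr_ge0; [case/andP: (UM y t hy t0)|exact: rho0].
  - move=> y hy; have hyd : `|y - x| <= d by rewrite ler_norml; clear -hy hd; lra.
    have wy := Hd y hyd; have wy0 : 0 <= w y t by clear -wy wxt; lra.
    rewrite /c; apply: ler_pM.
    + by apply: exprn_ge0; clear -wxt; lra.
    + by apply: mulr_ge0; [clear -xx0; lra|exact: expR_ge0].
    + by rewrite /U /m max_r// lerXn2r// nnegrE//; clear -wxt; lra.
    + rewrite /rho; apply: ler_pM; [clear -xx0; lra|exact: expR_ge0| |by rewrite ler_expR; clear -hy; lra].
      by rewrite -[leLHS]mulr1; apply: ler_pM; rewrite ?/l; clear -xx0 hx hy Y0; lra.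
apply: lt_le_trans low.
have := HY l ltac:(rewrite /l; lra).
have -> : c * (h + h) = c * h + c * h by ring.
have ch0 : 0 < c * h by rewrite mulr_gt0.
suff : E * ((k1 * M ^+ 3 * (x0 - a) + k2) * t) <= E * (3 * M ^+ 3 * t) * (l ^+ 2 * expR (- (l / 2))) by lra.
have -> : E * (3 * M ^+ 3 * t) * (l ^+ 2 * expR (- (l / 2))) = E * ((M ^+ 3 * (3 * (l ^+ 2 * expR (- (l / 2))))) * t) by ring.
apply: ler_wpM2l; first exact: ltW.
apply: ler_wpM2r; first exact: ltW.
have -> : k1 * M ^+ 3 * (x0 - a) + k2 = M ^+ 3 * (2 * (l ^+ 2 * expR (- (l / 2))) + l * expR (- l)).
  by rewrite /k1 /k2 /a; ring.
apply: ler_wpM2l; first exact: exprn_ge0.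
have l3 : l * expR (- l) <= l ^+ 2 * expR (- (l / 2)).
  apply: ler_pM; rewrite ?expR_ge0//; [lra|nra|].
  by rewrite ler_expR; lra.
lra.
Qed.

Lemma tail_mono (R : realType) (K M r : R) (F v vx vxx vt : R -> R -> R) :
  pos_sol K M r F v vx vxx vt ->
  forall x y t : R, r < x -> x <= y -> 0 < t -> v y t <= v x t.
Proof.
move=> ps x y t rx xy t0; have [->//|nxy] := eqVneq x y.
have xy' : x < y by rewrite lt_neqAle nxy.
have := @reflection_le R K M r F v vx vxx vt ps ((x + y) / 2) x t ltac:(lra) ltac:(lra) t0.
by have -> : 2 * ((x + y) / 2) - x = y by field.
Qed.

Lemma tail_decay (R : realType) (K M r : R) (F v vx vxx vt : R -> R -> R) :
  pos_sol K M r F v vx vxx vt ->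
  forall t e : R, 0 < t -> 0 < e -> exists X, forall x, X <= x -> v x t <= e.
Proof.
move=> ps t e t0 e0; have K0 := ps_K ps.
have M0 : 0 <= M by have /andP[h1 h2] := ps_bd ps 0 t0; exact: le_trans h2.
pose a := r + 1.
pose C := expR (K * t) * (2 * M * t).
have C0 : 0 <= C by rewrite mulr_ge0 ?expR_ge0// mulr_ge0 ?(ltW t0)// mulr_ge0.
exists (a + 1 + 8 * C / e) => x hx.
have ce0 : 0 <= 8 * C / e by rewrite divr_ge0 ?(ltW e0)// mulr_ge0.
pose h := 2 * (x - a).
have h2 : 2 <= h by rewrite /h; lra.
have h0 : 0 < h by lra.
pose b := a + h.
have ab : a < b by rewrite /b; lra.
pose rho (y : R) : R := (y - a) * (b - y) / h.
pose rho1 (y : R) : R := (a + b - 2 * y) / h.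
pose rho2 (y : R) : R := - 2 / h.
have drho (y : R) : is_derive y 1 rho (rho1 y) /\ is_derive y 1 rho1 (rho2 y).
  by split; rewrite /rho /rho1 /rho2; apply: is_derive_eq; rewrite /GRing.scale /=; ring.
have rho0 y : a <= y <= b -> 0 <= rho y.
  move=> hy; apply: divr_ge0; last exact: ltW.
  by apply: mulr_ge0; lra.
have hrho y : a <= y <= b -> 0 <= rho y /\ rho2 y <= 0 * rho y + 0.
  move=> hy; split; first exact: rho0.
  by rewrite mul0r addr0 /rho2 mulNr oppr_le0 divr_ge0// ltW.
have ra : rho a = 0 by rewrite /rho subrr !mul0r.
have rb : rho b = 0 by rewrite /rho subrr mulr0 mul0r.
have hh : h / h = 1 by rewrite divff// gt_eqF.
have Hflux (s : R) : 0 < s -> v a s * rho1 a - v b s * rho1 b <= 2 * M.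
  move=> s0; have -> : rho1 a = 1 by rewrite /rho1 (_ : a + b - 2 * a = h) ?hh// /b; ring.
  have -> : rho1 b = - 1 by rewrite /rho1 (_ : a + b - 2 * b = - h) ?mulNr ?hh// /b; ring.
  by have := ps_bd ps a s0; have := ps_bd ps b s0; lra.
have HU (y s : R) : a <= y <= b -> 0 < s -> vt y s <= vxx y s + K * v y s.
  move=> _ s0; rewrite (ps_eq ps)// lerD2l.
  have hv := ps_bd ps y s0; have /andP[v0 _] := hv.
  have := ps_F ps s0 hv (b := 0); rewrite (ps_F0 ps)// !subr0 lexx M0 => /(_ isT).
  by rewrite (ger0_norm v0); apply: le_trans; exact: ler_norm.
have UM (y s : R) : a <= y <= b -> 0 < s -> 0 <= v y s <= M by move=> _; exact: (ps_bd ps).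
have crho : continuous rho by move=> y; exact: is_derive1_cont (drho y).1.
have Hini (e' : R) : 0 < e' -> exists2 d, 0 < d &
      forall s, 0 < s < d -> Int a b (fun y => v y s * rho y) <= e'.
  move=> e'0; have [d d0 Hd] := @ps_ini _ _ _ _ _ _ _ _ _ ps a b ltac:(rewrite /a; lra) ab (e' / h) ltac:(by rewrite divr_gt0).
  exists d => // s hs; have /andP[s0 _] := hs.
  have cvs : continuous (v^~ s) by apply: cont2_slice => y; have [] := ps_cont ps y s0.
  have [N [N0 dN]] := antiderivative a cvs.
  have dN' y : a <= y <= b -> is_derive y 1 N (v y s) by move=> /andP[? _]; exact: dN.
  have := Hd s hs; rewrite (IntE ab cvs dN') ler_pdivlMr// => HN.
  apply: (@le_trans _ _ (h * N b - h * N a)); last by lra.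
  have cvr : continuous (fun y => v y s * rho y).
    by move=> y; apply: cvgM; [exact: cvs|exact: crho].
  have dhN y : a <= y <= b -> is_derive y 1 (fun y => h * N y) (h * v y s).
    by move=> hy; have := is_deriveZ h (dN' y hy).
  apply: (Int_le_anti ab cvr dhN) => y hy; have /andP[v0 _] := ps_bd ps y s0.
  rewrite mulrC; apply: ler_wpM2r => //.
  rewrite /rho ler_pdivrMr//.
  by apply: ler_pM; rewrite /b in hy *; clear -hy h0; lra.
have dU (y s : R) : 0 < s -> [/\ is_derive s 1 (v y) (vt y s),
     is_derive y 1 (v^~ s) (vx y s) & is_derive y 1 (vx^~ s) (vxx y s)].
  by move=> s0; split; [exact: (ps_dt ps)|exact: (ps_dx ps)|exact: (ps_dxx ps)].
have M20 : 0 <= 2 * M by lra.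
have := weighted_mass ab (ltW K0) (lexx 0) (lexx 0) M20 dU (fun y s => ps_cont ps y (t := s)) drho hrho ra rb HU UM Hflux Hini t0.
rewrite addr0 !mul0r add0r -/C => HC.
have xv0 : 0 <= v x t by case/andP: (ps_bd ps x t0).
have low : (v x t * (h / 8)) * (x - (a + h / 4)) <= Int a b (fun y => v y t * rho y).
  apply: Int_ge_sub => //.
  - move=> y; apply: cvgM; last exact: crho.
    by apply: cont2_slice => y'; have [] := ps_cont ps y' t0.
  - by lra.
  - by rewrite /h; lra.
  - by rewrite /b /h; lra.
  - by move=> y hy; apply: mulr_ge0; [case/andP: (ps_bd ps y t0)|exact: rho0].
  - move=> y hy; apply: ler_pM => //; first by lra.
      by apply: (tail_mono ps) => //; rewrite /a in hy *; lra.
    rewrite /rho ler_pdivlMr//.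
    have -> : h / 8 * h = (h / 4) * (h / 2) by field.
    by apply: ler_pM; rewrite /b /h in hy *; lra.
have : v x t * (h / 8) * (x - (a + h / 4)) <= C by exact: le_trans HC.
have -> : v x t * (h / 8) * (x - (a + h / 4)) = v x t * (x - a) ^+ 2 / 8 by rewrite /h; field.
move=> H; rewrite leNgt; apply/negP => ev.
have xa : 8 * C / e <= x - a by lra.
have xa1 : 1 <= x - a by lra.
rewrite ler_pdivrMr// in xa.
have xa2 : x - a <= (x - a) ^+ 2 by rewrite expr2; nra.
have p1 : e * (x - a) < v x t * (x - a) by rewrite ltr_pM2r//; lra.
have p2 := ler_wpM2l xv0 xa2.
lra.
Qed.


(** * The perturbed equation *)

Lemma period_reduction (R : realType) (T t : R) : 0 < T -> 0 <= t ->
  exists (n : nat) (s : R), 0 <= s <= T /\ t = s + n%:R * T.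
Proof.
move=> T0 t0; have tT : 0 <= t / T by rewrite divr_ge0// ltW.
have /andP[h1 h2] := truncn_itv tT.
exists (Num.truncn (t / T)), (t - (Num.truncn (t / T))%:R * T); split; last by rewrite subrK.
by move: h1 h2; rewrite -natr1 ler_pdivlMr// ltr_pdivrMr//; lra.
Qed.

Lemma periodicn (R : realType) (T : R) (h : R -> R) : (forall t, h (t + T) = h t) ->
  forall (n : nat) t, h (t + n%:R * T) = h t.
Proof.
move=> hT; elim=> [|n IH] t; first by rewrite mul0r addr0.
by rewrite -natr1 mulrDl mul1r addrA hT IH.
Qed.

Lemma holder_small (R : realType) (C alpha e : R) : 0 < alpha -> 0 < e ->
  exists2 d, 0 < d & forall x, 0 <= x -> x < d -> C * x `^ alpha < e.
Proof.
move=> a0 e0; have C1 : 0 < `|C| + 1 by have := normr_ge0 C; lra.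
pose q := e / (`|C| + 1).
have q0 : 0 < q by rewrite divr_gt0.
exists (q `^ alpha^-1); first by rewrite powR_gt0.
move=> x x0 xd.
have : x `^ alpha < q.
  have -> : q = (q `^ alpha^-1) `^ alpha by rewrite -powRrM mulVf ?gt_eqF// powRr1// ltW.
  by rewrite gt0_ltr_powR// nnegrE// powR_ge0.
rewrite /q ltr_pdivlMr// => h; apply: le_lt_trans h.
rewrite mulrC; apply: ler_wpM2l; first exact: powR_ge0.
by have := ler_norm C; lra.
Qed.

Record regular (R : realType) (T : R) (f fu : R -> R -> R) : Prop := Regular {
  rg_T : 0 < T ;
  rg_0 : forall t : R, f t 0 = 0 ;
  rg_per : forall t a : R, 0 <= a -> f (t + T) a = f t a ;
  rg_cont : forall t a : R, 0 <= a -> {for t, continuous (f^~ a)} ;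
  rg_der : forall t a : R, 0 < a -> is_derive a 1 (f t) (fu t a) ;
  rg_lip : forall M : R, 0 < M -> exists2 K, 0 < K & forall t a b : R, 0 <= t ->
      0 <= a <= M -> 0 <= b <= M -> `|f t a - f t b| <= K * `|a - b| /\ `|fu t a| <= K ;
  rg_c11 : forall M : R, 0 < M -> exists2 L, 0 <= L & forall t a b : R,
      0 <= a <= M -> 0 <= b <= M -> `|fu t a - fu t b| <= L * `|a - b| }.

Lemma regular_of (R : realType) (T : R) (f : R -> R -> R) :
  0 < T -> loc_holder f -> C1_u_loclip f -> f_zero f -> f_periodic T f ->
  exists fu, regular T f fu.
Proof.
move=> T0 hh [fu [dfu [_ [_ fl]]]] f0 fp.
have hc (t a e : R) : 0 <= a -> 0 < e -> exists2 d, 0 < d & forall s b, 0 <= b ->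
    `|s - t| < d -> `|b - a| < d -> `|f s b - f t a| < e.
  move=> a0 e0.
  have M0 : 0 < `|t| + `|a| + 1 by have := normr_ge0 t; have := normr_ge0 a; lra.
  have [al [C [al0 [al1 H]]]] := hh _ M0.
  have [d d0 Hd] := holder_small C al0 e0.
  exists (Num.min 1 (d / 2)); first by rewrite lt_min ltr01; lra.
  move=> s b b0; rewrite !lt_min => /andP[s1 sd] /andP[b1 bd].
  have hs : `|s| <= `|t| + `|a| + 1.
    have -> : s = (s - t) + t by ring.
    by rewrite (le_trans (ler_normD _ _))//; have := normr_ge0 a; lra.
  have hb : b <= `|t| + `|a| + 1.
    have := ler_norm (b - a); have := ler_norm a; have := normr_ge0 t; lra.
  have ha : a <= `|t| + `|a| + 1.
    have := ler_norm a; have := normr_ge0 t; lra.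
  have ht : `|t| <= `|t| + `|a| + 1 by have := normr_ge0 a; lra.
  apply: le_lt_trans (H s t b a hs ht b0 hb a0 ha) _.
  by apply: Hd; [exact: addr_ge0|lra].
have cm (t : R) : continuous (fun x : R => f t (Num.max 0 x)).
  move=> x; apply/cont_epsP => e e0.
  have mx : 0 <= Num.max 0 x by rewrite le_max lexx.
  have [d d0 Hd] := hc t (Num.max 0 x) e mx e0.
  exists d => // y hy; apply: Hd; rewrite ?le_max ?lexx// ?subrr ?normr0//.
  exact: le_lt_trans (max0_dist _ _) hy.
have mvt (t a b : R) : 0 <= a -> a < b ->
    exists c, [/\ a < c, c < b & f t b - f t a = fu t c * (b - a)].
  move=> a0 ab.
  have dF x : x \in `]a, b[ -> is_derive x 1 (fun x : R => f t (Num.max 0 x)) (fu t x).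
    rewrite in_itv/= => /andP[h1 h2]; have x0 : 0 < x by lra.
    apply: (is_derive_near _ _ (dfu t x x0) (d := x)) => //.
    by move=> y; rewrite ltr_norml => hy; rewrite max_r//; lra.
  have [c] := MVT ab dF (continuous_subspaceT (cm t)).
  rewrite in_itv/= !max_r//; last by lra.
  by move=> /andP[h1 h2] E; exists c.
have bT (a : R) : 0 <= a -> exists2 B, 0 <= B & forall t, 0 <= t -> `|f t a| <= B.
  move=> a0.
  have ca : {within `[0, T], continuous (fun t => `|f t a|)}.
    apply: continuous_subspaceT => t; apply: cvg_norm; apply/cont_epsP => e e0.
    have [d d0 Hd] := hc t a e a0 e0; exists d => // s hs.
    by apply: Hd => //; rewrite subrr normr0.
  have [c _ Hc] := EVT_max (ltW T0) ca.
  exists `|f c a| => // t t0; have [n [s [hs ->]]] := period_reduction T0 t0.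
  rewrite (@periodicn R T (f^~ a)) => [|r]; last exact: fp.
  by apply: Hc; rewrite in_itv.
exists fu; split => //.
- move=> t a a0; apply/cont_epsP => e e0; have [d d0 Hd] := hc t a e a0 e0.
  by exists d => // s hs; apply: Hd => //; rewrite subrr normr0.
- move=> M M0; have [L HL] := fl M M0; have [B B0 HB] := bT M (ltW M0).
  pose K := B / M + `|L| * M + 1.
  have BM : 0 <= B / M by rewrite divr_ge0// ltW.
  have LM : 0 <= `|L| * M by rewrite mulr_ge0// ltW.
  have K0 : 0 < K by rewrite /K; lra.
  have bfu t a : 0 <= t -> 0 <= a <= M -> `|fu t a| <= K.
    move=> t0 /andP[a0 aM]; have [c [c1 c2]] := mvt t 0 M (lexx 0) M0.
    rewrite f0 !subr0 => Ec.
    have fc : `|fu t c| <= B / M.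
      by rewrite ler_pdivlMr// -[X in _ * X <= _](gtr0_norm M0) -normrM -Ec; exact: HB.
    have -> : fu t a = (fu t a - fu t c) + fu t c by ring.
    rewrite (le_trans (ler_normD _ _))//.
    have := HL t a c a0 aM (ltW c1) (ltW c2).
    have p1 : L * `|a - c| <= `|L| * M.
      apply: (@le_trans _ _ (`|L| * `|a - c|)).
        by apply: ler_wpM2r => //; exact: ler_norm.
      by apply: ler_wpM2l => //; rewrite ler_norml; lra.
    by rewrite /K; lra.
  exists K => // t a b t0 ha hb; split; last exact: bfu.
  wlog ab : a b ha hb / a <= b.
    move=> W; have /orP[ab|ba] := le_total a b; first exact: W.
    by rewrite distrC (distrC a b); exact: W.
  have [->|nab] := eqVneq a b; first by rewrite !subrr normr0 mulr0.
  have ab' : a < b by rewrite lt_neqAle nab.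
  have a0 : 0 <= a by lra.
  have [c [c1 c2 Ec]] := mvt t a b a0 ab'.
  rewrite distrC Ec normrM (distrC a b); apply: ler_wpM2r => //.
  by apply: bfu => //; lra.
- move=> M M0; have [L HL] := fl M M0; exists `|L| => // t a b /andP[a0 aM] /andP[b0 bM].
  apply: le_trans (HL t a b a0 aM b0 bM) _; apply: ler_wpM2r => //; exact: ler_norm.
Qed.

Lemma regular_expand (R : realType) (T : R) (f fu : R -> R -> R) (M L : R) :
  regular T f fu -> 0 <= L ->
  (forall t a b : R, 0 <= a <= M -> 0 <= b <= M -> `|fu t a - fu t b| <= L * `|a - b|) ->
  forall t a b : R, 0 < a <= M -> 0 < b <= M ->
    `|f t b - f t a - fu t a * (b - a)| <= L * (b - a) ^+ 2.
Proof.
move=> rg L0 HL t a b ha hb.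
have key (x y : R) : 0 < x <= M -> 0 < y <= M -> x < y ->
    exists c, [/\ x < c, c < y & f t y - f t x = fu t c * (y - x)].
  move=> hx hy xy.
  have dF z : z \in `]x, y[ -> is_derive z 1 (f t) (fu t z).
    by rewrite in_itv/= => hz; apply: (rg_der rg); lra.
  have cF : {within `[x, y], continuous (f t)}.
    apply: derivable_within_continuous => z; rewrite in_itv/= => hz.
    by have [] := rg_der rg t (a := z) ltac:(lra).
  have [c] := MVT xy dF cF.
  by rewrite in_itv/= => /andP[h1 h2] E; exists c.
have fin c : 0 <= c <= M -> `|c - a| <= `|b - a| -> f t b - f t a = fu t c * (b - a) ->
    `|f t b - f t a - fu t a * (b - a)| <= L * (b - a) ^+ 2.
  move=> hc hca ->; rewrite -mulrBl normrM -[(b - a) ^+ 2]real_normK ?num_real// expr2 mulrA.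
  apply: ler_wpM2r => //.
  have ha' : 0 <= a <= M by lra.
  apply: le_trans (HL t c a hc ha') _; exact: ler_wpM2l.
have [ab|ba|->] := ltgtP a b.
- have [c [c1 c2 Ec]] := key a b ha hb ab.
  apply: (fin c) => //; first by lra.
  by rewrite !gtr0_norm; lra.
- have [c [c1 c2 Ec]] := key b a hb ha ba.
  apply: (fin c); first by lra.
    by rewrite !ltr0_norm; lra.
  by rewrite -opprB Ec; ring.
- by rewrite !subrr mulr0 subrr normr0 expr0n mulr0.
Qed.

Lemma regular_fu_cont (R : realType) (T : R) (f fu : R -> R -> R) :
  regular T f fu -> forall t a : R, 0 < a -> {for t, continuous (fu^~ a)}.
Proof.
move=> rg t a a0; apply/cont_epsP => e e0.
have M0 : 0 < a + 1 by lra.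
have [L L0 HL] := rg_c11 rg M0.
have ex := regular_expand rg L0 HL.
pose d := Num.min 1 (e / (4 * (L + 1))).
have L4 : 0 < 4 * (L + 1) by lra.
have d0 : 0 < d by rewrite /d lt_min ltr01 divr_gt0.
have d1 : d <= 1 by rewrite /d ge_min lexx.
have Ld : L * d <= e / 4.
  have : d <= e / (4 * (L + 1)) by rewrite /d ge_min lexx orbT.
  rewrite ler_pdivlMr// => h; lra.
have ha : 0 < a <= a + 1 by lra.
have hb : 0 < a + d <= a + 1 by lra.
pose q s := (f s (a + d) - f s a) / d.
have hq s : `|q s - fu s a| <= L * d.
  have := ex s a (a + d) ha hb; rewrite [X in _ * X](_ : a + d - a = d); last by ring.
  rewrite [X in _ <= _ * X](_ : _ = d ^+ 2); last by ring.
  have -> : f s (a + d) - f s a - fu s a * d = (q s - fu s a) * d.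
    by rewrite /q; field; rewrite gt_eqF.
  by rewrite normrM (gtr0_norm d0) expr2 mulrA ler_pM2r.
have ed : 0 < e / 8 * d by rewrite mulr_gt0//; lra.
have ad0 : 0 <= a + d by lra.
have [d2 d20 H2] := proj1 (cont_epsP _ _) (rg_cont rg (t := t) (ltW a0)) _ ed.
have [d3 d30 H3] := proj1 (cont_epsP _ _) (rg_cont rg (t := t) ad0) _ ed.
exists (Num.min d2 d3); first by rewrite lt_min d20.
move=> s; rewrite lt_min => /andP[s2 s3].
have k1 := H2 s s2; have k2 := H3 s s3; rewrite /= in k1 k2.
have : `|q s - q t| < e / 4.
  have -> : q s - q t = ((f s (a + d) - f t (a + d)) - (f s a - f t a)) / d.
    by rewrite /q; field; rewrite gt_eqF.
  rewrite normrM normfV (gtr0_norm d0) ltr_pdivrMr//.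
  by rewrite (le_lt_trans (ler_normB _ _))//; lra.
have := hq s; have := hq t; rewrite !ler_norml !ltr_norml; lra.
Qed.


Lemma per_sol_bounds (R : realType) (T : R) (f fu : R -> R -> R) (p : R -> R) :
  regular T f fu -> X_per f T p -> 0 < p 0 ->
  exists c M : R, 0 < c /\ forall t, 0 <= t -> c <= p t <= M.
Proof.
move=> rg [pp [pT dp]] p00; have T0 := rg_T rg.
have cp : continuous p by move=> t; exact: is_derive1_cont (dp t).
have [tM _ HM] := EVT_max (ltW T0) (continuous_subspaceT cp).
have [tm htm Hm] := EVT_min (ltW T0) (continuous_subspaceT cp).
rewrite in_itv/= in htm.
have bd t : 0 <= t -> p tm <= p t <= p tM.
  move=> t0; have [n [s [hs ->]]] := period_reduction T0 t0.
  by rewrite (periodicn pT) Hm ?HM// in_itv.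
exists (p tm), (p tM); split => //.
rewrite lt_neqAle pp andbT eq_sym; apply/eqP => pm0.
have M1 : 0 < p tM + 1 by have := pp tM; lra.
have [K K0 HK] := rg_lip rg M1.
have := @ode_unique R (fun s => p (s + tm)) (T - tm) K.
move=> H; have {H} : p (T - tm + tm) = 0.
  have dps (s : R) : is_derive s 1 (fun s => p (s + tm)) (f (s + tm) (p (s + tm))).
    apply/is_derive_epsP => e /(proj1 (is_derive_epsP _ _ _) (dp (s + tm))) [d d0 Hd].
    by exists d => // h /Hd; rewrite (addrAC s h).
  apply: H.
  - by apply: derivable_within_continuous => s _; have [] := dps s.
  - by rewrite add0r.
  - move=> s hs; exists (f (s + tm) (p (s + tm))); split; first exact: dps.
    have st : 0 <= s + tm by lra.
    have := bd _ st => hb; have p1 := pp (s + tm).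
    have [] := HK (s + tm) (p (s + tm)) 0 st ltac:(lra) ltac:(lra).
    by rewrite (rg_0 rg) !subr0.
  - lra.
by rewrite subrK -[T]add0r pT => p0; rewrite p0 ltxx in p00.
Qed.

Definition clamp (R : realType) (M y : R) : R := M - Num.max 0 (M - Num.max 0 y).

Lemma clamp_itv (R : realType) (M y : R) : 0 <= M -> 0 <= clamp M y <= M.
Proof.
move=> M0; rewrite /clamp; case: (lerP 0 y) => hy; first by case: (lerP 0 (M - y)); lra.
by case: (lerP 0 (M - 0)); lra.
Qed.

Lemma clamp_id (R : realType) (M y : R) : 0 <= y <= M -> clamp M y = y.
Proof. by move=> hy; rewrite /clamp (@max_r _ _ 0 y) ?max_r; lra. Qed.

Lemma clamp_dist (R : realType) (M y z : R) : `|clamp M y - clamp M z| <= `|y - z|.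
Proof.
rewrite /clamp (_ : _ - _ - _ = - (Num.max 0 (M - Num.max 0 y) - Num.max 0 (M - Num.max 0 z))); last by ring.
rewrite normrN (le_trans (max0_dist _ _))//.
rewrite (_ : _ - _ = - (Num.max 0 y - Num.max 0 z)); last by ring.
by rewrite normrN max0_dist.
Qed.

Definition trunc_field (R : realType) (f : R -> R -> R) (M t y : R) : R :=
  f (Num.max 0 t) (clamp M y).

(* [s = 1] or [s = -1]: the equation satisfied by [s (u - p)]. *)
Definition pert (R : realType) (f : R -> R -> R) (p : R -> R) (M s t z : R) : R :=
  s * (trunc_field f M t (p (Num.max 0 t) + s * z) - trunc_field f M t (p (Num.max 0 t))).

Definition pert_dz (R : realType) (fu : R -> R -> R) (p : R -> R) (s t z : R) : R :=
  fu (Num.max 0 t) (p (Num.max 0 t) + s * z).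

Lemma norm1_sqr (R : realType) (s : R) : `|s| = 1 -> s * s = 1.
Proof. by move=> h; rewrite -expr2 -real_normK ?num_real// h expr1n. Qed.

Lemma pert_smooth (R : realType) (T : R) (f fu : R -> R -> R) (p : R -> R) (c M : R) :
  regular T f fu -> continuous p -> 0 < c ->
  (forall t, 0 <= t -> c <= p t <= M - c) ->
  exists K L : R, forall s : R, `|s| = 1 -> smooth_field K L (c / 2) (pert f p M s) (pert_dz fu p s).
Proof.
move=> rg cp c0 pb.
have M0 : 0 < M by have := pb 0 (lexx 0); lra.
have [K K0 HK] := rg_lip rg M0; have [L L0 HL] := rg_c11 rg M0.
have ex := regular_expand rg L0 HL.
exists K, L => s s1.
have m0 (t : R) : 0 <= Num.max 0 t by rewrite le_max lexx.
have cP : continuous (fun t : R => p (Num.max 0 t)).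
  by apply: continuous_max0 => t _; exact: cp.
have lF : lip_field K (trunc_field f M).
  split.
    move=> z; apply: (@continuous_max0 R (fun t => f t (clamp M z))) => t _.
    by apply: (rg_cont rg); case/andP: (clamp_itv z (ltW M0)).
  move=> t a b; have [h _] := HK (Num.max 0 t) _ _ (m0 t) (clamp_itv a (ltW M0)) (clamp_itv b (ltW M0)).
  apply: (le_trans h); apply: ler_wpM2l; [exact: ltW|exact: clamp_dist].
have rng (t a : R) : `|a| <= c / 2 -> 0 < p (Num.max 0 t) + s * a <= M.
  move=> ha; have := pb _ (m0 t); have : `|s * a| <= c / 2 by rewrite normrM s1 mul1r.
  rewrite ler_norml; lra.
have rng' (t a : R) : `|a| <= c / 2 -> 0 <= p (Num.max 0 t) + s * a <= M.
  by move=> /(rng t) /andP[/ltW-> ->].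
have Fid (t a : R) : `|a| <= c / 2 ->
    trunc_field f M t (p (Num.max 0 t) + s * a) = f (Num.max 0 t) (p (Num.max 0 t) + s * a).
  by move=> ha; rewrite /trunc_field clamp_id// rng'.
split => //.
- by rewrite divr_gt0.
- split.
    move=> z t; apply: cvgM; first exact: cvg_cst.
    apply: cvgB.
      apply: (@lip_field_cont R K (trunc_field f M) (fun t : R => p (Num.max 0 t) + s * z) t K0 lF).
      by apply: cvgD; [exact: cP|exact: cvg_cst].
    exact: (@lip_field_cont R K (trunc_field f M) (fun t : R => p (Num.max 0 t)) t K0 lF (cP t)).
  move=> t a b; rewrite /pert -mulrBr normrM s1 mul1r opprB addrA subrK.
  apply: (le_trans (lF.2 _ _ _)).
  by rewrite opprD addrACA subrr add0r -mulrBr normrM s1 mul1r.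
- by move=> t; rewrite /pert mulr0 addr0 subrr mulr0.
- move=> t a ha; rewrite /pert_dz.
  by have [_] := HK (Num.max 0 t) _ _ (m0 t) (rng' t a ha) (rng' t a ha).
- move=> a ha; rewrite /pert_dz => t; apply/cont_epsP => e e0.
  pose y (t : R) : R := p (Num.max 0 t) + s * a.
  have cfu : continuous (fun r : R => fu (Num.max 0 r) (y t)).
    apply: (@continuous_max0 R (fun r => fu r (y t))) => r _.
    by apply: (regular_fu_cont rg); case/andP: (rng t a ha).
  have [d1 d10 H1] := proj1 (cont_epsP _ _) (cfu t) (e / 2) ltac:(lra).
  have L1 : 0 < L + 1 by lra.
  have e2 : 0 < e / 2 / (L + 1) by rewrite divr_gt0//; lra.
  have [d2 d20 H2] := proj1 (cont_epsP _ _) (cP t) _ e2.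
  exists (Num.min d1 d2); first by rewrite lt_min d10.
  move=> r; rewrite lt_min => /andP[r1 r2].
  have := H2 r r2; rewrite ltr_pdivlMr// => k2.
  have := H1 r r1; rewrite /= => k1.
  have k3 := HL (Num.max 0 r) _ _ (rng' r a ha) (rng' t a ha).
  have yE : p (Num.max 0 r) + s * a - (p (Num.max 0 t) + s * a) = p (Num.max 0 r) - p (Num.max 0 t) by ring.
  rewrite yE in k3.
  have -> : fu (Num.max 0 r) (p (Num.max 0 r) + s * a) - fu (Num.max 0 t) (p (Num.max 0 t) + s * a) =
    (fu (Num.max 0 r) (p (Num.max 0 r) + s * a) - fu (Num.max 0 r) (y t)) +
    (fu (Num.max 0 r) (y t) - fu (Num.max 0 t) (y t)) by rewrite /y; ring.
  rewrite (le_lt_trans (ler_normD _ _))// -/(y t).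
  have := normr_ge0 (p (Num.max 0 r) - p (Num.max 0 t)).
  by rewrite -/(y t) in k3; lra.
- move=> t a b ha hb; rewrite /pert_dz.
  apply: (le_trans (HL _ _ _ (rng' t a ha) (rng' t b hb))).
  apply: ler_wpM2l => //.
  by rewrite opprD addrACA subrr add0r -mulrBr normrM s1 mul1r.
- move=> t a b ha hb; rewrite /pert !Fid// /pert_dz.
  have := ex (Num.max 0 t) _ _ (rng t a ha) (rng t b hb).
  set A := f _ (_ + s * b); set B := f _ (_ + s * a); set C := fu _ _; set D := trunc_field _ _ _ _.
  have -> : s * (A - D) - s * (B - D) - C * (b - a) = s * (A - B - C * (s * (b - a))).
    have : C * (b - a) = s * s * (C * (b - a)) by rewrite norm1_sqr// mul1r.
    by move=> {1}->; ring.
  rewrite normrM s1 mul1r (_ : _ + s * b - _ = s * (b - a)); last by ring.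
  by rewrite exprMn expr2 norm1_sqr// mul1r.
Qed.

Lemma pert_per (R : realType) (T : R) (f fu : R -> R -> R) (p : R -> R) (M s : R) :
  regular T f fu -> (forall t, p (t + T) = p t) -> 0 <= M ->
  forall t a : R, 0 <= t -> pert f p M s (t + T) a = pert f p M s t a.
Proof.
move=> rg pT M0 t a t0; have T0 := rg_T rg.
have tT : 0 <= t + T by lra.
rewrite /pert /trunc_field (max_r tT) (max_r t0) pT.
have cl y : 0 <= clamp M y by case/andP: (clamp_itv y M0).
by rewrite !(rg_per rg).
Qed.

Lemma is_derive_shiftr (R : realType) (h : R -> R) (t T l : R) :
  is_derive (t + T) 1 h l -> is_derive t 1 (fun s => h (s + T)) l.
Proof.
move=> dh; apply/is_derive_epsP => e /(proj1 (is_derive_epsP _ _ _) dh) [d d0 Hd].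
by exists d => // k /Hd; rewrite (addrAC t k).
Qed.

Definition dev (R : realType) (u : R -> R -> R) (p : R -> R) (T s x t : R) : R :=
  s * (u x (t + T) - p (t + T)).

Lemma dev_psol (R : realType) (T : R) (f fu : R -> R -> R) (p : R -> R) (u : R -> R -> R) (M s : R) :
  regular T f fu -> X_per f T p -> classical_sol_on f [set t | 0 < t] u ->
  (forall x t, 0 < t -> u x t <= M) -> (forall t, 0 <= t -> p t <= M) -> `|s| = 1 ->
  psol (pert f p M s) (dev u p T s).
Proof.
move=> rg [pp [pT dp]] us uM pM s1; have T0 := rg_T rg.
exists (fun x t => s * ux u x (t + T)), (fun x t => s * uxx u x (t + T)) => x t t0.
have tT : 0 < t + T by lra.
have cp : continuous p by move=> r; exact: is_derive1_cont (dp r).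
have [u0 [d1 [d2 [d3 [eq [c1 [c2 [c3 c4]]]]]]]] := us x (t + T) tT.
have dt : is_derive (t + T) 1 (u x) (ut u x (t + T)) by apply: (DeriveDef d1); rewrite -derive1E.
have dx : is_derive x 1 (u^~ (t + T)) (ux u x (t + T)) by apply: (DeriveDef d2); rewrite -derive1E.
have dxx : is_derive x 1 ((ux u)^~ (t + T)) (uxx u x (t + T)).
  by apply: (DeriveDef d3); rewrite -derive1E.
have dps := dp (t + T).
split.
- rewrite /dev; have := is_deriveM (is_derive_cst s x 1) (is_deriveB dx (is_derive_cst (p (t + T)) x 1)).
  by move/is_derive_eq; apply; rewrite /GRing.scale /=; ring.
- have := is_deriveM (is_derive_cst s x 1) dxx.
  by move/is_derive_eq; apply; rewrite /GRing.scale /=; ring.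
- have := is_deriveM (is_derive_cst s t 1) (is_deriveB (is_derive_shiftr dt) (is_derive_shiftr dps)).
  move/is_derive_eq; apply; rewrite /GRing.scale /= mulr0 addr0 eq.
  rewrite /pert /trunc_field (max_r t0) /dev mulrA norm1_sqr// mul1r.
  rewrite pT subrKC !clamp_id; first last.
  + by rewrite u0 uM.
  + by rewrite pp pM.
  by rewrite !(rg_per rg)//; ring.
- apply: cont2M; first exact: cont2_cst.
  have sh (v : R -> R -> R) : cont2 v x (t + T) -> cont2 (fun x t => v x (t + T)) x t.
    move=> /cont2P cv; apply/cont2P => e e0; have [d d0 Hd] := cv e e0.
    exists d => // x' t' hx ht; apply: Hd => //.
    by rewrite (_ : t' + T - (t + T) = t' - t)//; ring.
  apply: cont2B; first exact: sh.
  apply: (sh (fun _ r => p r)); apply: cont2_comp; [exact: cont2_snd|exact: cp].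
Qed.

Lemma flow_pert_opp (R : realType) (f : R -> R -> R) (p : R -> R) (K L rho M t a : R) (gz1 gz2 : R -> R -> R) :
  smooth_field K L rho (pert f p M 1) gz1 -> smooth_field K L rho (pert f p M (- 1)) gz2 -> 0 <= t ->
  flow (pert f p M (- 1)) t a = - flow (pert f p M 1) t (- a).
Proof.
move=> sf1 sf2 t0; have K0 := sf_K sf1.
have [y0 cy dy] := flowP (- a) K0 (sf_lip sf1).
apply/esym; apply: (@flow_unique R K _ a t (fun t => - flow (pert f p M 1) t (- a)) K0 (sf_lip sf2)).
- by apply: continuous_subspaceT => s; apply: cvgN; exact: cy.
- by rewrite y0// opprK.
- move=> s /andP[s0 _]; have d1 := dy s s0.
  have -> : pert f p M (-1) s (- flow (pert f p M 1) s (- a)) = - pert f p M 1 s (flow (pert f p M 1) s (- a)).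
    by rewrite /pert mulrNN; ring.
  exact: is_deriveN.
- by rewrite t0 lexx.
Qed.

(* Near [p 0] the Poincare map of [h' = f(t,h)] is [p 0 + a |-> p 0 + flow (pert f p M 1) T a]. *)
Lemma flow_of_sol (R : realType) (T : R) (f fu : R -> R -> R) (p : R -> R) (K L c M a : R) (h : R -> R) :
  regular T f fu -> X_per f T p -> 0 < c -> (forall t, 0 <= t -> c <= p t <= M - c) ->
  smooth_field K L (c / 2) (pert f p M 1) (pert_dz fu p 1) ->
  expR (K * T) * `|a| <= c / 2 -> ode_sol_from f (p 0 + a) h ->
  h T = p 0 + flow (pert f p M 1) T a.
Proof.
move=> rg [pp [pT dp]] c0 pb sf ha [h0 [hp [hc dh]]].
have T0 := rg_T rg; have K0 := sf_K sf.
have cp : continuous p by move=> t; exact: is_derive1_cont (dp t).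
have ch : {within `[0, T], continuous h}.
  apply/continuous_within_itvP => //; split.
  - by move=> t; rewrite in_itv/= => /andP[t0 _]; exact: is_derive1_cont (dh t t0).
  - by rewrite h0.
  - by apply: cvg_at_left_filter; exact: is_derive1_cont (dh T T0).
have [tM _ HM] := EVT_max (ltW T0) ch.
have M0 : 0 < M by have := pb 0 (lexx 0); lra.
have hM0 := hp (Num.max 0 tM).
pose M2 := M + `|h tM|.
have M20 : 0 < M2 by rewrite /M2; have := normr_ge0 (h tM); lra.
have [K2 K20 HK2] := rg_lip rg M20.
have [y0 cy dy] := flowP a K0 (sf_lip sf).
pose y t := flow (pert f p M 1) t a.
have yb (t : R) : 0 <= t <= T -> `|y t| <= c / 2.
  move=> /andP[t0 tT]; apply: le_trans (flow_norm a sf t0) _; apply: le_trans ha.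
  apply: ler_wpM2r => //; rewrite ler_expR; apply: ler_wpM2l => //; exact: ltW.
have TT : 0 <= T <= T by rewrite lexx ltW.
have := @ode_unique R (fun t => h t - (p t + y t)) T K2 _ _ _ T TT.
move=> H; have {H} : h T - (p T + y T) = 0; last first.
  by rewrite -[in p T](add0r T) pT => /subr0_eq.
apply: H.
- by move=> x; apply: cvgB; [exact: ch|apply: cvgD; [exact: (continuous_subspaceT cp)|exact: (continuous_subspaceT cy)]].
- by rewrite h0 /y y0//; ring.
move=> t /andP[t0 tT]; have tt : 0 <= t <= T by rewrite (ltW t0).
have d1 := dh t t0; have d2 := dp t; have d3 := dy t t0.
exists (f t (h t) - (f t (p t) + pert f p M 1 t (y t))); split.
  have d4 : is_derive t 1 y (pert f p M 1 t (y t)) by exact: d3.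
  exact: is_derive_eq.
have yt := yb t tt; have pt := pb t (ltW t0).
have yt' : - (c / 2) <= y t <= c / 2 by rewrite -ler_norml.
have -> : pert f p M 1 t (y t) = f t (p t + y t) - f t (p t).
  rewrite /pert /trunc_field (max_r (ltW t0)) !mul1r !clamp_id//; lra.
rewrite subrKC.
have ht : h t <= `|h tM| by apply: (le_trans (HM t _)); rewrite ?in_itv//= ler_norm.
have h1 : 0 <= h t <= M2 by rewrite hp ?ltW//= /M2; lra.
have h2 : 0 <= p t + y t <= M2 by have := normr_ge0 (h tM); rewrite /M2; lra.
by have [] := HK2 t (h t) (p t + y t) (ltW t0) h1 h2.
Qed.


Lemma initial_mass (R : realType) (f : R -> R -> R) (u0 : R -> R) (u : R -> R -> R) :
  admissible_u0 u0 -> cauchy_sol f u0 u ->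
  exists r : R, forall a b : R, a < b -> r < a \/ b < - r -> forall e : R, 0 < e ->
    exists2 d, 0 < d & forall t, 0 < t < d -> Int a b (u^~ t) <= e.
Proof.
move=> [mu0 [u0p [_ [r Hr]]]] [us ui].
exists r => a b ab out e e0.
pose S := Num.max `|a| `|b| + 1.
have S0 : 0 < S by rewrite /S ltr_wpDl// le_max normr_ge0.
have aS : - S <= a /\ a <= S.
  have : `|a| <= Num.max `|a| `|b| by rewrite le_max lexx.
  by have := ler_norm a; have := ler_norm (- a); rewrite normrN /S; lra.
have bS : - S <= b /\ b <= S.
  have : `|b| <= Num.max `|a| `|b| by rewrite le_max lexx orbT.
  by have := ler_norm b; have := ler_norm (- b); rewrite normrN /S; lra.
have /fine_cvgP [ffin fcv] := ui S S0.
have /cvgrPdist_lt /(_ e e0) fe := fcv.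
have near2 := filterI ffin fe.
have [d /= d0 Hd] := near2.
exists d => // t /andP[t0 td].
have [] := Hd t _ t0; first by rewrite /ball /= sub0r normrN gtr0_norm.
rewrite /= => tfin; rewrite sub0r normrN => te.
have cu : continuous (u^~ t).
  apply: cont2_slice => x.
  by have [_ [_ [_ [_ [_ [c _]]]]]] := us x t t0.
have [H [_ dH]] := antiderivative a cu.
have dH' x : a <= x <= b -> is_derive x 1 H (u x t) by move=> /andP[? _]; exact: dH.
have E1 := Int_FTC ab cu dH'.
have E2 := IntE ab cu dH'.
rewrite E2 -lee_fin -E1.
have mf : measurable_fun [set: R] (fun x : R => `|u x t - u0 x|).
  apply: measurableT_comp => //; apply: measurable_realfun.measurable_funB => //.
  exact: measurable_realfun.continuous_measurable_fun.
apply: (@le_trans _ _ (\int[@lebesgue_measure R]_(x in `[(- S)%R, S]) (`|u x t - u0 x|)%:E)%E).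
  have -> : (\int[@lebesgue_measure R]_(x in `[a, b]) (u x t)%:E =
      \int[@lebesgue_measure R]_(x in `[a, b]) (`|u x t - u0 x|)%:E)%E.
    apply: eq_integral => x; rewrite inE/= in_itv/= => hx.
    have -> : u0 x = 0.
      apply: Hr; case: out => [ra|br].
        by rewrite (lt_le_trans _ (ler_norm _))//; lra.
      by rewrite -normrN (lt_le_trans _ (ler_norm _))//; lra.
    have [ux0 _] := us x t t0.
    by rewrite subr0 ger0_norm.
  apply: ge0_subset_integral.
  - exact: measurable_itv.
  - exact: measurable_itv.
  - by apply/measurable_realfun.measurable_EFinP; exact: measurable_funTS mf.
  - by move=> x _; rewrite lee_fin.
  - move=> x /=; rewrite !in_itv/= => hx; lra.
by rewrite -[X in (X <= _)%E]fineK// lee_fin (le_trans (ler_norm _))// ltW.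
Qed.

Lemma pos_sol_u (R : realType) (T : R) (f fu : R -> R -> R) (u0 : R -> R) (u : R -> R -> R) :
  regular T f fu -> admissible_u0 u0 -> cauchy_sol f u0 u -> bounded_sol u ->
  exists K M r : R, [/\ forall x t, 0 < t -> 0 <= u x t <= M,
    pos_sol K M r f u (ux u) (uxx u) (ut u) &
    pos_sol K M r f (fun x t => u (0 - x) t) (fun x t => - ux u (0 - x) t)
      (fun x t => uxx u (0 - x) t) (fun x t => ut u (0 - x) t)].
Proof.
move=> rg au0 cs [M HM].
have [r Hr] := initial_mass au0 cs.
have [us _] := cs.
pose M1 := `|M| + 1.
have M10 : 0 < M1 by rewrite /M1; have := normr_ge0 M; lra.
have ub (x t : R) : 0 < t -> 0 <= u x t <= M1.
  move=> t0; have [-> _] := us x t t0; rewrite /=.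
  have := HM x t t0; have := ler_norm (u x t); have := ler_norm M; rewrite /M1; lra.
have [K K0 HK] := rg_lip rg M10.
have dt (x t : R) : 0 < t -> is_derive t 1 (u x) (ut u x t).
  move=> t0; have [_ [d1 _]] := us x t t0.
  by apply: (DeriveDef d1); rewrite -derive1E.
have dx (x t : R) : 0 < t -> is_derive x 1 (u^~ t) (ux u x t).
  move=> t0; have [_ [_ [d2 _]]] := us x t t0.
  by apply: (DeriveDef d2); rewrite -derive1E.
have dxx (x t : R) : 0 < t -> is_derive x 1 ((ux u)^~ t) (uxx u x t).
  move=> t0; have [_ [_ [_ [d3 _]]]] := us x t t0.
  by apply: (DeriveDef d3); rewrite -derive1E.
have hF (t a b : R) : 0 < t -> 0 <= a <= M1 -> 0 <= b <= M1 -> `|f t a - f t b| <= K * `|a - b|.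
  by move=> t0 ha hb; have [] := HK t a b (ltW t0) ha hb.
have hF0 (t : R) : 0 < t -> f t 0 = 0 by move=> _; exact: (rg_0 rg).
have heq (x t : R) : 0 < t -> ut u x t = uxx u x t + f t (u x t).
  by move=> t0; have [_ [_ [_ [_ [e _]]]]] := us x t t0.
have hc (x t : R) : 0 < t -> [/\ cont2 u x t, cont2 (ux u) x t, cont2 (uxx u) x t & cont2 (ut u) x t].
  by move=> t0; have [_ [_ [_ [_ [_ [c1 [c2 [c3 c4]]]]]]]] := us x t t0; exact: And4 c1 c2 c3 c4.
have hi (a b : R) : r < a -> a < b -> forall e : R, 0 < e ->
    exists2 d, 0 < d & forall t, 0 < t < d -> Int a b (u^~ t) <= e.
  by move=> ra ab e e0; apply: Hr => //; left.
exists K, M1, r; split; [exact: ub|exact: (PosSol K0 hF hF0 dx dxx dt heq hc ub hi)|].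
have dx' (x t : R) : 0 < t -> is_derive x 1 ((fun x t => u (0 - x) t)^~ t) (- ux u (0 - x) t).
  by move=> t0; exact: is_derive_refl (dx (0 - x) t t0).
have dxx' (x t : R) : 0 < t -> is_derive x 1 ((fun x t => - ux u (0 - x) t)^~ t) (uxx u (0 - x) t).
  by move=> t0; have := is_deriveN (is_derive_refl (dxx (0 - x) t t0)); rewrite opprK.
have dt' (x t : R) : 0 < t -> is_derive t 1 ((fun x t => u (0 - x) t) x) (ut u (0 - x) t).
  exact: dt.
have heq' (x t : R) : 0 < t -> ut u (0 - x) t = uxx u (0 - x) t + f t (u (0 - x) t) by exact: heq.
have hc' (x t : R) : 0 < t -> [/\ cont2 (fun x t => u (0 - x) t) x t, cont2 (fun x t => - ux u (0 - x) t) x t,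
    cont2 (fun x t => uxx u (0 - x) t) x t & cont2 (fun x t => ut u (0 - x) t) x t].
  move=> t0; have [c1 c2 c3 c4] := hc (0 - x) t t0.
  split; try exact: cont2_refl.
  apply: (@cont2_comp R (fun w => - w) (fun x t => ux u (0 - x) t)); first exact: cont2_refl.
  by apply: cvgN; exact: cvg_id.
have ub' (x t : R) : 0 < t -> 0 <= u (0 - x) t <= M1 by exact: ub.
apply: (PosSol K0 hF hF0 dx' dxx' dt' heq' hc' ub').
move=> a b ra ab e e0.
have ba : - b < - a by lra.
have [d d0 Hd] := Hr (- b) (- a) ba ltac:(right; lra) e e0.
exists d => // t ht; have /andP[t0 _] := ht; apply: le_trans (Hd t ht).
have cu : continuous (u^~ t) by apply: cont2_slice => x; have [] := hc x t t0.
have [H [_ dH]] := antiderivative (- b) cu.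
have dH' x : - b <= x <= - a -> is_derive x 1 H (u x t) by move=> /andP[? _]; exact: dH.
rewrite (IntE ba cu dH').
have -> : H (- a) - H (- b) = - H (0 - b) - - H (0 - a) by rewrite !sub0r; ring.
have cur : continuous (fun x => u (0 - x) t).
  move=> x; apply: (cvg_comp (fun x => 0 - x) (u^~ t)); last exact: cu.
  by apply: cvgB; [exact: cvg_cst|exact: cvg_id].
have dr x : a <= x <= b -> is_derive x 1 (fun x => - H (0 - x)) (u (0 - x) t).
  move=> hx; have := is_deriveN (is_derive_refl (dH' (0 - x) ltac:(lra))).
  by rewrite opprK.
by rewrite (IntE ab cur dr).
Qed.


(** * Exclusion of the limit *)

Record profile (R : realType) (T K L rho M r k0 : R) (g gm gz gzm z : R -> R -> R) : Prop := Profile {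
  pf_T : 0 < T ;
  pf_sf : smooth_field K L rho g gz ;
  pf_sfm : smooth_field K L rho gm gzm ;
  pf_opp : forall a : R, flow gm T a = - flow g T (- a) ;
  pf_per : forall t a : R, 0 <= t -> g (t + T) a = g t a ;
  pf_perm : forall t a : R, 0 <= t -> gm (t + T) a = gm t a ;
  pf_sol : psol g z ;
  pf_solm : psol gm (fun x t => - z x t) ;
  pf_bd : forall x t : R, 0 <= t -> `|z x t| <= M ;
  pf_r : 0 <= r ;
  pf_mono : forall x y t : R, r < x -> x <= y -> 0 <= t -> z y t <= z x t ;
  pf_monol : forall x y t : R, x <= y -> y < - r -> 0 <= t -> z x t <= z y t ;
  pf_k0 : 0 < k0 ;
  pf_tail : forall t : R, 0 <= t -> exists X, forall x, X <= `|x| -> z x t <= - k0 ;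
  pf_close : forall (e S : R) (N : nat), 0 < e -> exists2 n : nat, (N <= n)%N &
     forall x, `|x| <= S -> `|z x (n%:R * T)| < e }.

Lemma profile_small (R : realType) (T K L rho M r k0 : R) (g gm gz gzm z : R -> R -> R) :
  profile T K L rho M r k0 g gm gz gzm z ->
  forall (e : R) (N : nat), 0 < e -> exists2 n : nat, (N <= n)%N & forall x, z x (n%:R * T) <= e.
Proof.
move=> pf e N e0; have T0 := pf_T pf; have r0 := pf_r pf.
have [n Nn Hn] := @pf_close _ _ _ _ _ _ _ _ _ _ _ _ _ pf e (r + 1) N e0.
have nT : 0 <= n%:R * T by rewrite mulr_ge0// ltW.
have small x : `|x| <= r + 1 -> z x (n%:R * T) <= e.
  by move=> hx; rewrite (le_trans (ler_norm _))// ltW// Hn.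
exists n => // x; have [h|h] := lerP x (r + 1).
  have [h'|h'] := lerP (- (r + 1)) x; first by apply: small; rewrite ler_norml h'.
  apply: (@le_trans _ _ (z (- (r + 1)) (n%:R * T))).
    by apply: (pf_monol pf) => //; [exact: ltW|lra].
  by apply: small; rewrite normrN ger0_norm//; lra.
apply: (@le_trans _ _ (z (r + 1) (n%:R * T))).
  by apply: (pf_mono pf) => //; [lra|exact: ltW].
by apply: small; rewrite ger0_norm//; lra.
Qed.

Lemma case_periodic (R : realType) (T K L rho M r k0 q eps : R) (g gm gz gzm z : R -> R -> R) :
  profile T K L rho M r k0 g gm gz gzm z ->
  q < 0 -> - k0 <= q -> - flow_rad K rho T < q -> 0 < eps ->
  (forall a, q <= a < eps -> flow g T a <= a) -> False.
Proof.
move=> pf q0 qk qr eps0 PT; have T0 := pf_T pf; have sf := pf_sf pf.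
have rad0 : 0 < flow_rad K rho T by rewrite mulr_gt0 ?expR_gt0// (sf_rho sf).
pose eta := Num.min eps (flow_rad K rho T) / 4.
have m0 : 0 < Num.min eps (flow_rad K rho T) by rewrite lt_min eps0.
have m1 : Num.min eps (flow_rad K rho T) <= eps by rewrite ge_min lexx.
have m2 : Num.min eps (flow_rad K rho T) <= flow_rad K rho T by rewrite ge_min lexx orbT.
have eta0 : 0 < eta by rewrite /eta; lra.
have [n0 _ Hn0] := profile_small pf 0 eta0.
have nT : 0 <= n0%:R * T by rewrite mulr_ge0// ltW.
have [X HX] := pf_tail pf nT.
have zs := psol_shiftn n0 (ltW T0) (pf_per pf) (pf_sol pf).
have zM x t : 0 <= t -> z x (t + n0%:R * T) <= M.
  by move=> t0; rewrite (le_trans (ler_norm _))// (pf_bd pf)// addr_ge0.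
have q20 : 0 < - q / 2 by lra.
have e1 : 2 * eta < flow_rad K rho T by rewrite /eta; lra.
have e2 : 2 * eta < eps by rewrite /eta; lra.
have zi x : z x (0 + n0%:R * T) <= eta by rewrite add0r; exact: Hn0.
have zX x : X <= `|x| -> z x (0 + n0%:R * T) <= q.
  by move=> hx; rewrite add0r (le_trans (HX x hx)).
have [N HN] := gauss_decay sf T0 (pf_per pf) zs zM q0 eta0 qr e1 e2 PT zi zX q20.
have [n Nn Hn] := @pf_close _ _ _ _ _ _ _ _ _ _ _ _ _ pf (- q / 2) 0 (N + n0)%N q20.
have Nn' : (N <= n - n0)%N by rewrite leq_subRL ?(leq_trans (leq_addl _ _) Nn)// addnC.
have := HN _ Nn' 0; rewrite -mulrDl -natrD subnK ?(leq_trans (leq_addl _ _) Nn)//.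
have := Hn 0; rewrite normr0 lexx => /(_ isT); rewrite ltr_norml.
lra.
Qed.

Lemma flat_decay (R : realType) (T K L rho eps a1 b : R) (g gz : R -> R -> R) :
  smooth_field K L rho g gz -> 0 < T -> (forall t a : R, 0 <= t -> g (t + T) a = g t a) ->
  (forall a, - eps < a -> a < 0 -> flow g T a < a) ->
  - eps < a1 -> a1 < 0 -> - eps < b -> b < 0 ->
  (forall n, (0 < n)%N -> flow g (n%:R * T) a1 <= a1) /\
  exists2 N, (0 < N)%N & flow g (N%:R * T) a1 <= b.
Proof.
move=> sf T0 gT PT a1e a10 be b0.
have K0 := sf_K sf; have gl := sf_lip sf.
pose P a := flow g T a.
have semi n : flow g (n.+1%:R * T) a1 = P (flow g (n%:R * T) a1).
  have nT : 0 <= n%:R * T by rewrite mulr_ge0// ltW.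
  have [y0 cy dy] := flowP a1 K0 gl.
  have per k s b' : 0 <= s -> g (s + k%:R * T) b' = g s b'.
    elim: k s => [|k IH] s s0; first by rewrite mul0r addr0.
    by rewrite -natr1 mulrDl mul1r addrA gT ?IH// addr_ge0// mulr_ge0// ltW.
  have cs : {within `[0, T], continuous (fun t : R => flow g (t + n%:R * T) a1)}.
    apply: continuous_subspaceT => t.
    apply: (cvg_comp (fun t => t + n%:R * T) (fun t => flow g t a1)); last exact: cy.
    by apply: cvgD; [exact: cvg_id|exact: cvg_cst].
  have ds (t : R) : 0 < t <= T ->
      is_derive t 1 (fun t => flow g (t + n%:R * T) a1) (g t (flow g (t + n%:R * T) a1)).
    move=> /andP[t0 _]; have tn : 0 < t + n%:R * T by lra.
    by have := is_derive_shiftr (dy _ tn); rewrite per// ltW.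
  have TT : 0 <= T <= T by rewrite lexx ltW.
  have z0 : flow g (0 + n%:R * T) a1 = flow g (n%:R * T) a1 by rewrite add0r.
  have := flow_unique K0 gl cs z0 ds TT.
  by have -> : n.+1%:R * T = T + n%:R * T by rewrite -natr1; ring.
have mono n : flow g (n.+1%:R * T) a1 <= a1.
  elim: n => [|n IH].
    by rewrite mul1r; apply/ltW/PT.
  rewrite semi; apply: (@le_trans _ _ (P a1)); last by apply/ltW/PT.
  by apply: (flow_mono K0 gl) => //; exact: ltW.
split; first by case=> // n _; exact: mono.
have [bl|bl] := lerP a1 b.
  by exists 1%N => //; rewrite (le_trans (mono 0%N)).
have cP : {within `[b, a1], continuous (fun a => a - P a)}.
  apply: continuous_subspaceT => a; apply: cvgB; first exact: cvg_id.
  have E0 := expR_gt0 (K * T).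
  apply/cont_epsP => e e0; exists (e / expR (K * T)); first by rewrite divr_gt0.
  move=> b'; rewrite ltr_pdivlMr// mulrC => h.
  exact: le_lt_trans (flow_dist a b' K0 gl (ltW T0)) h.
have [c] := EVT_min (ltW bl) cP.
rewrite in_itv/= => hc Hc.
pose m := c - P c.
have m0 : 0 < m by rewrite subr_gt0; apply: PT; lra.
have step n : flow g (n.+1%:R * T) a1 <= b \/ flow g (n.+1%:R * T) a1 <= a1 - n%:R * m.
  elim: n => [|n [IH|IH]]; first by right; rewrite mul0r subr0; exact: mono.
    left; rewrite semi; apply: (@le_trans _ _ (P b)); last by apply/ltW/PT.
    by apply: (flow_mono K0 gl) => //; exact: ltW.
  have [h|h] := lerP (flow g (n.+1%:R * T) a1) b.
    left; rewrite semi; apply: (@le_trans _ _ (P b)); last by apply/ltW/PT.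
    by apply: (flow_mono K0 gl) => //; exact: ltW.
  right; rewrite semi.
  have := Hc (flow g (n.+1%:R * T) a1); rewrite in_itv/= (ltW h) mono => /(_ isT).
  rewrite -/m -[in n.+1%:R * m]natr1 mulrDl mul1r; lra.
have [N HN] : exists N : nat, (a1 - b) / m < N%:R.
  by exists (Num.bound ((a1 - b) / m)); rewrite archi_boundP// divr_ge0 ?(ltW m0)//; lra.
exists N.+1 => //; case: (step N) => // h; apply: (le_trans h).
by move: HN; rewrite ltr_pdivrMr//; lra.
Qed.

Lemma case_unstable (R : realType) (T K L rho M r k0 eps : R) (g gm gz gzm z : R -> R -> R) :
  profile T K L rho M r k0 g gm gz gzm z -> 0 < eps ->
  (forall a, - eps < a -> a < 0 -> flow g T a < a) -> False.
Proof.
move=> pf eps0 PT; have T0 := pf_T pf; have sf := pf_sf pf; have sfm := pf_sfm pf.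
have K0 := sf_K sf; have gl := sf_lip sf; have glm := sf_lip sfm; have k00 := pf_k0 pf.
have r0 := pf_r pf.
have shift n := psol_shiftn n (ltW T0) (pf_per pf) (pf_sol pf).
have shiftm n := psol_shiftn n (ltW T0) (pf_perm pf) (pf_solm pf).
have nT n : 0 <= n%:R * T :> R by rewrite mulr_ge0// ltW.
have nTS n (t : R) : T + n%:R * T = n.+1%:R * T by rewrite -natr1 mulrDl mul1r addrC.
have TT : 0 <= T <= T by rewrite lexx ltW.
have [A0 A00 HA] := bowl_exists sf T0 eps0 PT.
pose A := Num.min A0 (Num.min (k0 / 2) (eps / 4)).
have Ap : 0 < A by rewrite !lt_min A00 !divr_gt0.
have AA0 : A <= A0 by rewrite ge_min lexx.
have Ak : A <= k0 / 2 by rewrite /A !ge_min lexx !orbT.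
have Ae : A <= eps / 4 by rewrite /A !ge_min lexx !orbT.
have [l [eta [phi [l0 eta0 phi0 phil Hbowl]]]] := HA A Ap AA0.
pose E := expR (K * T).
have E0 : 0 < E by exact: expR_gt0.
have E1 : 1 <= E by rewrite /E -[leLHS]expR0 ler_expR mulr_ge0// ltW.
have fE h gzh (a t : R) : smooth_field K L rho h gzh -> 0 <= t <= T -> `|flow h t a| <= E * `|a|.
  move=> sfh /andP[t0 tT]; apply: le_trans (flow_norm a sfh t0) _.
  by apply: ler_wpM2r => //; rewrite ler_expR; apply: ler_wpM2l => //; exact: ltW.
have l00 : `|0 : R| <= l by rewrite normr0 ltW.
pose Bw s n := forall x, `|x| <= l -> z (s + x) (n%:R * T) <= phi x.
have Bwz s n : Bw s n -> z s (n%:R * T) <= - (3 / 2 * A).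
  by move=> /(_ 0 l00); rewrite addr0 phi0.
have Bwstep s n : Bw s n -> (forall t, 0 <= t <= T ->
    z (s - l) (t + n%:R * T) <= eta /\ z (s + l) (t + n%:R * T) <= eta) -> Bw s n.+1.
  move=> B He x xl; rewrite -(nTS n 0).
  apply: (Hbowl (fun x t => z x (t + n%:R * T)) s (shift n)) => // y yl.
  by rewrite add0r; exact: B.
have tailBw n : exists X, forall s, X + l <= s -> Bw s n.
  have [X HX] := pf_tail pf (nT n).
  exists X => s hs x xl; apply: (@le_trans _ _ (- (3 / 2 * A))); last exact: phil.
  have : X <= `|s + x| by rewrite (le_trans _ (ler_norm _))//; move: xl; rewrite ler_norml; lra.
  by move=> /HX; lra.
have [caseA|caseB] := pselect (forall e : R, 0 < e -> exists a, [/\ 0 < a, a < e & flow g T a <= a]).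
  have [a [a0 ae Pa]] := caseA (eta / E) ltac:(by rewrite divr_gt0).
  rewrite ltr_pdivlMr// in ae.
  have [n0 _ Hn0] := profile_small pf 0 a0.
  have fl (m : nat) : (forall x, z x ((n0 + m)%:R * T) <= a) ->
      forall x t, 0 <= t <= T -> z x (t + (n0 + m)%:R * T) <= flow g t a.
    move=> Hm; apply: (flat_cmp_line (M := M) K0 gl (shift (n0 + m)%N)).
    - by move=> x; rewrite add0r; exact: Hm.
    - by move=> x t t0; rewrite (le_trans (ler_norm _))// (pf_bd pf)// addr_ge0.
    - exists (- (E * `|a|)) => t ht; have := fE g gz a t sf ht.
      by rewrite ler_norml => /andP[].
  have Ha m : forall x, z x ((n0 + m)%:R * T) <= a.
    elim: m => [|m IH] x; first by rewrite addn0; exact: Hn0.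
    by rewrite addnS -(nTS _ 0); apply: le_trans Pa; exact: fl.
  have [X HX] := tailBw n0.
  have HB m : Bw (X + l) (n0 + m)%N.
    elim: m => [|m IH]; first by rewrite addn0; exact: HX.
    rewrite addnS; apply: Bwstep => // t ht.
    have fa : flow g t a <= eta.
      apply: (le_trans (ler_norm _)); apply: (le_trans (fE g gz a t sf ht)).
      by rewrite gtr0_norm// mulrC ltW.
    by split; apply: (le_trans _ fa); apply: (fl m (Ha m)).
  have [n Nn Hn] := @pf_close _ _ _ _ _ _ _ _ _ _ _ _ _ pf A `|X + l| n0 Ap.
  have := Bwz _ _ (HB (n - n0)%N); rewrite subnKC//.
  by have := Hn (X + l) (lexx _); rewrite ltr_norml; lra.
have [e1 e10 PB] : exists2 e, 0 < e & forall a, 0 < a -> a < e -> a < flow g T a.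
  apply: contrapT => nB; apply: caseB => e e0; apply: contrapT => na; apply: nB.
  exists e => // a a0 ae; rewrite ltNge; apply/negP => h; apply: na.
  by exists a.
have PTm a : - e1 < a -> a < 0 -> flow gm T a < a.
  move=> h1 h2; rewrite (pf_opp pf) ltrNl; apply: PB; clear -h1 h2; lra.
have [A0' A00' HA'] := bowl_exists sfm T0 e10 PTm.
pose A' := Num.min A0' (eta / (E * E) / 3).
have eE : 0 < eta / (E * E) by rewrite divr_gt0// mulr_gt0.
have Ap' : 0 < A' by rewrite lt_min A00' divr_gt0.
have AA0' : A' <= A0' by rewrite ge_min lexx.
have Aeta : A' <= eta / (E * E) / 3 by rewrite ge_min lexx orbT.
have [l' [eta' [phi' [l0' eta0' phi0' phil' Hbowl']]]] := HA' A' Ap' AA0'.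
have l00' : `|0 : R| <= l' by rewrite normr0 ltW.
pose a1 := - Num.min (eta' / E) (eps / 2).
have mp : 0 < Num.min (eta' / E) (eps / 2) by rewrite lt_min !divr_gt0.
have a10 : a1 < 0 by rewrite /a1 oppr_lt0.
have a1e : - eps < a1.
  rewrite /a1 ltrN2; apply: (@le_lt_trans _ _ (eps / 2)); first by rewrite ge_min lexx orbT.
  by clear -eps0; lra.
have a1eta : E * `|a1| <= eta'.
  rewrite /a1 normrN gtr0_norm// mulrC -ler_pdivlMr//.
  by rewrite ge_min lexx.
have [fdec [N N0 fN]] := flat_decay (b := - (2 * A)) sf T0 (pf_per pf) PT a1e a10 ltac:(clear -Ae eps0 Ap; lra) ltac:(clear -Ap; lra).
pose S := N%:R * T.
have TS : T <= S by rewrite /S ler_peMl ?(ltW T0)// ler1n.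
have M0 : 0 <= M by rewrite (le_trans _ (pf_bd pf 0 (lexx 0))).
pose B := M + expR (K * S) * `|a1|.
have B0 : 0 <= B by rewrite addr_ge0// mulr_ge0 ?expR_ge0.
pose sl := Num.min (A / 2) (- a1 / 2).
have sl0 : 0 < sl by rewrite lt_min !divr_gt0 ?oppr_gt0.
have slA : sl <= A / 2 by rewrite ge_min lexx.
have sla : sl <= - a1 / 2 by rewrite ge_min lexx orbT.
have [Y1 Y10 HY1] := @tail_small R K B S sl sl0 B0.
pose a2 := - (eta / E).
have a2n : E * `|a2| = eta by rewrite /a2 normrN gtr0_norm ?divr_gt0// mulrC divfK// gt_eqF.
pose B2 := M + eta.
have B20 : 0 <= B2 by rewrite addr_ge0// ltW.
have eE2 : 0 < eta / (E * E) / 2 by rewrite divr_gt0.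
have [Y2 Y20 HY2] := @tail_small R K B2 T _ eE2 B20.
pose r' := r + 1.
pose y := r' + Y2 + l'.
pose x1 := y + l'.
have [X HX] := tailBw 0%N.
pose s := x1 + Y1 + Y2 + l + `|X|.
have Xn := ler_norm X; have Xn0 := normr_ge0 X.
have ry : r < y - l' by rewrite /y /r'; clear -Y20; lra.
have yl : y - l' <= y + l' by clear -l0'; lra.
have rx1 : r < x1 by apply: (lt_le_trans ry).
have rsl : r < s - l by apply: (lt_trans rx1); rewrite /s; clear -Y10 Y20 Xn0; lra.
have sll : s - l <= s + l by clear -l0; lra.
have g1 : x1 + Y1 <= s - l by rewrite /s; clear -Y20 Xn0; lra.
have g2 : x1 + Y2 <= s - l by rewrite /s; clear -Y10 Xn0; lra.
have g3 : X + l <= s by rewrite /s; clear -rx1 r0 Y10 Y20 Xn; lra.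
have g4 : y - l' = r' + Y2 by rewrite /y; clear; ring.
pose D n := forall x, `|x| <= l' -> - z (y + x) (n%:R * T) <= phi' x.
pose Fl n := exists n' (ts : R), [/\ (n' < n)%N, (n <= n' + N)%N, 0 <= ts <= T &
   forall x, x1 <= x -> z x (ts + n'%:R * T) <= flow g ts a1].
have Flz n n' ts : (n' < n)%N -> (n <= n' + N)%N -> 0 <= ts <= T ->
   (forall x, x1 <= x -> z x (ts + n'%:R * T) <= flow g ts a1) ->
   forall x, `|x| <= l -> z (s + x) (n%:R * T) <= flow g ((n - n')%:R * T) a1 + sl.
  move=> n1 n2 hts H x xl; have [xl1 xl2] : - l <= x /\ x <= l by move: xl; rewrite ler_norml => /andP.
  have /andP[ts0 tsT] := hts.
  have kn : (0 < n - n')%N by rewrite subn_gt0.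
  have kN : (n - n' <= N)%N by rewrite leq_subLR.
  have kT : T <= (n - n')%:R * T by rewrite ler_peMl ?(ltW T0)// ler1n.
  have kS : (n - n')%:R * T <= S by rewrite /S; apply: ler_wpM2r; [exact: ltW|rewrite ler_nat].
  have := @flat_cmp R K B M a1 g (fun x t => z x (t + n'%:R * T)) x1 (2 * s - x1) ts S K0 gl (shift n') ts0.
  move=> HH; have {HH} := HH _ _ B0 _ (s + x) ((n - n')%:R * T).
  have -> : (n - n')%:R * T + n'%:R * T = n%:R * T by rewrite -mulrDl -natrD subnK// ltnW.
  move=> HH; apply: le_trans (HH _ _ _ _ _) _.
  - by move=> v /andP[v1 _]; exact: H.
  - by move=> v t t0; rewrite (le_trans (ler_norm _))// (pf_bd pf)// addr_ge0.
  - move=> t /andP[t0 tS]; have := flow_norm a1 sf t0.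
    have : expR (K * t) * `|a1| <= expR (K * S) * `|a1|.
      by apply: ler_wpM2r => //; rewrite ler_expR; apply: ler_wpM2l => //; exact: ltW.
    have := ler_norm (- flow g t a1); rewrite normrN /B; clear; lra.
  - by clear -g1 Y10 xl1 xl2; lra.
  - by rewrite (le_trans tsT kT) kS.
  - rewrite lerD2l; apply/ltW; apply: HY1 => //; [clear -g1 xl1 xl2; lra|clear -g1 xl1 xl2; lra|exact: ltW].
have stepB n : Bw s n -> Bw s n.+1 \/ D n.+1.
  move=> Bn.
  have [He|He] := pselect (forall t, 0 <= t <= T ->
    z (s - l) (t + n%:R * T) <= eta /\ z (s + l) (t + n%:R * T) <= eta).
    by left; exact: Bwstep.
  right.
  have [ts [hts zts]] : exists ts, 0 <= ts <= T /\ eta < z (s - l) (ts + n%:R * T).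
    apply: contrapT => nex; apply: He => t ht.
    have h1 : z (s - l) (t + n%:R * T) <= eta.
      by rewrite leNgt; apply/negP => h; apply: nex; exists t.
    split => //; apply: le_trans h1; have /andP[t0 _] := ht.
    by apply: (pf_mono pf) => //; rewrite addr_ge0.
  have /andP[ts0 tsT] := hts.
  move=> x xl; have [xl1 xl2] : - l' <= x /\ x <= l' by move: xl; rewrite ler_norml => /andP.
  apply: (@le_trans _ _ (- (3 / 2 * A'))); last exact: phil'.
  have := @flat_cmp R K B2 M a2 gm (fun x t => - z x (t + n%:R * T)) r' (s - l) ts T K0 glm (shiftm n) ts0.
  move=> HH; have {HH} := HH _ _ B20 _ (y + x) T.
  rewrite (nTS n 0) => HH; apply: le_trans (HH _ _ _ _ _) _.
  - move=> v /andP[v1 v2].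
    have f2 := fE gm gzm a2 ts sfm hts; rewrite a2n ler_norml in f2.
    have : z (s - l) (ts + n%:R * T) <= z v (ts + n%:R * T).
      by apply: (pf_mono pf) => //; [rewrite /r' in v1; clear -v1; lra|rewrite addr_ge0].
    by clear -zts f2; lra.
  - by move=> v t t0; rewrite (le_trans (ler_norm _))// normrN (pf_bd pf)// addr_ge0.
  - move=> t ht; have f2 := fE gm gzm a2 t sfm ht; rewrite a2n ler_norml in f2.
    by rewrite /B2; clear -f2 M0; lra.
  - by clear -xl1 xl2 g2 g4 Y20; rewrite /x1 in g2; lra.
  - by rewrite tsT lexx.
  - have a20 : a2 <= 0 by rewrite oppr_le0 ltW ?divr_gt0.
    have f3 := flow_gap K0 glm a20 (ltW T0).
    rewrite (flow_zero sfm (ltW T0)) !sub0r opprK mulNr expRN -/E in f3.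
    have f4 : E^-1 * (eta / E) = eta / (E * E) by field; rewrite gt_eqF.
    rewrite f4 in f3.
    have := HY2 r' (s - l) (y + x) T; move=> HH2; have {HH2} := HH2 _ _ (lexx _) (ltW K0).
    move=> HH2; have := HH2 ltac:(clear -xl1 g4; lra) ltac:(clear -xl2 g2; rewrite /x1 in g2; lra).
    by clear -f3 Aeta; lra.
have stepD n : D n -> D n.+1 \/ Fl n.+1.
  move=> Dn.
  have [He|He] := pselect (forall t, 0 <= t <= T ->
    - z (y - l') (t + n%:R * T) <= eta' /\ - z (y + l') (t + n%:R * T) <= eta').
    left => x xl; rewrite -(nTS n 0).
    apply: (Hbowl' (fun x t => - z x (t + n%:R * T)) y (shiftm n)) => // v vl.
    by rewrite add0r; exact: Dn.
  right.
  have [ts [hts zts]] : exists ts, 0 <= ts <= T /\ z x1 (ts + n%:R * T) < - eta'.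
    apply: contrapT => nex; apply: He => t ht; have /andP[t0 _] := ht.
    have h1 : - eta' <= z x1 (t + n%:R * T).
      by rewrite leNgt; apply/negP => h; apply: nex; exists t.
    have h2 : z (y + l') (t + n%:R * T) <= z (y - l') (t + n%:R * T).
      by apply: (pf_mono pf) => //; rewrite addr_ge0.
    by split; rewrite lerNl; [exact: le_trans h2|exact: h1].
  have /andP[ts0 tsT] := hts.
  exists n, ts; split => //; first by rewrite -addn1 leq_add2l.
  move=> x hx; have h1 : z x (ts + n%:R * T) <= z x1 (ts + n%:R * T).
    by apply: (pf_mono pf) => //; rewrite addr_ge0.
  have := fE g gz a1 ts sf hts; rewrite ler_norml => /andP[h2 _].
  apply: (le_trans h1); apply: (le_trans (ltW zts)); apply: le_trans h2.
  by rewrite lerN2.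
have all n : [\/ Bw s n, D n | Fl n].
  elim: n => [|n IH]; first by apply: Or31; exact: HX.
  case: IH => [/stepB[]|/stepD[]|]; try by [constructor 1|constructor 2|constructor 3].
  move=> [n' [ts [n1 n2 hts H]]].
  have [n3|n3] := ltnP n (n' + N)%N.
    by apply: Or33; exists n', ts; split => //; exact: ltnW.
  have nE : n = (n' + N)%N by apply/eqP; rewrite eqn_leq n2.
  have : Bw s n.
    move=> x xl; apply: (le_trans (Flz n n' ts n1 n2 hts H x xl)).
    apply: le_trans (phil x); have -> : (n - n')%N = N by rewrite nE addKn.
    by clear -fN slA; lra.
  by move=> /stepB[]; [constructor 1|constructor 2].
pose e0 := Num.min A (Num.min A' (- a1 / 2)).
have e00 : 0 < e0 by rewrite lt_min Ap lt_min Ap' divr_gt0 ?oppr_gt0.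
have eA : e0 <= A by rewrite ge_min lexx.
have eA' : e0 <= A' by rewrite ge_min; apply/orP; right; rewrite ge_min lexx.
have ea : e0 <= - a1 / 2 by rewrite ge_min; apply/orP; right; rewrite ge_min lexx orbT.
have [n _ Hn] := @pf_close _ _ _ _ _ _ _ _ _ _ _ _ _ pf e0 (`|s| + `|y|) 0%N e00.
have hs := Hn s ltac:(by rewrite lerDl); have hy := Hn y ltac:(by rewrite lerDr).
rewrite !ltr_norml in hs hy.
case: (all n) => [/Bwz|/(_ 0 l00')|[n' [ts [n1 n2 hts H]]]].
- by clear -hs eA Ap; lra.
- by rewrite addr0 phi0'; clear -hy eA' Ap'; lra.
- have := Flz n n' ts n1 n2 hts H 0 l00; rewrite addr0.
  have := fdec (n - n')%N ltac:(by rewrite subn_gt0); clear -hs ea sla; lra.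
Qed.



Lemma profile_of (R : realType) (T : R) (f fu : R -> R -> R) (u0 : R -> R)
  (u : R -> R -> R) (p : R -> R) :
  regular T f fu -> admissible_u0 u0 -> cauchy_sol f u0 u -> bounded_sol u ->
  X_per f T p -> 0 < p 0 -> omega_tilde_mem f T u (fun _ t => p t) ->
  exists c M K L r : R, [/\ 0 < c, forall t, 0 <= t -> c <= p t <= M - c &
    profile T K L (c / 2) M r (c / 2) (pert f p M 1) (pert f p M (- 1))
      (pert_dz fu p 1) (pert_dz fu p (- 1)) (dev u p T 1)].
Proof.
move=> rg au cs bs Xp p00 om; have T0 := rg_T rg.
have [pge [pT pd]] := Xp; have cp : continuous p by move=> t; exact: is_derive1_cont (pd t).
have [c [Mp [c0 pb]]] := per_sol_bounds rg Xp p00.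
have [K0 [M0 [r0 [ub ps psr]]]] := pos_sol_u rg au cs bs.
have M00 : 0 <= M0 by have /andP[h1 h2] := ub 0 1 ltr01; exact: le_trans h1 h2.
have Mp0 : 0 <= Mp by have /andP[h1 h2] := pb 0 (lexx _); rewrite (le_trans _ h2)// (le_trans (ltW c0)).
pose M := M0 + Mp + c.
have M_0 : 0 <= M by rewrite /M; lra.
have pb' t : 0 <= t -> c <= p t <= M - c.
  by move=> t0; have /andP[h1 h2] := pb t t0; rewrite h1 /= /M; lra.
have uM x t : 0 < t -> u x t <= M by move=> t0; have /andP[_ h] := ub x t t0; rewrite /M; lra.
have pM t : 0 <= t -> p t <= M by move=> t0; have /andP[_ h] := pb t t0; rewrite /M; lra.
have n1 : `|1 : R| = 1 by rewrite normr1.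
have nm1 : `|- 1 : R| = 1 by rewrite normrN normr1.
have [K [L sf]] := pert_smooth rg cp c0 pb'.
have tT t : 0 <= t -> 0 < t + T by lra.
have r1 : r0 <= Num.max 0 r0 by rewrite le_max lexx orbT.
exists c, M, K, L, (Num.max 0 r0); split => //; split => //.
- exact: sf.
- exact: sf.
- by move=> a; apply: (flow_pert_opp _ (sf 1 n1) (sf (- 1) nm1)); exact: ltW.
- exact: pert_per rg pT M_0.
- exact: pert_per rg pT M_0.
- exact: dev_psol rg Xp cs.1 uM pM n1.
- have -> : (fun x t => - dev u p T 1 x t) = dev u p T (- 1).
    by apply/funext => x; apply/funext => t; rewrite /dev mul1r mulN1r.
  exact: dev_psol rg Xp cs.1 uM pM nm1.
- move=> x t t0; have tT0 := tT t t0; have /andP[h1 _] := ub x _ tT0.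
  have h2 := uM x _ tT0; have h3 := pM _ (ltW tT0); have h4 := pge (t + T).
  by rewrite /dev mul1r ler_norml; clear -h1 h2 h3 h4; lra.
- by rewrite le_max lexx.
- move=> x y t hx xy t0; rewrite /dev !mul1r lerD2r.
  by apply: (tail_mono ps) => //; [exact: le_lt_trans hx|exact: tT].
- move=> x y t xy hy t0; rewrite /dev !mul1r lerD2r.
  have := @tail_mono _ _ _ _ _ _ _ _ _ psr (- y) (- x) (t + T) _ _ (tT t t0).
  rewrite !sub0r !opprK; apply; last by rewrite lerN2.
  by rewrite ltrNr; apply: (lt_le_trans hy); rewrite lerN2.
- by rewrite divr_gt0.
- move=> t t0; have tT0 := tT t t0; have c2 : 0 < c / 2 by rewrite divr_gt0.
  have [X1 H1] := tail_decay ps tT0 c2; have [X2 H2] := tail_decay psr tT0 c2.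
  exists (Num.max X1 X2) => x; rewrite ge_max => /andP[x1 x2].
  have /andP[h _] := pb' _ (ltW tT0); rewrite /dev mul1r.
  suff : u x (t + T) <= c / 2 by clear -h; lra.
  have [x0|x0] := lerP 0 x; first by apply: H1; rewrite ger0_norm in x1.
  by have := H2 (- x); rewrite sub0r opprK; apply; rewrite ltr0_norm in x2.
- move=> e S N e0; have [_ [k [kp [kN kc]]]] := om.
  have S0 : 0 < `|S| + 1 by rewrite ltr_wpDl.
  have [J1 HJ1] := kc _ _ S0 e0; have [J2 HJ2] := kN N.+1.
  have h1 := HJ1 (maxn J1 J2) (leq_maxl _ _); have h2 := HJ2 (maxn J1 J2) (leq_maxr _ _).
  move: h1 h2; case: (k _) (kp (maxn J1 J2)) => // n _ h1 h2.
  exists n => // x xS.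
  have := h1 x 0; rewrite normr0 add0r (ltW S0) => /(_ _ isT) h.
  have nE : n%:R * T + T = n.+1%:R * T by rewrite -natr1 mulrDl mul1r.
  rewrite /dev mul1r nE.
  have := periodicn pT n.+1 0; rewrite add0r => ->; apply: h.
  by rewrite (le_trans xS)// (le_trans (ler_norm S))// lerDl.
Qed.

Theorem theorem1p5 (R : realType) (T : R) (f : R -> R -> R) (u0 : R -> R)
  (u : R -> R -> R) (p : R -> R) :
  0 < T ->
  loc_holder f -> C1_u_loclip f -> f_zero f -> f_periodic T f ->
  admissible_u0 u0 ->
  cauchy_sol f u0 u -> bounded_sol u ->
  X_per f T p ->
  ((exists eps : R, 0 < eps /\
      forall a : R, p 0 - eps < a -> a < p 0 -> T_mono_decreasing f T a) \/
   (exists eps : R, 0 < eps /\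
      forall a : R, p 0 - eps < a -> a < p 0 + eps -> T_mono_nonincreasing f T a)) ->
  ~ omega_tilde_mem f T u (fun _ t => p t).
Proof.
move=> T0 fh fC f0 fT au cs bs Xp mono om.
have [fu rg] := regular_of T0 fh fC f0 fT.
have [eps eps0 Hm] : exists2 eps : R, 0 < eps & forall a : R, p 0 - eps < a -> a < p 0 ->
    T_mono_nonincreasing f T a.
  case: mono => -[eps [eps0 H]]; exists eps => // a a1 a2; first by right; exact: H.
  by apply: H => //; clear -a2 eps0; lra.
have p00 : 0 < p 0.
  have pa : 0 <= p 0 - eps / 2.
    have [|//|[h [[<- [h0 _]] _]]|[h [[<- [h0 _]] _]]] := Hm (p 0 - eps / 2); try exact: h0.
    - by clear -eps0; lra.
    - by clear -eps0; lra.
  by clear -pa eps0; lra.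
have [c [M [K [L [r [c0 pb pf]]]]]] := profile_of rg au cs bs Xp p00 om.
have E0 : 0 < expR (K * T) by exact: expR_gt0.
have ret (h : R -> R) a : expR (K * T) * `|a| <= c / 2 -> ode_sol_from f (p 0 + a) h ->
    h (0 + T) = p 0 + flow (pert f p M 1) T a /\ h 0 = p 0 + a.
  move=> ha hs; rewrite add0r; split; last exact: hs.1.
  exact: flow_of_sol rg Xp c0 pb (pf_sf pf) ha hs.
have down a : expR (K * T) * `|a| <= c / 2 -> T_mono_decreasing f T (p 0 + a) ->
    flow (pert f p M 1) T a < a.
  move=> ha [h [hs hd]]; have [h1 h2] := ret h a ha hs.
  by have := hd 0 (lexx _); rewrite h1 h2 ltrD2l.
have fix_ a : expR (K * T) * `|a| <= c / 2 -> T_periodic_sol f T (p 0 + a) ->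
    flow (pert f p M 1) T a = a.
  move=> ha [h [hs hd]]; have [h1 h2] := ret h a ha hs.
  by have := hd 0 (lexx _); rewrite h1 h2 => /addrI.
pose d := Num.min (c / 2 / expR (K * T)) (Num.min (c / 2) (flow_rad K (c / 2) T)).
have rad0 : 0 < flow_rad K (c / 2) T by rewrite mulr_gt0 ?expR_gt0// divr_gt0.
have d0 : 0 < d by rewrite !lt_min rad0 !divr_gt0.
have dE a : `|a| <= d -> expR (K * T) * `|a| <= c / 2.
  by move=> ad; rewrite mulrC -ler_pdivlMr// (le_trans ad)// ge_min lexx.
have d1 : d <= c / 2 by rewrite /d !ge_min lexx !orbT.
have d2 : d <= flow_rad K (c / 2) T by rewrite /d !ge_min lexx !orbT.
case: mono => -[e [ep H]]; pose b := Num.min e d;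
  have b0 : 0 < b by rewrite lt_min ep.
  apply: (case_unstable pf b0) => a a1 a2.
  have be : b <= e by rewrite ge_min lexx.
  have bd : b <= d by rewrite ge_min lexx orbT.
  apply: down; last by apply: H; [clear -a1 be|clear -a2]; lra.
  by apply: dE; rewrite ler0_norm ?(ltW a2)//; clear -a1 bd; lra.
have be : b <= e by rewrite ge_min lexx.
have bd : b <= d by rewrite ge_min lexx orbT.
have sm a : `|a| < b -> expR (K * T) * `|a| <= c / 2 /\ T_mono_nonincreasing f T (p 0 + a).
  move=> ab; split; first by apply: dE; rewrite ltW// (lt_le_trans ab).
  by move: ab; rewrite ltr_norml => /andP[a1 a2]; apply: H; [clear -a1 be|clear -a2 be]; lra.
have [[q [q1 q2 Pq]]|nq] := pselect (exists q, [/\ - b < q, q < 0 & flow (pert f p M 1) T q = q]).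
  apply: (case_periodic (q := q) (eps := b) pf q2) => //.
  - by clear -q1 bd d1; lra.
  - by clear -q1 bd d2; lra.
  - move=> a /andP[a1 a2]; have ab : `|a| < b by rewrite ltr_norml a2 (lt_le_trans q1).
    by have [ha [/(fix_ _ ha)->|/(down _ ha)/ltW]] := sm a ab.
apply: (case_unstable pf b0) => a a1 a2.
have ab : `|a| < b by rewrite ltr0_norm//; clear -a1; lra.
have [ha [/(fix_ _ ha) h|/(down _ ha)//]] := sm a ab.
by exfalso; apply: nq; exists a.
Qed.
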